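(* Let $0<H<1$. Let $\{Y_t\}$ be a stationary CARFIMA$(p,H,q)$ process with parameters $\alpha_0,\dots,\alpha_p,\beta_1,\dots,\beta_q,H,\sigma$ (as defined in the context; in particular all eigenvalues of the companion matrix $A$ have negative real parts), and for $h\ge0$ let $\gamma_Y(h)=\operatorname{cov}(Y_{t+h},Y_t)$ be its autocovariance function. (a) For $h\ge 0$, $$\gamma_Y(h)=H\beta'Ae^{Ah}\Big(\int_0^h e^{-Au}u^{2H-1}\,du\Big)V^*\beta-H\beta'Ae^{-Ah}\Big(\int_h^\infty e^{Au}u^{2H-1}\,du\Big)V^*\beta-H\beta'Ae^{Ah}\Big(\int_0^\infty e^{Au}u^{2H-1}\,du\Big)V^*\beta,$$ where $V^*=\sigma^2\int_0^\infty e^{Au}\delta_p\delta_p'e^{A'u}\,du$. (b) If the eigenvalues $\lambda_1,\dots,\lambda_p$ of $A$ are distinct, then for $h\ge0$ $$\gamma_Y(h)=\frac{\sigma^2}{2}\Gamma(2H+1)\sum_{i=1}^p\frac{\beta(\lambda_i)\beta(-\lambda_i)}{\alpha^{(1)}(\lambda_i)\alpha(-\lambda_i)}\,u(H,\lambda_i,h),$$ where $\alpha(z)=z^p-\alpha_pz^{p-1}-\cdots-\alpha_1$, $\alpha^{(1)}$ is its first derivative, $\beta(z)=1+\beta_1z+\beta_2z^2+\cdots+\beta_qz^q$, and $$u(H,\lambda,h)=2(-\lambda)^{1-2H}\cosh(\lambda h)+\lambda^{1-2H}e^{\lambda h}P(2H,\lambda h)-(-\lambda)^{1-2H}e^{-\lambda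 h}P(2H,-\lambda h),$$ with $P(a,z)=\frac{1}{\Gamma(a)}\int_0^z e^{-u}u^{a-1}\,du$, the integration being along the radial line in the complex plane from $0$ to $z$. (c) If $H\ne 1/2$, then as $h\to\infty$ $$\gamma_Y(h)\sim\sigma^2H(2H-1)\frac{\beta^2(0)}{\alpha^2(0)}h^{2H-2},$$ where $\alpha(\cdot)$ and $\beta(\cdot)$ are the polynomials given in (b) and ''$\sim$'' means that the ratio of the left- and right-hand sides converges to $1$.
   Context: Prime denotes transpose. $\{B_t^H\}_{t\in\mathbb{R}}$ is a standard (two-sided) fractional Brownian motion with Hurst parameter $H\in(0,1)$: a zero-mean Gaussian process with $B_0^H=0$ and $E(B_t^HB_s^H)=\frac12\{|t|^{2H}+|s|^{2H}-|t-s|^{2H}\}$. Parameters: integers $p\ge1$, $0\le q<p$; real $\alpha_0,\dots,\alpha_p,\beta_1,\dots,\beta_q$ with $\alpha_1\ne0$ and (if $q\ge1$) $\beta_q\ne0$; $\sigma>0$. $A$ is the $p\times p$ companion matrix whose $(i,i+1)$ entries are $1$ for $1\le i\le p-1$, whose last row is $(\alpha_1,\dots,\alpha_p)$, and all of whose other entries are $0$ (for $p=1$, $A=(\alpha_1)$). $\delta_p=(0,\dots,0,1)'\in\mathbb{R}^p$. $\beta=(1,\beta_1,\dots,\beta_{p-1})'\in\mathbb{R}^p$ with $\beta_j=0$ for $j>q$ (the vector $\beta$ is distinguished from the polynomial $\beta(\cdot)$ by the absence of an argument). A CARFIMA$(p,H,q)$ process is $Y_t=\beta'X_t$, where $dX_t=(AX_t+\alpha_0\delta_p)\,dt+\sigma\delta_p\,dB_t^H$.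 When all eigenvalues of $A$ have negative real parts, the stationary CARFIMA process is $$Y_t=-\frac{\alpha_0}{\alpha_1}+\sigma\int_{-\infty}^t\beta'e^{A(t-u)}\delta_p\,dB_u^H,$$ the stochastic integral of the deterministic integrand being the mean-square limit of Riemann sums. ''Stationarity'' refers to this situation. Complex powers use the principal branch, the argument of $u$ being constant and equal to that of $z$ along the radial line in the definition of $P(a,z)$, consistently with the branch used for $\lambda^{1-2H}$ and $(-\lambda)^{1-2H}$. *)

(* Defs.v *)
From HB Require Import structures.
From mathcomp Require Import all_boot all_order all_algebra.
From mathcomp Require Import complex.
From mathcomp Require Import all_classical all_reals all_analysis.

Set Implicit Arguments.
Unset Strict Implicit.
Unset Printing Implicit Defensive.

Import Order.TTheory GRing.Theory Num.Theory.
Import numFieldNormedType.Exports.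

Local Open Scope classical_set_scope.
Local Open Scope ring_scope.
Local Open Scope complex_scope.

Section matrix_functions.
Context {R : realType}.

(* The limit is taken entry by entry. *)
Definition expmx n (M : 'M[R]_n) : 'M[R]_n :=
  \matrix_(i, j) limn (series (fun k : nat => (M ^+ k) i j / k`!%:R)).

Definition mxRintegral m n (D : set R) (F : R -> 'M[R]_(m, n)) : 'M[R]_(m, n) :=
  \matrix_(i, j) (\int[lebesgue_measure]_(u in D) F u i j).

End matrix_functions.

Section complex_functions.
Context {R : realType}.
Implicit Types (z : R[i]) (a : R).

Definition cexp z : R[i] :=
  (expR (complex.Re z))%:C * (cos (complex.Im z) +i* sin (complex.Im z)).

Definition ccosh z : R[i] := (cexp z + cexp (- z)) / 2%:R.

(* Principal argument, with values in ]-pi, pi] for z != 0. *)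
Definition carg z : R :=
  let c := acos (complex.Re z / ComplexField.Normc.normc z) in
  if 0 <= complex.Im z then c else - c.

Definition clog z : R[i] := ln (ComplexField.Normc.normc z) +i* carg z.

(* Principal branch of z ^ a for a real exponent a; the value at z = 0 follows
   the convention of powR. *)
Definition cpow z a : R[i] :=
  if z == 0 then (a == 0)%:R else cexp (a%:C * clog z).

Definition cintegral (D : set R) (f : R -> R[i]) : R[i] :=
  (\int[lebesgue_measure]_(x in D) complex.Re (f x)) +i*
  (\int[lebesgue_measure]_(x in D) complex.Im (f x)).

Definition Gamma a : R :=
  \int[lebesgue_measure]_(t in `]0, +oo[) (t `^ (a - 1) * expR (- t)).

(* The radial path from 0 to z is u = t z with 0 <= t <= 1; for t > 0 the
   principal argument of t z is that of z. *)
Definition incP a z : R[i] :=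
  (Gamma a)^-1%:C *
  cintegral `[0, 1] (fun t => cexp (- (t%:C * z)) * cpow (t%:C * z) (a - 1) * z).

End complex_functions.

Section fractional_brownian_motion.
Context d (T : measurableType d) (R : realType) (P : probability T R).
Local Open Scope ereal_scope.

(* normal_prob m 0 is not a point mass, so the degenerate Gaussian law
   (standard deviation 0) is handled separately. *)
Definition gaussian_rv (X : T -> R) : Prop :=
  exists m s : R, forall A : set R, measurable A ->
    P (X @^-1` A) = if s == 0%R then \d_m A else normal_prob m s A.

Definition gaussian_process (X : R -> {RV P >-> R}) : Prop :=
  forall (n : nat) (c t : 'I_n -> R),
    gaussian_rv (fun w => \sum_(i < n) c i * X (t i) w)%R.

Definition fractional_brownian_motion (H : R) (B : R -> {RV P >-> R}) : Prop :=
  [/\ gaussian_process B,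
      {ae P, forall w, B 0%R w = 0%R},
      forall t, 'E_P[B t] = 0 &
      forall t s, 'E_P[(fun w => B t w * B s w)%R] =
        (2^-1 * (`|t| `^ (2 * H) + `|s| `^ (2 * H) - `|t - s| `^ (2 * H)))%:E].

(* The points of the partition of [a, b] are a :: s, with tau i the tag of its
   i-th cell. *)
Definition riemann_sum (B : R -> T -> R) (f : R -> R) (a b : R) (s : seq R)
    (tau : nat -> R) (w : T) : R :=
  (\sum_(i < size s)
     f (tau i) * (B (nth b (a :: s) i.+1) w - B (nth b (a :: s) i) w))%R.

(* I is (a version of) the mean-square limit of the Riemann sums of
   \int_a^b f dB as the mesh tends to 0, for arbitrary tags. *)
Definition is_ms_integral (B : R -> {RV P >-> R}) (f : R -> R) (a b : R)
    (I : {RV P >-> R}) : Prop :=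
  forall e : R, (0 < e)%R -> exists2 delta : R, (0 < delta)%R &
    forall (s : seq R) (tau : nat -> R),
      itv_partition a b s ->
      (forall i, (i < size s)%N ->
        (nth b (a :: s) i.+1 - nth b (a :: s) i < delta)%R /\
        (nth b (a :: s) i <= tau i <= nth b (a :: s) i.+1)%R) ->
      'E_P[(fun w => (riemann_sum B f a b s tau w - I w) ^+ 2)%R] < e%:E.

(* \int_{-oo}^b f dB as the mean-square limit of \int_a^b f dB as a -> -oo. *)
Definition is_ms_integral_ninfty (B : R -> {RV P >-> R}) (f : R -> R) (b : R)
    (J : {RV P >-> R}) : Prop :=
  exists I : R -> {RV P >-> R},
    (forall a, (a < b)%R -> is_ms_integral B f a b (I a)) /\
    'E_P[(fun w => (I a w - J w) ^+ 2)%R] @[a --> -oo%R] --> 0.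

End fractional_brownian_motion.

(* The parameters are families alpha, beta : nat -> R of which only
   alpha 0, ..., alpha p and beta 1, ..., beta q are used. *)
Section carfima.
Context {R : realType}.
Variables (p q : nat) (alpha beta : nat -> R) (sigma : R).

Definition companion : 'M[R]_p :=
  \matrix_(i, j) if i.+1 == p then alpha j.+1 else (j == i.+1 :> nat)%:R.

Definition delta_vec : 'cV[R]_p := \col_i (i.+1 == p)%:R.

Definition beta_coef (j : nat) : R :=
  if j == 0%N then 1 else if (j <= q)%N then beta j else 0.

Definition beta_vec : 'cV[R]_p := \col_j beta_coef j.

Definition alpha_poly : {poly R} := 'X^p - \sum_(i < p) alpha i.+1 *: 'X^i.

Definition beta_poly : {poly R} := 1 + \sum_(1 <= j < q.+1) beta j *: 'X^j.

Definition companionC : 'M[R[i]]_p := map_mx (real_complex R) companion.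

Definition alpha_polyC : {poly R[i]} := map_poly (real_complex R) alpha_poly.

Definition beta_polyC : {poly R[i]} := map_poly (real_complex R) beta_poly.

Definition carfima_kernel (x : R) : R :=
  (beta_vec^T *m expmx (x *: companion) *m delta_vec) 0 0.

(* The random variables Y t are only determined up to the choice of a version J
   of the stochastic integral. *)
Definition stationary_carfima d (T : measurableType d) (P : probability T R)
    (B Y : R -> {RV P >-> R}) : Prop :=
  (forall z : R[i], eigenvalue companionC z -> complex.Re z < 0) /\
  forall t : R, exists2 J : {RV P >-> R},
    is_ms_integral_ninfty B (fun u => carfima_kernel (t - u)) t J &
    forall w, Y t w = - (alpha 0%N / alpha 1%N) + sigma * J w.

Definition Vstar : 'M[R]_p :=
  sigma ^+ 2 *: mxRintegral `[0, +oo[ (fun u =>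
    expmx (u *: companion) *m delta_vec *m delta_vec^T
      *m expmx (u *: companion^T)).

End carfima.

Definition autocov d (T : measurableType d) (R : realType) (P : probability T R)
    (Y : R -> {RV P >-> R}) (t h : R) : \bar R :=
  covariance P (Y (t + h)) (Y t).

Definition ufun (R : realType) (H : R) (lam : R[i]) (h : R) : R[i] :=
  2%:R * cpow (- lam) (1 - 2 * H) * ccosh (lam * h%:C)
  + cpow lam (1 - 2 * H) * cexp (lam * h%:C) * incP (2 * H) (lam * h%:C)
  - cpow (- lam) (1 - 2 * H) * cexp (- (lam * h%:C))
      * incP (2 * H) (- (lam * h%:C)).

(* Main.v *)
(* Let E x = exp(x A), psi x = |x|^(2H) / 2, and let Theta h be the integral over
   w >= 0 of psi'(h - w) E w; then Xi = A^-1 (Theta - psi) satisfies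
   Xi' = Theta = A Xi + psi. Let J_t be the stochastic integral driving Y_t. If Z is
   square integrable, mu v = E[B_v Z], W' = U := A W + mu delta, and
   E l (U (t - l)) tends to 0 as l tends to infinity, then Abel summation in the
   Riemann sums gives E[J_t Z] = beta' U t. Taking Z = B_s yields E[J_t B_s] in
   terms of Theta; taking Z = J_t, for which the Lyapunov equation of V* provides W,
   yields the autocovariance beta' A (Theta h + Theta (-h)) V* beta, which is (a).

   For (b), V* beta is expanded on the eigenvectors (1, lam, ..., lam^(p-1))' of A,
   with coefficients read off the Lyapunov equation, so that only scalar integrals
   remain. They are evaluated with
   int_0^oo u^(2H-1) e^(- z u) du = Gamma(2H) z^(-2H) for Re z > 0, which follows by
   differentiation along the path tau |-> z^tau from 1 to z.

   For (c), Theta(+-h) +- A^-1 psi'(h) + A^-2 psi''(h) solves a linear equation forced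
   by A^-2 psi'''(h), hence is O(h^(2H-3)); the terms in psi' cancel in the sum, and
   the Lyapunov equation evaluates the ones in psi''. *)

Require Import Defs.
From HB Require Import structures.
From mathcomp Require Import all_boot all_order all_algebra.
From mathcomp Require Import complex.
From mathcomp Require Import all_classical all_reals all_analysis.
From mathcomp Require Import measurable_realfun.
From mathcomp Require Import ring lra.

Set Implicit Arguments.
Unset Strict Implicit.
Unset Printing Implicit Defensive.

Import Order.TTheory GRing.Theory Num.Theory.
Import numFieldNormedType.Exports.

Local Open Scope classical_set_scope.
Local Open Scope ring_scope.
Local Open Scope complex_scope.

(** * Derivatives of real and matrix functions *)

(** For [H < 1/2] the weight [|u - v|^(2H-2)] of the usual double-integral formula for covariances
    is not integrable on the diagonal, and [psi'] is unbounded at 0. A proof uniform in [H]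
    therefore differentiates neither the covariance of [B] nor [mu]. Abel summation moves the
    increments of [mu] onto the smooth kernel [beta' exp((t - v) A) delta], so only continuity of
    [mu] is used, and the double integral is split into two single ones: pairing [J_t] with [B_s]
    yields the function [mu] needed to pair it with another [J]. The price is that a primitive [W]
    adapted to [A] must be guessed each time. [Theta] itself may fail to be differentiable at 0;
    subtracting [psi] before applying [A^-1] gives [Xi], which is differentiable everywhere, and all
    guesses for [W] are built from it.

    All matrices and integrals are real. Exponential decay is obtained without Jordan form, and
    complex eigenvalues enter through real and imaginary parts: a gamma integral at a complex
    argument becomes a pair of integrals with a cosine and a sine, and an eigenvector a pair of real
    vectors. *)

Section real_derivatives.
Context {R : realType}.
Implicit Types (f g : R -> R) (x a b c : R).

Lemma derD f g x a b : is_derive x (1 : R) f a -> is_derive x (1 : R) g b ->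
  is_derive x (1 : R) (fun u => f u + g u) (a + b).
Proof. exact: is_deriveD. Qed.

Lemma derN f x a : is_derive x (1 : R) f a ->
  is_derive x (1 : R) (fun u => - f u) (- a).
Proof. exact: is_deriveN. Qed.

Lemma derB f g x a b : is_derive x (1 : R) f a -> is_derive x (1 : R) g b ->
  is_derive x (1 : R) (fun u => f u - g u) (a - b).
Proof. exact: is_deriveB. Qed.

Lemma derM f g x a b : is_derive x (1 : R) f a -> is_derive x (1 : R) g b ->
  is_derive x (1 : R) (fun u => f u * g u) (a * g x + f x * b).
Proof.
move=> fa gb; apply: (is_derive_eq (is_deriveM fa gb)).
by rewrite addrC /GRing.scale/= (mulrC a).
Qed.

Lemma der_cst a x : is_derive x (1 : R) (fun=> a) 0.
Proof. exact: is_derive_cst. Qed.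

Lemma derZ a f x b : is_derive x (1 : R) f b ->
  is_derive x (1 : R) (fun u => a * f u) (a * b).
Proof. exact: is_deriveZ. Qed.

Lemma der_sum n (f : 'I_n -> R -> R) x (a : 'I_n -> R) :
  (forall i, is_derive x (1 : R) (f i) (a i)) ->
  is_derive x (1 : R) (fun u => \sum_i f i u) (\sum_i a i).
Proof.
move=> fa.
rewrite (_ : (fun u => _) = \sum_i f i); first exact: is_derive_sum.
by apply/funext => u; rewrite fct_sumE.
Qed.

Lemma der_comp f g x a b : is_derive x (1 : R) g b ->
  is_derive (g x) (1 : R) f a -> is_derive x (1 : R) (fun u => f (g u)) (b * a).
Proof. by move=> gb fa; rewrite mulrC; exact: is_derive1_comp. Qed.

Lemma der_aff a b x : is_derive x (1 : R) (fun u => a * u + b) a.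
Proof.
have ax := derZ a (is_derive_id x (1 : R)).
by apply: (is_derive_eq (derD ax (der_cst b x))); rewrite mulr1 addr0.
Qed.

Lemma der_comp_aff f a b x d : is_derive (a * x + b) (1 : R) f d ->
  is_derive x (1 : R) (fun u => f (a * u + b)) (a * d).
Proof. by move=> fd; apply: (@der_comp f (fun u => a * u + b)) fd; exact: der_aff. Qed.

Lemma der_cts f x a : is_derive x (1 : R) f a -> {for x, continuous f}.
Proof. by case=> fx _; exact/differentiable_continuous/derivable1_diffP. Qed.

(** Both [g - f] and [g + f] are nondecreasing. This comparison with an explicit majorant [g]
    replaces integral estimates in all later error bounds. *)
Lemma der_bound f g (df dg : R -> R) a b : a <= b ->
  (forall x, a <= x <= b -> is_derive x (1 : R) f (df x)) ->
  (forall x, a <= x <= b -> is_derive x (1 : R) g (dg x)) ->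
  (forall x, a <= x <= b -> `|df x| <= dg x) ->
  `|f b - f a| <= g b - g a.
Proof.
move=> ab fd gd dfg.
have H (s : R) : `|s| = 1 -> s * (f b - f a) <= g b - g a.
  move=> s1.
  have hd x : a <= x <= b -> is_derive x (1 : R) (fun u => g u - s * f u)
      (dg x - s * df x).
    by move=> xab; apply: derB; [exact: gd|apply: derZ; exact: fd].
  have [x||x xab] := @MVT_segment _ (fun u => g u - s * f u)
      (fun x => dg x - s * df x) a b ab.
  - by rewrite in_itv/= => /andP[/ltW ax /ltW xb]; apply: hd; rewrite ax.
  - apply: continuous_in_subspaceT => x.
    by rewrite inE/= in_itv/= => /hd/der_cts.
  have h0 : 0 <= dg x - s * df x.
    rewrite subr_ge0 (le_trans _ (dfg x _))//.
    by rewrite (le_trans (ler_norm _))// normrM s1 mul1r.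
  have : 0 <= (dg x - s * df x) * (b - a) by rewrite mulr_ge0// subr_ge0.
  by move=> + e; rewrite -e; lra.
rewrite ler_norml -[X in _ && (X <= _)]mul1r H ?normr1// andbT lerNl -mulN1r.
by rewrite H// normrN1.
Qed.

(** By the mean value theorem a difference quotient at [a] is a value of [df] at a nearby point, and
    [df] is continuous at [a]. It serves for [Xi] at 0, where the formula for its derivative cannot
    be obtained termwise. *)
Lemma der_extend f (df : R -> R) a : continuous f -> {for a, continuous df} ->
  (forall x, x != a -> is_derive x (1 : R) f (df x)) ->
  is_derive a (1 : R) f (df a).
Proof.
move=> cf cdf fd.
have key : h^-1 *: (f (h + a) - f a) @[h --> 0^'] --> df a.
  apply/cvgrPdist_le => e e0.
  have /cvgrPdist_le/(_ e e0)[r/= r0 Hr] := cdf.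
  rewrite near_withinE; exists r => // h; rewrite /ball_ /= sub0r normrN => hr h0.
  (* The mean value theorem asks for a derivative in the open interval only, so [a] may be either
     endpoint; the two cases give the two one-sided quotients. *)
  have main u v c : u < v -> (c == u) || (c == v) -> c = a ->
      exists2 z, u < z < v & f v - f u = df z * (v - u).
    move=> uv cuv ca.
    have [x||x xuv ->] := @MVT _ f df u v uv.
    - rewrite in_itv/= => /andP[ux xv]; apply: fd; rewrite -ca.
      by move: cuv => /orP[]/eqP->; [rewrite gt_eqF|rewrite lt_eqF].
    - exact: continuous_subspaceT.
    by exists x => //; rewrite in_itv/= in xuv.
  suff [z zr ->] : exists2 z, `|a - z| < r & h^-1 *: (f (h + a) - f a) = df z.
    exact: Hr.
  have [hp|hn] := ltP 0 h.
    have ah : a < h + a by rewrite ltrDr.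
    have aa : (a == a) || (a == h + a) by rewrite eqxx.
    have [z /andP[az zh] ->] := main a (h + a) a ah aa erefl.
    rewrite addrK /GRing.scale/= mulrCA mulVf// mulr1; exists z => //.
    by rewrite ltr_norml; move: hr; rewrite gtr0_norm//; lra.
  have {}hn : h < 0 by rewrite lt_neqAle h0.
  have ha : h + a < a by rewrite gtrDr.
  have aa : (a == h + a) || (a == a) by rewrite eqxx orbT.
  have [z /andP[az zh] e1] := main (h + a) a a ha aa erefl.
  exists z; first by rewrite ltr_norml; move: hr; rewrite ltr0_norm//; lra.
  rewrite /GRing.scale/= -opprB e1 opprD addrCA subrr addr0 !mulrN opprK.
  by rewrite mulrCA mulVf// mulr1.
have E : (fun h : R => h^-1 *: ((f \o shift a) (h *: (1 : R)) - f a)) =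
    (fun h => h^-1 *: (f (h + a) - f a)).
  by apply/funext => h /=; rewrite [h *: _]mulr1.
apply: DeriveDef; first by rewrite /derivable E; apply/cvg_ex; exists (df a).
by rewrite /derive E; apply/cvg_lim; first exact: Rhausdorff.
Qed.

Lemma cvg_sumr T (F : set_system T) {FF : Filter F} n (f : 'I_n -> T -> R)
    (a : 'I_n -> R) : (forall i, f i x @[x --> F] --> a i) ->
  \sum_i f i x @[x --> F] --> \sum_i a i.
Proof.
move=> fa; rewrite (_ : (fun u => _) = \sum_i f i).
  by elim/big_ind2 : _ => [|? ? ? ? ? ?|i _]; [exact: cvg_cst|exact: cvgD|exact: fa].
by apply/funext => u; rewrite fct_sumE.
Qed.

End real_derivatives.

Section matrix_derivatives.
Context {R : realType}.

Lemma mxBE m n (M N : 'M[R]_(m, n)) i j : (M - N) i j = M i j - N i j.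
Proof. by rewrite !mxE. Qed.

Lemma mxNE m n (M : 'M[R]_(m, n)) i j : (- M) i j = - M i j.
Proof. by rewrite !mxE. Qed.

(** Entrywise, in agreement with [expmx] and [mxRintegral], so that no norm on matrices
    intervenes. *)
Definition mxder m n (F : R -> 'M[R]_(m, n)) (x : R) (D : 'M[R]_(m, n)) :=
  forall i j, is_derive x (1 : R) (fun u => F u i j) (D i j).

Lemma mxder_eq m n (F : R -> 'M[R]_(m, n)) x D D' :
  mxder F x D -> D = D' -> mxder F x D'.
Proof. by move=> + <-. Qed.

Lemma mxder_cst m n (M : 'M[R]_(m, n)) x : mxder (fun=> M) x 0.
Proof. by move=> i j; rewrite mxE; exact: der_cst. Qed.

Lemma mxderD m n (F G : R -> 'M[R]_(m, n)) x D D' : mxder F x D ->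
  mxder G x D' -> mxder (fun u => F u + G u) x (D + D').
Proof.
move=> FD GD i j; rewrite mxE.
by under eq_fun do rewrite mxE; apply: derD.
Qed.

Lemma mxderN m n (F : R -> 'M[R]_(m, n)) x D : mxder F x D ->
  mxder (fun u => - F u) x (- D).
Proof.
move=> FD i j; rewrite mxE.
by under eq_fun do rewrite mxE; apply: derN.
Qed.

Lemma mxderB m n (F G : R -> 'M[R]_(m, n)) x D D' : mxder F x D ->
  mxder G x D' -> mxder (fun u => F u - G u) x (D - D').
Proof. by move=> FD GD; apply: mxderD => //; exact: mxderN. Qed.

Lemma mxderM m n k (F : R -> 'M[R]_(m, n)) (G : R -> 'M[R]_(n, k)) x D D' :
  mxder F x D -> mxder G x D' ->
  mxder (fun u => F u *m G u) x (D *m G x + F x *m D').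
Proof.
move=> FD GD i j; rewrite !mxE -big_split/=.
under eq_fun do rewrite mxE.
by apply: der_sum => l; exact: derM.
Qed.

Lemma mxderMl m n k (M : 'M[R]_(m, n)) (G : R -> 'M[R]_(n, k)) x D :
  mxder G x D -> mxder (fun u => M *m G u) x (M *m D).
Proof.
move=> GD; apply: mxder_eq (mxderM (mxder_cst M x) GD) _.
by rewrite mul0mx add0r.
Qed.

Lemma mxderMr m n k (M : 'M[R]_(n, k)) (G : R -> 'M[R]_(m, n)) x D :
  mxder G x D -> mxder (fun u => G u *m M) x (D *m M).
Proof.
move=> GD; apply: mxder_eq (mxderM GD (mxder_cst M x)) _.
by rewrite mulmx0 addr0.
Qed.

Lemma mxderZ m n (f : R -> R) (F : R -> 'M[R]_(m, n)) x d D :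
  is_derive x (1 : R) f d -> mxder F x D ->
  mxder (fun u => f u *: F u) x (d *: F x + f x *: D).
Proof.
move=> fd FD i j; rewrite !mxE.
by under eq_fun do rewrite mxE; apply: derM.
Qed.

Lemma mxder_tr m n (F : R -> 'M[R]_(m, n)) x D : mxder F x D ->
  mxder (fun u => (F u)^T) x D^T.
Proof. by move=> FD i j; rewrite mxE; under eq_fun do rewrite mxE; exact: FD. Qed.

Lemma mxder_aff m n (F : R -> 'M[R]_(m, n)) a b x D :
  mxder F (a * x + b) D -> mxder (fun u => F (a * u + b)) x (a *: D).
Proof. by move=> FD i j; rewrite mxE; exact: (@der_comp_aff _ (fun u => F u i j)). Qed.

Lemma mxder0_cst m n (F : R -> 'M[R]_(m, n)) x y :
  (forall u, mxder F u 0) -> F x = F y.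
Proof.
move=> F0; apply/matrixP => i j.
apply: (@is_derive_0_is_cst _ (fun u => F u i j)) => u.
by have := F0 u i j; rewrite mxE.
Qed.

Lemma mxder_ext m n (F G : R -> 'M[R]_(m, n)) x D :
  F =1 G -> mxder F x D -> mxder G x D.
Proof. by move=> /funext ->. Qed.

End matrix_derivatives.

(** * The matrix exponential *)

Section matrix_exponential.
Context {R : realType}.
Variable n : nat.
Implicit Types (A : 'M[R]_n) (x y : R).

(** A crude majorant, at least every row sum; it suffices to dominate the exponential series by that
    of [exp(mxmaj A |x|)]. *)
Definition mxmaj A : R := \sum_i \sum_j `|A i j|.

Lemma mxmaj_ge0 A : 0 <= mxmaj A.
Proof. by apply: sumr_ge0 => i _; exact: sumr_ge0. Qed.

Lemma mxmaj_row A i : \sum_j `|A i j| <= mxmaj A.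
Proof.
rewrite /mxmaj [leRHS](bigD1 i)//= lerDl; apply: sumr_ge0 => k _.
exact: sumr_ge0.
Qed.

Lemma mxpow_bound A k i j : `|(A ^+ k) i j| <= mxmaj A ^+ k.
Proof.
elim: k i j => [|k IH] i j.
  by rewrite !expr0 mxE; case: (i == j); rewrite ?normr1 ?normr0.
rewrite exprS mxE (le_trans (ler_norm_sum _ _ _))//.
rewrite [leRHS]exprS (le_trans _ (ler_wpM2r _ (mxmaj_row A i)))//; last first.
  by rewrite exprn_ge0// mxmaj_ge0.
by rewrite mulr_suml ler_sum// => l _; rewrite normrM ler_wpM2l.
Qed.

Definition mxexp_coef A i j (k : nat) : R := (A ^+ k) i j / k`!%:R.

Lemma is_cvg_mxexp_coef A i j x : cvgn (pseries (mxexp_coef A i j) x).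
Proof.
apply: normed_cvg.
apply: (@series_le_cvg _ _ (exp_coeff (mxmaj A * `|x|))) => [k|k|k|].
- exact: normr_ge0.
- by apply: exp_coeff_ge0; rewrite mulr_ge0// mxmaj_ge0.
- rewrite /mxexp_coef/exp_coeff/= !normrM normfV normr_nat normrX exprMn.
  by rewrite mulrAC ler_wpM2r// ler_wpM2r// mxpow_bound.
- exact: is_cvg_series_exp_coeff.
Qed.

Lemma mxpowZ A x k : (x *: A) ^+ k = x ^+ k *: A ^+ k.
Proof.
elim: k => [|k IH]; first by rewrite !expr0 scale1r.
by rewrite !exprS IH -scalerA -[LHS]/(_ *m _) -scalemxAl -scalemxAr.
Qed.

Lemma expmxE A x i j : expmx (x *: A) i j = limn (pseries (mxexp_coef A i j) x).
Proof.
rewrite mxE; congr (limn (series _)); apply/funext => k.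
by rewrite mxpowZ mxE /mxexp_coef mulrAC mulrC mulrA mulrAC.
Qed.

Lemma mulr_divfact (c : R) k : k.+1%:R * (c / k.+1`!%:R) = c / k`!%:R.
Proof. by rewrite factS natrM mulrCA invfM mulVKf. Qed.

Lemma mxexp_coef_diffs A i j k :
  pseries_diffs (mxexp_coef A i j) k = (A ^+ k.+1) i j / k`!%:R.
Proof. exact: mulr_divfact. Qed.

Arguments is_cvg_mxexp_coef : clear implicits.

Lemma lim_sum_pseries (c : 'I_n -> nat -> R) (a : 'I_n -> R) x :
  (forall l, cvgn (pseries (c l) x)) ->
  cvgn (pseries (fun k => \sum_l a l * c l k) x) /\
  limn (pseries (fun k => \sum_l a l * c l k) x) =
    \sum_l a l * limn (pseries (c l) x).
Proof.
move=> cc.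
have E : pseries (fun k => \sum_l a l * c l k) x =
    (fun N => \sum_l a l * pseries (c l) x N).
  apply/funext => N; rewrite /pseries /series/=.
  under eq_bigr do rewrite mulr_suml.
  rewrite exchange_big/=; apply: eq_bigr => l _.
  by rewrite mulr_sumr; apply: eq_bigr => k _; rewrite mulrA.
have : (fun N => \sum_l a l * pseries (c l) x N) @ \oo -->
    \sum_l a l * limn (pseries (c l) x).
  by apply: cvg_sumr => l; apply: cvgMl_tmp; exact: cc.
rewrite -E => h; split; first by apply/cvg_ex; eexists; exact: h.
exact/cvg_lim.
Qed.

Lemma expmx_derl A x : mxder (fun u => expmx (u *: A)) x (A *m expmx (x *: A)).
Proof.
move=> i j; under eq_fun do rewrite expmxE.
have dE B k l : pseries_diffs (mxexp_coef (B : 'M[R]_n) k l) =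
    (fun m => \sum_h B k h * mxexp_coef B h l m).
  apply/funext => m; rewrite mxexp_coef_diffs exprS mxE mulr_suml.
  by apply: eq_bigr => h _; rewrite /mxexp_coef mulrA.
have [cd ld] := lim_sum_pseries (A i) (fun l => is_cvg_mxexp_coef A l j x).
rewrite mxE; under eq_bigr do rewrite expmxE.
(* [|x| + 1] is just a radius beyond [|x|] at which the series and its first two derived series
   converge. *)
rewrite -ld -dE; apply: (@pseries_snd_diffs _ _ (`|x| + 1)).
- exact: is_cvg_mxexp_coef.
- rewrite dE.
  by have [] := lim_sum_pseries (A i) (fun l => is_cvg_mxexp_coef A l j (`|x| + 1)).
(* The coefficients of the twice derived series are [(A^(k+2)) i j / k!], hence combinations of
   exponential series with weights from [A^2]. *)
- have -> : pseries_diffs (pseries_diffs (mxexp_coef A i j)) =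
      (fun m => \sum_h (A ^+ 2) i h * mxexp_coef A h j m).
    apply/funext => m; rewrite {1}/pseries_diffs mxexp_coef_diffs mulr_divfact.
    rewrite -addn2 addnC exprD mxE mulr_suml.
    by apply: eq_bigr => h _; rewrite /mxexp_coef mulrA.
  by have [] := lim_sum_pseries ((A ^+ 2) i)
    (fun l => is_cvg_mxexp_coef A l j (`|x| + 1)).
- by rewrite [ltRHS]ger0_norm ?ltrDl ?addr_ge0.
Qed.

Lemma expmx_comm A x : A *m expmx (x *: A) = expmx (x *: A) *m A.
Proof.
apply/matrixP => i j; rewrite !mxE.
under eq_bigr do rewrite expmxE.
under [RHS]eq_bigr do rewrite expmxE mulrC.
have [_ <-] := lim_sum_pseries (A i) (fun l => is_cvg_mxexp_coef A l j x).
have [_ <-] := lim_sum_pseries (A ^~ j) (fun l => is_cvg_mxexp_coef A i l x).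
congr (limn (pseries _ _)); apply/funext => k.
have : (A *m A ^+ k) i j = (A ^+ k *m A) i j.
  by congr (fun_of_matrix _ i j); rewrite -[LHS]exprS -[RHS]exprSr.
rewrite !mxE /mxexp_coef => /(congr1 (fun z => z / k`!%:R)).
rewrite !mulr_suml => E; under eq_bigr do rewrite mulrA.
by rewrite E; apply: eq_bigr => l _; rewrite mulrA [in RHS](mulrC (A _ _)).
Qed.

Lemma expmx_der A x : mxder (fun u => expmx (u *: A)) x (expmx (x *: A) *m A).
Proof. by rewrite -expmx_comm; exact: expmx_derl. Qed.

Lemma expmx0 A : expmx (0 *: A) = 1%:M.
Proof.
apply/matrixP => i j; rewrite expmxE.
apply/cvg_lim; first exact: Rhausdorff.
apply: cvg_near_cst.
near=> N.
have N0 : (0 < N)%N by near: N; exact: nbhs_infty_gt.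
rewrite -(prednK N0) /pseries /series/= big_nat_recl// big1 => [|k _].
  by rewrite /mxexp_coef expr0 fact0 divr1 addr0 expr0 mulr1.
by rewrite exprS mul0r mulr0.
Unshelve. all: by end_near. Qed.

(** The left side has derivative 0 in [x]. Inversion and additivity both follow from this one
    identity, with no Cauchy product of series. *)
Lemma expmxDl A x y : expmx (- x *: A) *m expmx ((x + y) *: A) = expmx (y *: A).
Proof.
pose F u := expmx (- u *: A) *m expmx ((u + y) *: A).
rewrite -/(F x) (@mxder0_cst _ _ _ F x 0) => [|u].
  by rewrite /F oppr0 expmx0 mul1mx add0r.
have d1 : mxder (fun u => expmx (- u *: A)) u (- (expmx (- u *: A) *m A)).
  apply: (@mxder_ext _ _ _ (fun u => expmx ((-1 * u + 0) *: A))).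
    by move=> v; rewrite mulN1r addr0.
  apply: mxder_eq; first by apply: (@mxder_aff _ _ _ (fun u => expmx (u *: A))); exact: expmx_der.
  by rewrite scaleN1r mulN1r addr0.
have d2 : mxder (fun u => expmx ((u + y) *: A)) u (A *m expmx ((u + y) *: A)).
  apply: (@mxder_ext _ _ _ (fun u => expmx ((1 * u + y) *: A))).
    by move=> v; rewrite mul1r.
  apply: mxder_eq; first by apply: (@mxder_aff _ _ _ (fun u => expmx (u *: A))); exact: expmx_derl.
  by rewrite scale1r mul1r.
apply: mxder_eq (mxderM d1 d2) _.
by rewrite mulNmx mulmxA addNr.
Qed.

Lemma expmxK A x : expmx (- x *: A) *m expmx (x *: A) = 1%:M.
Proof. by have := expmxDl A x 0; rewrite addr0 expmx0. Qed.

Lemma expmxKN A x : expmx (x *: A) *m expmx (- x *: A) = 1%:M.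
Proof. by have := expmxK A (- x); rewrite opprK. Qed.

Lemma expmxD A x y : expmx ((x + y) *: A) = expmx (x *: A) *m expmx (y *: A).
Proof. by rewrite -(expmxDl A x y) mulmxA expmxKN mul1mx. Qed.

Lemma expmx_tr A x : expmx (x *: A^T) = (expmx (x *: A))^T.
Proof.
apply/matrixP => i j; rewrite [RHS]mxE !expmxE.
congr (limn (pseries _ _)); apply/funext => k; rewrite /mxexp_coef.
suff -> : A^T ^+ k = (A ^+ k)^T by rewrite mxE.
elim: k => [|k IH]; first by rewrite !expr0 trmx1.
by rewrite exprS IH exprSr -[LHS]/(_ *m _) -trmx_mul.
Qed.

Lemma expmx_ctns A i j : continuous (fun x => expmx (x *: A) i j).
Proof. by move=> x; apply: der_cts (expmx_der A x i j). Qed.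

End matrix_exponential.

(** * Exponential decay under a spectral condition *)

Section exponential_decay.
Context {R : realType}.

Lemma der_nincr (f df : R -> R) (a b : R) : a <= b ->
  (forall x, a <= x <= b -> is_derive x (1 : R) f (df x)) ->
  (forall x, a <= x <= b -> df x <= 0) -> f b <= f a.
Proof.
move=> ab fd d0.
have := @der_bound _ (fun=> 0) (fun u => - f u) (fun=> 0) (fun u => - df u) a b ab.
rewrite subrr normr0 => /(_ (fun x _ => der_cst 0 x)).
move=> /(_ (fun x xab => derN (fd x xab))).
have d0' x : a <= x <= b -> 0 <= - df x by rewrite oppr_ge0 => /d0.
by move=> /(_ d0'); lra.
Qed.

Lemma der_expR c x : is_derive x (1 : R) (fun u => expR (c * u)) (c * expR (c * x)).
Proof.
have d := derZ c (is_derive_id x (1 : R)).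
apply: (is_derive_eq (der_comp d (is_derive_expR (c * x)))).
by rewrite mulr1.
Qed.

(* Young's inequality turns the linear system into a scalar differential
   inequality for [f1 ^ 2 + f2 ^ 2]. *)
Lemma linear_ode_decay (a b c K : R) (f1 f2 g1 g2 : R -> R) : a < - c ->
  (forall x, is_derive x (1 : R) f1 (a * f1 x - b * f2 x + g1 x)) ->
  (forall x, is_derive x (1 : R) f2 (b * f1 x + a * f2 x + g2 x)) ->
  (forall x, 0 <= x -> `|g1 x| <= K * expR (- c * x)) ->
  (forall x, 0 <= x -> `|g2 x| <= K * expR (- c * x)) ->
  exists K', forall x, 0 <= x -> `|f1 x| <= K' * expR (- c * x) /\
    `|f2 x| <= K' * expR (- c * x).
Proof.
move=> ac d1 d2 b1 b2; have [m mE m0] : exists2 m, m = - (a + c) & 0 < m.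
  by exists (- (a + c)) => //; lra.
pose y x := f1 x * f1 x + f2 x * f2 x.
pose K0 := 2 * K ^+ 2 / m ^+ 2.
have K00 : 0 <= K0 by rewrite /K0 divr_ge0 ?sqr_ge0// mulr_ge0 ?sqr_ge0.
have y0 x : 0 <= y x by rewrite /y addr_ge0 ?sqr_ge0// -expr2 sqr_ge0.
(* Since [a = - (c + m)], Young's inequality gives [y' <= - (2 c + m) y + (g1^2 + g2^2) / m], and
   the last term is at most [K0 m exp(- 2 c x)]. Multiplying by [exp((2 c + m) x)] shows that [w] is
   nonincreasing. *)
pose w x := y x * expR ((2 * c + m) * x) - K0 * expR (m * x).
pose dy x := 2 * (a * y x + f1 x * g1 x + f2 x * g2 x).
have yd x : is_derive x (1 : R) y (dy x).
  apply: (is_derive_eq (derD (derM (d1 x) (d1 x)) (derM (d2 x) (d2 x)))).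
  by rewrite /dy /y; ring.
pose dw x := dy x * expR ((2 * c + m) * x)
  + y x * ((2 * c + m) * expR ((2 * c + m) * x)) - K0 * (m * expR (m * x)).
have wd x : is_derive x (1 : R) w (dw x).
  exact: (derB (derM (yd x) (der_expR _ x)) (derZ _ (der_expR _ x))).
have dw0 x : 0 <= x -> dw x <= 0.
  move=> x0.
  have e2 : expR ((2 * c + m) * x) = expR (2 * c * x) * expR (m * x).
    by rewrite mulrDl expRD.
  have e3 : expR (2 * c * x) * (expR (- c * x) * expR (- c * x)) = 1.
    by rewrite -!expRD -[RHS]expR0; congr expR; ring.
  have em : 0 < expR (m * x) := expR_gt0 _.
  have ec : 0 < expR (2 * c * x) := expR_gt0 _.
  have sq (g : R) : `|g| <= K * expR (- c * x) ->
      g * g * expR (2 * c * x) <= K ^+ 2.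
    move=> gK.
    have -> : K ^+ 2 = (K * expR (- c * x)) * (K * expR (- c * x)) *
       expR (2 * c * x) by rewrite -[LHS]mulr1 -[X in _ * X]e3; ring.
    by rewrite ler_pM2r// -expr2 -(real_normK (num_real g)) expr2 ler_pM.
  have s1 := sq _ (b1 x x0); have s2 := sq _ (b2 x x0).
  have yg (f g : R) : 2 * (f * g) <= m * (f * f) + (g * g) / m.
    rewrite -subr_ge0 (_ : _ - _ = (m * f - g) ^+ 2 / m); last first.
      by field; rewrite (gt_eqF m0).
    by rewrite divr_ge0 ?sqr_ge0// ltW.
  have dyle : dy x <= - (2 * c + m) * y x + (g1 x * g1 x + g2 x * g2 x) / m.
    have := yg (f1 x) (g1 x); have := yg (f2 x) (g2 x).
    by rewrite /dy /y mE mulrDl; lra.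
  rewrite /dw e2.
  have : (dy x + (2 * c + m) * y x) * expR (2 * c * x) <= K0 * m.
    apply: (@le_trans _ _ ((g1 x * g1 x + g2 x * g2 x) / m * expR (2 * c * x))).
      by rewrite ler_pM2r//; lra.
    rewrite (_ : K0 * m = 2 * K ^+ 2 / m); last first.
      by rewrite /K0; field; rewrite (gt_eqF m0).
    by rewrite mulrAC ler_pM2r ?invr_gt0//; lra.
  rewrite -(ler_pM2r em); lra.
(* From [w x <= w 0] and [1 <= exp(m x)] follows [y x <= (K0 + y 0) exp(- 2 c x)]; the square root
   is the bound on each component. *)
exists (Num.sqrt (K0 + y 0)) => x x0.
have : w x <= w 0.
  apply: (der_nincr x0 (fun u _ => wd u)) => u /andP[u0 _]; exact: dw0.
rewrite /w !mulr0 expR0 !mulr1 => wx.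
have em : 0 < expR (m * x) := expR_gt0 _.
have em1 : 1 <= expR (m * x) by rewrite -[leLHS]expR0 ler_expR mulr_ge0// ltW.
have e2 : expR ((2 * c + m) * x) = expR (2 * c * x) * expR (m * x).
  by rewrite mulrDl expRD.
have e3 : expR (2 * c * x) * (expR (- c * x) * expR (- c * x)) = 1.
  by rewrite -!expRD -[RHS]expR0; congr expR; ring.
have yx : y x <= (K0 + y 0) * (expR (- c * x) * expR (- c * x)).
  have : y x * expR (2 * c * x) <= K0 + y 0.
    rewrite -(ler_pM2r em) -[leLHS]mulrA -e2.
    apply: (@le_trans _ _ (y 0 + K0 * expR (m * x))); first by lra.
    have : y 0 * 1 <= y 0 * expR (m * x) by rewrite ler_wpM2l.
    lra.
  move=> yK; rewrite -(ler_pM2r (expR_gt0 (2 * c * x))) -[leRHS]mulrA.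
  by rewrite [X in _ <= _ * X]mulrC e3 mulr1.
have S : 0 <= K0 + y 0 by rewrite addr_ge0.
have fin (f : R) : f * f <= y x -> `|f| <= Num.sqrt (K0 + y 0) * expR (- c * x).
  move=> fy; rewrite -(@ler_pXn2r _ 2)// ?nnegrE ?mulr_ge0 ?sqrtr_ge0 ?expR_ge0//.
  rewrite exprMn sqr_sqrtr// (real_normK (num_real f)) !expr2.
  exact: le_trans yx.
by split; apply: fin; rewrite /y ?lerDl ?lerDr -expr2 sqr_ge0.
Qed.

Definition mxRe m n (M : 'M[R[i]]_(m, n)) : 'M[R]_(m, n) := map_mx (@complex.Re R) M.
Definition mxIm m n (M : 'M[R[i]]_(m, n)) : 'M[R]_(m, n) := map_mx (@complex.Im R) M.

Lemma Re_sum (I : Type) (r : seq I) (F : I -> R[i]) :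
  complex.Re (\sum_(i <- r) F i) = \sum_(i <- r) complex.Re (F i).
Proof. exact: (raddf_sum (@complex.Re R)). Qed.

Lemma Im_sum (I : Type) (r : seq I) (F : I -> R[i]) :
  complex.Im (\sum_(i <- r) F i) = \sum_(i <- r) complex.Im (F i).
Proof. exact: (raddf_sum (@complex.Im R)). Qed.

Lemma mxRe_mulCl m n k (A : 'M[R]_(m, n)) (M : 'M[R[i]]_(n, k)) :
  mxRe (map_mx (real_complex R) A *m M) = A *m mxRe M.
Proof.
apply/matrixP => i j; rewrite !mxE Re_sum; apply: eq_bigr => l _.
by rewrite !mxE; case: (M l j) => a b /=; rewrite mul0r subr0.
Qed.

Lemma mxIm_mulCl m n k (A : 'M[R]_(m, n)) (M : 'M[R[i]]_(n, k)) :
  mxIm (map_mx (real_complex R) A *m M) = A *m mxIm M.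
Proof.
apply/matrixP => i j; rewrite !mxE Im_sum; apply: eq_bigr => l _.
by rewrite !mxE; case: (M l j) => a b /=; rewrite mul0r addr0.
Qed.

Definition decaying m n (c : R) (F : R -> 'M[R]_(m, n)) :=
  exists K, forall x i j, 0 <= x -> `|F x i j| <= K * expR (- c * x).

Lemma fin_choose_bound n (P : 'I_n -> R -> Prop) :
  (forall i, exists K, P i K) -> (forall i K K', K <= K' -> P i K -> P i K') ->
  exists K, forall i, P i K.
Proof.
move=> eK Pm; have [K HK] := choice eK.
exists (\sum_i `|K i|) => i; apply: Pm (HK i).
by rewrite (le_trans (ler_norm _))// [leRHS](bigD1 i)//= lerDl sumr_ge0.
Qed.

Lemma decaying_entries m n c (F : R -> 'M[R]_(m, n)) :
  (forall i j, exists K, forall x, 0 <= x -> `|F x i j| <= K * expR (- c * x)) ->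
  decaying c F.
Proof.
move=> H.
have up (i : 'I_m) (j : 'I_n) (K K' : R) : K <= K' ->
    (forall x, 0 <= x -> `|F x i j| <= K * expR (- c * x)) ->
    (forall x, 0 <= x -> `|F x i j| <= K' * expR (- c * x)).
  by move=> KK h x x0; rewrite (le_trans (h _ x0))// ler_wpM2r ?expR_ge0.
suff [K HK] : exists K, forall i j x, 0 <= x -> `|F x i j| <= K * expR (- c * x).
  by exists K => x i j; exact: HK.
apply: (@fin_choose_bound _ (fun i K => forall j x, 0 <= x ->
  `|F x i j| <= K * expR (- c * x))) => [i|i K K' KK h j]; last exact: up (h j).
apply: (@fin_choose_bound _ (fun j K => forall x, 0 <= x ->
  `|F x i j| <= K * expR (- c * x))) => [j|j]; [exact: H|exact: up].
Qed.

(* One step of Putzer's algorithm: if [(A - z) M exp(x A)] decays then so does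
   [M exp(x A)], which solves [F' = z F + (A - z) F]. *)
Lemma decaying_peel n (A : 'M[R]_n) (M : 'M[R[i]]_n) (z : R[i]) c :
  complex.Re z < - c ->
  map_mx (real_complex R) A *m M = M *m map_mx (real_complex R) A ->
  let M' := (map_mx (real_complex R) A - z%:M) *m M in
  decaying c (fun x => mxRe M' *m expmx (x *: A)) ->
  decaying c (fun x => mxIm M' *m expmx (x *: A)) ->
  decaying c (fun x => mxRe M *m expmx (x *: A)) /\
  decaying c (fun x => mxIm M *m expmx (x *: A)).
Proof.
set AC := map_mx _ A => zc AM M' [K1 H1] [K2 H2].
case: z zc @M' H1 H2 => a b /= ac.
set M' := (_ *m M); move=> H1 H2.
have e1 : mxRe M' = A *m mxRe M - (a *: mxRe M - b *: mxIm M).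
  rewrite /M' mulmxBl -mxRe_mulCl mul_scalar_mx; apply/matrixP => i j.
  rewrite !mxE raddfB/=; congr (_ - _).
  by case: (M i j) => u v.
have e2 : mxIm M' = A *m mxIm M - (b *: mxRe M + a *: mxIm M).
  rewrite /M' mulmxBl -mxIm_mulCl mul_scalar_mx; apply/matrixP => i j.
  rewrite !mxE raddfB/=; congr (_ - _).
  by case: (M i j) => u v /=; rewrite addrC.
have cR : A *m mxRe M = mxRe M *m A.
  rewrite -mxRe_mulCl AM; apply/matrixP => i j; rewrite !mxE Re_sum.
  apply: eq_bigr => l _; rewrite !mxE.
  by case: (M i l) => u v /=; rewrite mulr0 subr0.
have cI : A *m mxIm M = mxIm M *m A.
  rewrite -mxIm_mulCl AM; apply/matrixP => i j; rewrite !mxE Im_sum.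
  apply: eq_bigr => l _; rewrite !mxE.
  by case: (M i l) => u v /=; rewrite mulr0 add0r.
pose F N (x : R) : 'M[R]_n := N *m expmx (x *: A).
have dF N x : A *m N = N *m A -> mxder (F N) x (A *m N *m expmx (x *: A)).
  move=> ->; rewrite -mulmxA; apply: mxderMl; exact: expmx_derl.
pose K := Num.max K1 K2.
have dec i j : exists K', forall x, 0 <= x ->
    `|F (mxRe M) x i j| <= K' * expR (- c * x) /\
    `|F (mxIm M) x i j| <= K' * expR (- c * x).
  apply: (@linear_ode_decay a b c K (fun x => F (mxRe M) x i j)
    (fun x => F (mxIm M) x i j) (fun x => F (mxRe M') x i j)
    (fun x => F (mxIm M') x i j)) => //.
  - move=> x; apply: (is_derive_eq (dF _ x cR i j)).
    rewrite /F e1 mulmxBl mulmxBl -!scalemxAl !mxE; ring.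
  - move=> x; apply: (is_derive_eq (dF _ x cI i j)).
    rewrite /F e2 mulmxBl mulmxDl -!scalemxAl !mxE; ring.
  - move=> x x0; rewrite (le_trans (H1 _ _ _ x0))// ler_wpM2r ?expR_ge0//.
    by rewrite le_max lexx.
  - move=> x x0; rewrite (le_trans (H2 _ _ _ x0))// ler_wpM2r ?expR_ge0//.
    by rewrite le_max lexx orbT.
by split; apply: decaying_entries => i j; have [K' HK'] := dec i j;
  exists K' => x /HK'[].
Qed.

Lemma common_decay_rate (r : seq R[i]) : (forall z, z \in r -> complex.Re z < 0) ->
  exists2 c, 0 < c & forall z, z \in r -> complex.Re z < - c.
Proof.
elim: r => [|z r IH] H; first by exists 1.
have [|c c0 Hc] := IH; first by move=> w wr; apply: H; rewrite inE wr orbT.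
have z0 : complex.Re z < 0 by apply: H; rewrite inE eqxx.
(* Half of [- Re z] keeps the inequality for [z] strict. *)
exists (Num.min c (- (complex.Re z / 2))).
  by rewrite lt_min c0/= oppr_gt0 pmulr_llt0 ?invr_gt0.
move=> w; rewrite inE => /orP[/eqP->|/Hc wc].
  by rewrite ltrNr gt_min; apply/orP; right; lra.
by rewrite ltrNr gt_min ltrNr wc.
Qed.

(** By Cayley-Hamilton the product of [A - z] over all roots [z] of the characteristic polynomial is
    0 and decays trivially. Peeling off one factor at a time with [decaying_peel] ends at the empty
    product, the identity. *)
Lemma expmx_decay n (A : 'M[R]_n) :
  (forall z, eigenvalue (map_mx (real_complex R) A) z -> complex.Re z < 0) ->
  exists2 c, 0 < c & decaying c (fun x => expmx (x *: A)).
Proof.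
case: n A => [A _|n A HA]; first by exists 1 => //; exists 0 => x [].
set AC := map_mx _ A in HA.
have [r pr] := closed_field_poly_normal (char_poly AC).
move: pr; rewrite (monicP (char_poly_monic _)) scale1r => pr.
have rP z : z \in r -> complex.Re z < 0.
  by move=> zr; apply: HA; rewrite eigenvalue_root_char pr root_prod_XsubC.
have [c c0 rc] := common_decay_rate rP.
exists c => //.
pose M s := horner_mx AC (\prod_(z <- s) ('X - z%:P)).
suff H s : (forall z, z \in s -> complex.Re z < - c) ->
    decaying c (fun x => mxRe (M s) *m expmx (x *: A)) ->
    decaying c (fun x => mxIm (M s) *m expmx (x *: A)) ->
    decaying c (fun x => expmx (x *: A)).
  have Mr0 : M r = 0 by rewrite /M -pr Cayley_Hamilton.
  apply: (H r rc); rewrite Mr0 /mxRe /mxIm map_mx0;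
    exists 0 => x i j _; by rewrite mul0mx mxE normr0 mul0r.
elim: s => [_|z s IH sc].
  move=> [K HK] _; exists K => x i j /(HK x i j).
  suff -> : mxRe (M [::]) = 1%:M by rewrite mul1mx.
  rewrite /M big_nil rmorph1; apply/matrixP => k l; rewrite !mxE.
  by case: (k == l).
have Ms : M (z :: s) = (AC - z%:M) *m M s.
  by rewrite /M big_cons rmorphM/= rmorphB/= horner_mx_X horner_mx_C.
rewrite Ms => d1 d2.
have [||||e1 e2] := @decaying_peel _ A (M s) z c.
- by apply: sc; rewrite inE eqxx.
- have := comm_horner_mx2 AC 'X (\prod_(z <- s) ('X - z%:P)).
  by rewrite horner_mx_X.
- exact: d1.
- exact: d2.
by apply: IH => // w ws; apply: sc; rewrite inE ws orbT.
Qed.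

End exponential_decay.

(** * Integrals with an algebraic singularity *)

Section weighted_integrals.
Context {R : realType}.
Notation mu := (@lebesgue_measure R).
Implicit Types (a c h : R) (f g : R -> R).

Lemma powR_le_expR a c : 0 <= a -> 0 < c ->
  exists K, forall u : R, 0 <= u -> u `^ a <= K * expR (c * u).
Proof.
(* The inequality [k u <= exp(k u)] is raised to the power [a]; [k a <= c] is what is needed, and
   the [+ 1] allows [a = 0]. *)
move=> a0 c0; pose k := c / (a + 1).
have k0 : 0 < k by rewrite divr_gt0//; lra.
exists ((k^-1) `^ a) => u u0.
rewrite [in leLHS](_ : u = k^-1 * (k * u)); last by rewrite mulKf// gt_eqF.
have ku0 : 0 <= k * u by rewrite mulr_ge0// ltW.
rewrite powRM ?invr_ge0 ?(ltW k0)// ler_wpM2l ?powR_ge0//.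
apply: (@le_trans _ _ (expR (k * u) `^ a)).
  apply: ge0_ler_powR; rewrite ?nnegrE ?expR_ge0//.
  by rewrite (le_trans _ (expR_ge1Dx _))// lerDr.
rewrite /powR gt_eqF ?expR_gt0// expRK ler_expR mulrA ler_wpM2r//.
by rewrite /k mulrCA ler_piMr ?(ltW c0)// ler_pdivrMr; lra.
Qed.

Lemma ltr_powR_oo a : 0 < a -> (fun u : R => u `^ a) u @[u --> +oo] --> +oo.
Proof.
move=> a0; apply/cvgryPge => A.
near=> u.
have u0 : 0 <= u by near: u; exact: nbhs_pinfty_ge.
apply: (@le_trans _ _ (`|A| `^ a^-1 `^ a)).
  by rewrite -powRrM mulVf ?gt_eqF// powRr1// ler_norm.
apply: ge0_ler_powR; rewrite ?nnegrE ?powR_ge0 ?(ltW a0)//.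
Unshelve. all: by end_near. Qed.

Lemma powR_continuous_pos a (u : R) : 0 < u -> {for u, continuous (fun x => x `^ a)}.
Proof. by move=> u0; exact: der_cts (is_derive1_powR a u0). Qed.

Lemma powR_exp_integrable a c : 0 < a -> 0 < c ->
  mu.-integrable `[0, +oo[ (EFin \o (fun u => u `^ (a - 1) * expR (- c * u))).
Proof.
move=> a0 c0.
(* One comparison settles both ends: [g = G'] behaves like [u^(a-1)] at 0, decays only polynomially
   at infinity, and has an explicit bounded primitive. *)
pose G u : R := - (1 + u `^ a) `^ (-1).
pose g u : R := a * u `^ (a - 1) * (1 + u `^ a) `^ (-2).
have u1 (u : R) : 0 < 1 + u `^ a by rewrite ltr_wpDr ?powR_ge0.
have dG (u : R) : 0 < u -> is_derive u (1 : R) G (g u).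
  move=> u0.
  have d1 := derD (der_cst (1 : R) u) (is_derive1_powR a u0).
  have d2 := der_comp d1 (is_derive1_powR (-1) (u1 u)).
  apply: (is_derive_eq (derN d2)); rewrite /g add0r.
  have -> : (-1 - 1 : R) = - 2 by ring.
  by ring.
have gc (u : R) : 0 < u -> {for u, continuous g}.
  move=> u0; apply: cvgM.
    by apply: cvgM; [exact: cvg_cst|exact: powR_continuous_pos].
  apply: (@continuous_comp _ _ _ (fun u => 1 + u `^ a) (fun v => v `^ (-2))).
    by apply: cvgD; [exact: cvg_cst|exact: powR_continuous_pos].
  exact: powR_continuous_pos.
have g0 (u : R) : 0 <= g u by rewrite /g !mulr_ge0 ?powR_ge0// ltW.
have mp b D : measurable_fun D (fun u : R => u `^ b).
  by apply: measurable_funTS; apply: measurable_powR.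
have mg : measurable_fun setT g.
  apply: measurable_funM; first by apply: measurable_funM.
  apply: (@measurableT_comp _ _ _ _ _ _ (fun v => v `^ (-2))); first exact: mp.
  by apply: measurable_funD.
have G1 : G x @[x --> +oo] --> 0.
  apply/cvgrPdist_le => e e0; near=> x.
  rewrite sub0r opprK ger0_norm ?powR_ge0// powR_inv1 ?(ltW (u1 _))//.
  rewrite -[leRHS]invrK lef_pV2 ?posrE ?invr_gt0//.
  rewrite (@le_trans _ _ (x `^ a)) ?lerDr//.
  by near: x; have /cvgryPge := ltr_powR_oo a0; apply.
have gi : (\int[mu]_(x in `]0%R, +oo[) (g x)%:E <= 1)%E.
  pose F n : set R := `[n.+1%:R^-1, +oo[%classic.
  have F0 n : 0 < (n.+1%:R^-1 : R) by rewrite invr_gt0.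
  have -> : `]0%R, +oo[%classic = \bigcup_n F n.
    apply/seteqP; split=> [x|x [n _]]; rewrite /F /= !in_itv/= !andbT; last first.
      exact: lt_le_trans.
    move=> x0; exists (Num.truncn x^-1) => //=; rewrite in_itv/= andbT.
    rewrite -[leRHS]invrK lef_pV2 ?posrE ?invr_gt0//.
    by apply/ltW/Num.Theory.truncnS_gt.
  have cv : (\int[mu]_(x in F n) (g x)%:E @[n --> \oo] -->
      \int[mu]_(x in \bigcup_n F n) (g x)%:E)%E.
    apply: ge0_nondecreasing_set_cvg_integral.
  - move=> m n mn; apply/subsetPset; apply: subset_itvr; rewrite bnd_simp.
    by rewrite lef_pV2 ?posrE// ler_nat ltnS.
  - by move=> n; exact: measurable_itv.
  - by move=> n; exact/measurable_EFinP/measurable_funTS.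
  - by move=> n x _; rewrite lee_fin.
  rewrite -(cvg_lim _ cv)//; apply: lime_le; first by apply/cvg_ex; eexists; exact: cv.
  apply: nearW => n /=.
  rewrite (@ge0_continuous_FTC2y _ g G _ 0)//.
  - rewrite -EFinB lee_fin sub0r opprK powR_inv1 ?(ltW (u1 _))//.
    by rewrite invf_le1// lerDl powR_ge0.
  - apply: continuous_in_subspaceT => x; rewrite inE/= in_itv/= andbT => x0.
    by apply: gc; exact: lt_le_trans x0.
  - by move=> x x0; have [] := dG x (lt_trans (F0 n) x0).
  - exact/cvg_at_right_filter/(der_cts (dG _ (F0 n))).
  - move=> x; rewrite in_itv/= andbT => x0.
    have := dG x (lt_trans (F0 n) x0) => dx.
    by rewrite derive1E; exact: derive_val.
have gI : mu.-integrable `[0, +oo[ (EFin \o g).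
  apply/integrableP; split; first exact/measurable_EFinP/measurable_funTS.
  rewrite -integral_itv_obnd_cbnd; last first.
    apply/measurable_EFinP; apply: measurableT_comp => //.
    exact/measurable_funTS.
  under eq_integral do rewrite /= ger0_norm//.
  by rewrite (le_lt_trans gi)// ltry.
have [K1 HK1] := powR_le_expR (ltW a0) (divr_gt0 c0 (ltr0Sn R 1)).
(* From [u^a <= K1 exp(c u / 2)] comes [(1 + u^a)^2 <= (1 + |K1|)^2 exp(c u)]; the division by [a]
   compensates the factor [a] in [g]. *)
pose K := (1 + `|K1|) ^+ 2 / a.
have : mu.-integrable `[0, +oo[ (EFin \o (fun u => K * g u)).
  apply: eq_integrable (integrableZl _ K gI) => // x _.
apply: le_integrable => //.
  apply/measurable_EFinP/measurable_funTS; apply: measurable_funM => //.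
  apply: continuous_measurable_fun => u; exact: der_cts (der_expR (- c) u).
move=> u; rewrite /= in_itv/= andbT => u0.
rewrite lee_fin ger0_norm ?mulr_ge0 ?powR_ge0 ?expR_ge0//.
rewrite ger0_norm; last by rewrite mulr_ge0// divr_ge0 ?sqr_ge0 ?ltW.
rewrite /K /g mulrA (_ : _ / a * (a * _) = u `^ (a - 1) * (1 + `|K1|) ^+ 2);
  last by field; rewrite gt_eqF.
rewrite -mulrA ler_wpM2l ?powR_ge0//.
rewrite powR_invn ?(ltW (u1 _))// ler_pdivlMr ?exprn_gt0//.
rewrite mulNr expRN mulrC ler_pdivrMr ?expR_gt0//.
have -> : expR (c * u) = expR (c / 2 * u) ^+ 2.
  by rewrite -expRM_natl; congr expR; field.
rewrite -exprMn ler_sqr ?nnegrE ?mulr_ge0 ?addr_ge0 ?powR_ge0 ?expR_ge0//.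
rewrite mulrDl mul1r lerD//.
  by rewrite -[leLHS]expR0 ler_expR mulr_ge0// divr_ge0// ltW.
by rewrite (le_trans (HK1 u u0))// ler_wpM2r ?expR_ge0// ler_norm.
Unshelve. all: by end_near. Qed.

End weighted_integrals.

(** * Improper integrals and primitives with a singular endpoint *)

Section improper_integrals.
Context {R : realType}.
Notation mu := (@lebesgue_measure R).
Implicit Types (a c h : R) (f g : R -> R).

Lemma Rintegral_tail g h : 0 <= h -> mu.-integrable `[0, +oo[ (EFin \o g) ->
  \int[mu]_(u in `[h, +oo[) g u =
  \int[mu]_(u in `[0, +oo[) g u - \int[mu]_(u in `[0, h]) g u.
Proof.
move=> h0 ig; rewrite Rintegral_itvB ?bnd_simp//.
rewrite Rintegral_itv_obnd_cbnd//.
by apply: integrableS ig => //; apply: subset_itvr; rewrite bnd_simp.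
Qed.

Lemma cvg_Rintegral_y g : mu.-integrable `[0, +oo[ (EFin \o g) ->
  \int[mu]_(u in `[0, h]) g u @[h --> +oo] --> \int[mu]_(u in `[0, +oo[) g u.
Proof.
move=> ig; apply/cvg_pinftyP => u uoo.
have mg : measurable_fun (`[0, +oo[%classic : set R) g.
  by move/integrableP : ig => [/measurable_EFinP].
pose f_ n x := (EFin \o (g \_ `[0, u n])) x.
have Df n : (\int[mu]_(x in `[0%R, u n]) (g x)%:E =
             \int[mu]_(x in `[0%R, +oo[) f_ n x)%E.
  rewrite [LHS]integral_mkcond [RHS]integral_mkcond.
  apply: eq_integral => x _; rewrite /f_ /= !patchE.
  case: ifPn => xu; last by rewrite if_same.
  rewrite ifT//; move: xu; rewrite !inE/= !in_itv/= andbT.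
  by case/andP.
suff : (\int[mu]_(x in `[0%R, +oo[) f_ n x @[n --> \oo] -->
    \int[mu]_(x in `[0%R, +oo[) (EFin \o g) x)%E.
  move=> cv; rewrite /Rintegral.
  under eq_fun do rewrite Df.
  apply: fine_cvg; rewrite fineK//.
  exact: integrable_fin_num.
apply: (@dominated_cvg _ _ _ mu _ _ f_ (EFin \o g) (fun x => `|(g x)%:E|%E)) => //.
- move=> n; apply/measurable_EFinP.
  apply: measurable_funTS; apply/(measurable_restrictT _ (measurable_itv _)).
  have /= := @measurable_funS _ _ _ _ _ `[0, u n]%classic g (measurable_itv _) _ mg.
  apply => //; exact: subset_itvl.
- move=> x; rewrite /= in_itv/= andbT => x0; apply: cvg_near_cst.
  near=> n; rewrite /f_/= patchE ifT// inE/= in_itv/= x0/=.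
  by near: n; move/cvgryPge : uoo; apply.
- exact: integrable_abse.
- move=> n x _; rewrite /f_/= lee_fin patchE; case: ifP => // _.
  by rewrite normr0.
Unshelve. all: by end_near. Qed.

(** [g] may blow up at 0. The indefinite integral and [F] are still continuous on [[0, h]] and have
    the same derivative inside, so their difference is constant. *)
Lemma FTC_singular g (F : R -> R) h : 0 <= h ->
  mu.-integrable `[0, h] (EFin \o g) ->
  (forall x : R, 0 < x -> {for x, continuous g}) ->
  continuous F -> (forall x : R, 0 < x -> is_derive x (1 : R) F (g x)) ->
  \int[mu]_(u in `[0, h]) g u = F h - F 0.
Proof.
rewrite le_eqVlt => /predU1P[<- _ _ _ _|h0 ig cg cF dF].
  by rewrite set_itv1 Rintegral_set1 subrr.
pose J x := \int[mu]_(u in `[0, x]) g u.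
have J0 : J 0 = 0 by rewrite /J set_itv1 Rintegral_set1.
have [x||x _] := @MVT _ (fun x => J x - F x) (fun=> 0) 0 h h0.
- rewrite in_itv/= => /andP[x0 xh].
  have [d1 d2] := continuous_FTC1_closed xh ig x0 (cg x x0).
  have dJ : is_derive x (1 : R) J (g x).
    by apply: DeriveDef; [exact: d1|rewrite -derive1E].
  by apply: (is_derive_eq (derB dJ (dF x x0))); rewrite subrr.
- move=> x; apply: (@continuousB _ _ (subspace `[0, h]%classic)).
    exact: (parameterized_integral_continuous (ltW h0) ig).
  exact: (continuous_subspaceT cF).
by rewrite J0 -/(J h); lra.
Qed.

Lemma FTC_singular_y g (F : R -> R) l : 
  mu.-integrable `[0, +oo[ (EFin \o g) ->
  (forall x : R, 0 < x -> {for x, continuous g}) ->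
  continuous F -> (forall x : R, 0 < x -> is_derive x (1 : R) F (g x)) ->
  F x @[x --> +oo] --> l ->
  \int[mu]_(u in `[0, +oo[) g u = l - F 0.
Proof.
move=> ig cg cF dF Fl.
have c1 := cvg_Rintegral_y ig.
apply: cvg_unique c1 _; first exact: Rhausdorff.
have E : {near +oo%R, (fun h => F h - F 0) =1 (fun h => \int[mu]_(u in `[0, h]) g u)}.
  near=> h.
  have h0 : 0 <= h by near: h; exact: nbhs_pinfty_ge.
  rewrite (FTC_singular h0 _ cg cF dF)//.
  by apply: integrableS ig => //; apply: subset_itvl.
by apply: cvg_trans; [apply: near_eq_cvg; exact: E|apply: cvgB => //; exact: cvg_cst].
Unshelve. all: by end_near. Qed.

(** The weight of the gamma integral. With [a = 2 H] it carries the singularity of [psi'], unbounded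
    at 0 when [a < 1] but always integrable. *)
Definition wfun a f u := u `^ (a - 1) * f u.

Lemma wfun_integrable a c K f : 0 < a -> 0 < c -> continuous f ->
  (forall u, 0 <= u -> `|f u| <= K * expR (- c * u)) ->
  mu.-integrable `[0, +oo[ (EFin \o wfun a f).
Proof.
move=> a0 c0 cf fK.
apply: (le_integrable _ _ _ (integrableZl _ K (powR_exp_integrable a0 c0))) => //.
  apply/measurable_EFinP; apply: measurable_funM; last first.
    by apply: measurable_funTS; exact: continuous_measurable_fun.
  by apply: measurable_funTS; apply: measurable_powR.
move=> u; rewrite /= in_itv/= andbT => u0.
rewrite lee_fin /wfun normrM ger0_norm ?powR_ge0//.
rewrite (le_trans _ (ler_norm _))// mulrCA ler_wpM2l ?powR_ge0//.
exact: fK.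
Qed.

Lemma wfun_integrable_itv a f h : 0 < a -> continuous f ->
  mu.-integrable `[0, h] (EFin \o wfun a f).
Proof.
move=> a0 cf; have [h0|h0] := ltP h 0.
  by rewrite set_itv_ge ?bnd_simp -?ltNge//; exact: integrable_set0.
have [u _ fu] := EVT_max h0 (continuous_subspaceT
  (fun x => cvg_norm (cf x) : {for x, continuous (fun x => `|f x|)})).
have i1 : mu.-integrable `[0, h]
    (EFin \o (fun u => u `^ (a - 1) * expR (- 1 * u))).
  by apply: integrableS (powR_exp_integrable a0 ltr01) => //; exact: subset_itvl.
(* On [[0, h]] one has [1 <= exp(h) exp(- u)], which reduces the bounded [f] to an exponential. *)
apply: (le_integrable _ _ _ (integrableZl _ (`|f u| * expR h) i1)) => //.
  apply/measurable_EFinP; apply: measurable_funM; last first.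
    by apply: measurable_funTS; exact: continuous_measurable_fun.
  by apply: measurable_funTS; apply: measurable_powR.
move=> x; rewrite /= in_itv/= => /andP[x0 xh].
rewrite lee_fin /wfun normrM ger0_norm ?powR_ge0//.
rewrite (le_trans _ (ler_norm _))// mulrCA ler_wpM2l ?powR_ge0//.
rewrite -mulrA -expRD (le_trans (fu x _)) ?in_itv/= ?x0//.
rewrite ler_peMr// -[leLHS]expR0 ler_expR mulN1r; lra.
Qed.

Definition wJ a f h := \int[mu]_(u in `[0, h]) wfun a f u.

Lemma wfun_continuous a f (x : R) : 0 < x -> continuous f -> {for x, continuous (wfun a f)}.
Proof. by move=> x0 cf; apply: cvgM; [exact: powR_continuous_pos|exact: cf]. Qed.

Lemma wJ_der a f (x : R) : 0 < a -> continuous f -> 0 < x ->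
  is_derive x (1 : R) (wJ a f) (wfun a f x).
Proof.
move=> a0 cf x0.
have xx : x < x + 1 by rewrite ltrDl.
have [d1 d2] := continuous_FTC1_closed xx (wfun_integrable_itv (x + 1) a0 cf) x0
  (wfun_continuous x0 cf).
by apply: DeriveDef; [exact: d1|rewrite -derive1E].
Qed.

Lemma wJ0 a f : wJ a f 0 = 0.
Proof. by rewrite /wJ set_itv1 Rintegral_set1. Qed.

Lemma wJ_cts0 a f : 0 < a -> continuous f -> {for 0, continuous (wJ a f)}.
Proof.
move=> a0 cf; suff : wJ a f x @[x --> (0 : R)] --> wJ a f 0 by [].
rewrite wJ0.
exact: (parameterized_integral_cvg_left ltr01 (wfun_integrable_itv 1 a0 cf)).
Qed.

End improper_integrals.

(** * The fractional kernel of the autocovariance *)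

Section fractional_kernel.
Context {R : realType}.
Variables (a : R).
Hypothesis a0 : 0 < a.

(** For [a = 2 H], half the variance of an increment of [B] over a time [x]; the covariance of [B]
    is [psi u + psi v - psi (u - v)]. *)
Definition psi (x : R) : R := `|x| `^ a / 2.

Definition dpsi (x : R) : R := a / 2 * (Num.sg x * `|x| `^ (a - 1)).

Lemma psiN (x : R) : psi (- x) = psi x.
Proof. by rewrite /psi normrN. Qed.

Lemma dpsiN (x : R) : dpsi (- x) = - dpsi x.
Proof. by rewrite /dpsi normrN sgrN mulNr mulrN. Qed.

Lemma dpsi_pos (x : R) : 0 < x -> dpsi x = a / 2 * x `^ (a - 1).
Proof. by move=> x0; rewrite /dpsi gtr0_sg// gtr0_norm// mul1r. Qed.

Lemma near_gt0 (x : R) : 0 < x -> \forall y \near x, 0 < y.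
Proof. exact: lt_nbhsr. Qed.

Lemma psi_der_pos (x : R) : 0 < x -> is_derive x (1 : R) psi (dpsi x).
Proof.
move=> x0; rewrite dpsi_pos//.
have d : is_derive x (1 : R) (fun y => 2^-1 * y `^ a) (2^-1 * (a * x `^ (a - 1))).
  exact: derZ (is_derive1_powR a x0).
have E : \forall y \near x, 2^-1 * y `^ a = psi y.
  by apply: filterS (near_gt0 x0) => y y0; rewrite /psi gtr0_norm// mulrC.
apply: (near_eq_is_derive E).
by apply: (is_derive_eq d); ring.
Qed.

Lemma psi_der (x : R) : x != 0 -> is_derive x (1 : R) psi (dpsi x).
Proof.
case: (ltgtP x 0) => // x0 _; last exact: psi_der_pos.
have Nx0 : 0 < -1 * x + 0 by lra.
have E : psi = (fun u => psi (-1 * u + 0)).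
  by apply/funext => u; rewrite addr0 mulN1r psiN.
rewrite [X in is_derive _ _ X]E.
apply: (is_derive_eq (der_comp_aff (psi_der_pos Nx0))).
by rewrite addr0 !mulN1r dpsiN opprK.
Qed.

Lemma psi_cts : continuous psi.
Proof.
move=> x; have [->|x0] := eqVneq x 0; last exact: der_cts (psi_der x0).
apply/cvgrPdist_le => e e0.
pose d := (2 * e) `^ a^-1.
have d0 : 0 < d by rewrite powR_gt0// mulr_gt0.
exists d => //= y; rewrite /ball_/= sub0r normrN => yd.
rewrite {1}/psi normr0 powR0 ?gt_eqF// mul0r sub0r normrN.
rewrite ger0_norm ?divr_ge0 ?powR_ge0// ler_pdivrMr// mulrC.
have -> : 2 * e = d `^ a.
  by rewrite /d -powRrM mulVf ?gt_eqF// powRr1// mulr_ge0// ltW.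
by apply: ge0_ler_powR; rewrite ?nnegrE ?(ltW a0) ?(ltW d0) ?(ltW yd).
Qed.

Variables (n : nat) (A : 'M[R]_n) (c : R).
Hypothesis c0 : 0 < c.
Hypothesis Adec : decaying c (fun x => expmx (x *: A)).
Local Notation E x := (expmx (x *: A)).

Definition intN h := mxRintegral `[0, h]%classic
  (fun u => u `^ (a - 1) *: expmx (- u *: A)).

Definition tailint l := mxRintegral `[l, +oo[%classic
  (fun u => u `^ (a - 1) *: expmx (u *: A)).

Let EN_cts i j : continuous (fun u : R => expmx (- u *: A) i j).
Proof.
move=> x; apply: (@continuous_comp _ _ _ -%R (fun u : R => E u i j)).
  exact: continuousN.
exact: expmx_ctns.
Qed.

Lemma intNE h i j : intN h i j = wJ a (fun u : R => expmx (- u *: A) i j) h.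
Proof.
rewrite mxE /wJ; apply: eq_Rintegral => u _.
by rewrite mxE.
Qed.

Let Eint i j : lebesgue_measure.-integrable `[0, +oo[
  (EFin \o wfun a (fun u : R => E u i j)).
Proof.
have [K HK] := Adec; apply: (wfun_integrable a0 c0 (K := K)) => [|u u0].
  exact: expmx_ctns.
exact: HK.
Qed.

Lemma tailintE l i j : 0 <= l ->
  tailint l i j = tailint 0 i j - wJ a (fun u : R => E u i j) l.
Proof.
have H k : tailint k i j =
    \int[lebesgue_measure]_(u in `[k, +oo[) wfun a (fun u : R => E u i j) u.
  by rewrite mxE; apply: eq_Rintegral => u _; rewrite mxE.
by move=> l0; rewrite !H Rintegral_tail.
Qed.

(* [expint h] is the integral of [sgn u |u|^(a-1) exp(- u A)] from [0] to [h]. *)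
Definition expint h : 'M[R]_n :=
  if 0 <= h then intN h else \matrix_(i, j) wJ a (fun u : R => E u i j) (- h).

(* [Theta h] is the integral over [w >= 0] of [psi'(h - w) exp(w A)]. *)
Definition Theta h : 'M[R]_n := (a / 2) *: (E h *m (expint h - tailint 0)).

Lemma Theta_ge0 (h : R) : 0 <= h ->
  Theta h = (a / 2) *: (E h *m intN h) - (a / 2) *: (E h *m tailint 0).
Proof. by move=> h0; rewrite /Theta /expint h0 mulmxBr scalerBr. Qed.

(** For [w >= 0] the argument [- h - w] of [psi'] never becomes positive, so the substitution
    [u = h + w] leaves a single tail integral. *)
Lemma Theta_le0 (h : R) : 0 <= h -> Theta (- h) = - ((a / 2) *: (E (- h) *m tailint h)).
Proof.
move=> h0; rewrite /Theta /expint -scalerN -mulmxN; congr (_ *: (_ *m _)).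
apply/matrixP => i j.
rewrite mxBE mxNE (tailintE i j h0) opprB.
congr (_ - _); case: ifPn => [|_]; last by rewrite mxE opprK.
(* Only [h = 0] takes the first branch of [expint] here, and there both branches vanish. *)
rewrite oppr_ge0 => h0'; have -> : h = 0 by apply/le_anti; rewrite h0 h0'.
by rewrite oppr0 intNE !wJ0.
Qed.

Lemma expint_der (x : R) : x != 0 ->
  mxder expint x ((Num.sg x * `|x| `^ (a - 1)) *: expmx (- x *: A)).
Proof.
move=> x0 i j; rewrite mxE.
case: (ltgtP x 0) x0 => // x0 _.
  have Nx : 0 < -1 * x + 0 by lra.
  have d := der_comp_aff (wJ_der a0 (@expmx_ctns _ _ A i j) Nx).
  apply: (near_eq_is_derive _ (is_derive_eq d _)).
    near=> y; rewrite /expint mulN1r addr0 ifF ?mxE//.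
    apply/negbTE; rewrite -ltNge; near: y; exact: lt_nbhsl.
  by rewrite ltr0_sg// ltr0_norm// /wfun addr0 !mulN1r mulNr.
have d := wJ_der a0 (@EN_cts i j) x0.
apply: (near_eq_is_derive _ (is_derive_eq d _)).
  near=> y; rewrite /expint ifT ?intNE//.
  by apply: ltW; near: y; exact: near_gt0.
by rewrite gtr0_sg// gtr0_norm// /wfun mul1r.
Unshelve. all: by end_near. Qed.

Lemma expint_cts i j : continuous (fun x => expint x i j).
Proof.
move=> x; have [->|x0] := eqVneq x 0; last exact: der_cts (expint_der x0 i j).
have e0 : expint 0 i j = 0 by rewrite /expint lexx intNE wJ0.
have c1 : wJ a (fun u : R => E u i j) x @[x --> (0 : R)] --> 0.
  by rewrite -{2}(wJ0 a (fun u : R => E u i j)); exact: (wJ_cts0 a0 (expmx_ctns (A := A) (i := i) (j := j))).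
have c2 : wJ a (fun u : R => expmx (- u *: A) i j) x @[x --> (0 : R)] --> 0.
  by rewrite -{2}(wJ0 a (fun u : R => expmx (- u *: A) i j)); exact: (wJ_cts0 a0 (@EN_cts i j)).
apply/cvgrPdist_le => e ep; rewrite e0.
have /cvgrPdist_le/(_ e ep)[r1 /= r1p H1] := c1.
have /cvgrPdist_le/(_ e ep)[r2 /= r2p H2] := c2.
exists (Num.min r1 r2); first by rewrite /= lt_min r1p.
move=> y; rewrite /ball_/= lt_min => /andP[y1 y2].
rewrite /expint; case: ifPn => y0; first by rewrite intNE; exact: H2.
by rewrite mxE; apply: H1; rewrite /ball_/= opprK add0r -normrN -sub0r.
Qed.

Lemma Theta_der (x : R) : x != 0 -> mxder Theta x (A *m Theta x + (dpsi x)%:M).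
Proof.
move=> x0.
have d1 := mxderB (expint_der x0) (mxder_cst (tailint 0) x).
have d2 := mxderM (expmx_derl A x) d1.
have d3 := mxderZ (der_cst (a / 2) x) d2.
apply: mxder_eq d3 _.
rewrite scale0r add0r subr0 scalerDr /Theta -(scalemxAr (a / 2) A) mulmxA; congr (_ + _).
by rewrite -scalemxAr expmxKN scalerA -/(dpsi x) scalemx1.
Qed.

Lemma Theta_cts i j : continuous (fun x => Theta x i j).
Proof.
move=> x; rewrite /Theta.
have -> : (fun x => ((a / 2) *: (E x *m (expint x - tailint 0))) i j) =
   (fun x => a / 2 * \sum_l E x i l * (expint x l j - tailint 0 l j)).
  apply/funext => u; rewrite mxE mxE; congr (_ * _).
  by apply: eq_bigr => l _; rewrite mxBE.
apply: cvgMl_tmp; apply: cvg_sumr => l; apply: cvgM; first exact: expmx_ctns.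
by apply: cvgB; [exact: expint_cts|exact: cvg_cst].
Qed.

Hypothesis Au : A \in unitmx.

Definition Xi x : 'M[R]_n := invmx A *m (Theta x - (psi x)%:M).

Lemma ThetaE (x : R) : Theta x = A *m Xi x + (psi x)%:M.
Proof. by rewrite /Xi mulKVmx// subrK. Qed.

Lemma mxder_scalar (f : R -> R) (x d : R) : is_derive x (1 : R) f d ->
  mxder (fun u => (f u)%:M : 'M[R]_n) x d%:M.
Proof.
move=> fd i j; rewrite mxE; under eq_fun do rewrite mxE.
by case: (i == j); rewrite ?mulr1n// !mulr0n; exact: der_cst.
Qed.

(** Away from 0 the terms [psi'] cancel. At 0, where [psi] may have no derivative, [Xi] and [Theta]
    are continuous and [der_extend] concludes. *)
Lemma Xi_der (x : R) : mxder Xi x (Theta x).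
Proof.
have off y : y != 0 -> mxder Xi y (Theta y).
  move=> y0.
  apply: mxder_eq (mxderMl _ (mxderB (Theta_der y0) (mxder_scalar (psi_der y0)))) _.
  by rewrite addrK mulKmx.
have [->|] := eqVneq x 0; last exact: off.
move=> i j; apply: (@der_extend _ (fun u => Xi u i j) (fun u => Theta u i j)).
- move=> y; rewrite /Xi.
  have -> : (fun x => (invmx A *m (Theta x - (psi x)%:M)) i j) =
     (fun x => \sum_l invmx A i l * (Theta x l j - psi x *+ (l == j))).
    apply/funext => u; rewrite mxE; apply: eq_bigr => l _.
    by rewrite mxBE [X in _ - X]mxE.
  apply: cvg_sumr => l; apply: cvgMl_tmp; apply: cvgB; first exact: Theta_cts.
  case: (l == j); first by rewrite mulr1n; exact: psi_cts.
  by rewrite mulr0n; exact: cvg_cst.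
- exact: Theta_cts.
- by move=> y y0; exact: off.
Qed.

(** The factor [exp(l A)] cancels the [exp(- l A)] inside [Theta (- l)] exactly, leaving the tail of
    a convergent integral. *)
Lemma cvg_Theta_Ny i j : (E l *m Theta (- l)) i j @[l --> +oo] --> 0.
Proof.
have H l : 0 <= l -> (E l *m Theta (- l)) i j =
    (a / 2) * (wJ a (fun u : R => E u i j) l - tailint 0 i j).
  move=> l0; rewrite Theta_le0// mulmxN -scalemxAr mulmxA expmxKN mul1mx.
  by rewrite mxNE mxE (tailintE i j l0) -mulrN opprB.
have : a / 2 * (wJ a (fun u : R => E u i j) l - tailint 0 i j) @[l --> +oo] --> 0.
  have c1 : wJ a (fun u : R => E u i j) l @[l --> +oo] --> tailint 0 i j.
    have -> : tailint 0 i j =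
      \int[lebesgue_measure]_(u in `[0, +oo[) wfun a (fun u : R => E u i j) u.
      by rewrite mxE; apply: eq_Rintegral => u _; rewrite mxE.
    exact: cvg_Rintegral_y.
  move: (tailint 0 i j) c1 => t c1.
  have c2 : a / 2 * (wJ a (fun u : R => E u i j) l - t) @[l --> +oo] -->
      a / 2 * (t - t).
    by apply: cvgMl_tmp; apply: cvgB => //; exact: cvg_cst.
  by move: c2; rewrite subrr mulr0.
apply: cvg_trans; apply: near_eq_cvg; near=> l; rewrite H//.
Unshelve. all: by end_near. Qed.

End fractional_kernel.

(** * Growth of the fractional kernel at infinity *)

Section theta_growth.
Context {R : realType}.

Lemma cvg_expRN (k : R) : 0 < k -> expR (- k * x) @[x --> +oo] --> 0.
Proof.
move=> k0; apply/cvgrPdist_le => e e0; near=> x.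
rewrite sub0r normrN ger0_norm ?expR_ge0// mulNr expRN.
rewrite -[leRHS]invrK lef_pV2 ?posrE ?invr_gt0 ?expR_gt0//.
rewrite (le_trans _ (expR_ge1Dx _))//.
have : e^-1 / k <= x by near: x; apply: nbhs_pinfty_ge; exact: num_real.
by rewrite ler_pdivrMr// mulrC => h; rewrite (le_trans h)// lerDr.
Unshelve. all: by end_near. Qed.

Lemma expR_bound_cvg0 (f : R -> R) K k x0 : 0 < k ->
  (forall x, x0 <= x -> `|f x| <= K * expR (- k * x)) -> f x @[x --> +oo] --> 0.
Proof.
move=> k0 fK; have c : K * expR (- k * x) @[x --> +oo] --> 0.
  by rewrite -[X in _ --> X](mulr0 K); apply: cvgMl_tmp; exact: cvg_expRN.
apply/norm_cvg0P; apply: (@squeeze_cvgr _ _ _ _ (fun=> 0) _ _ _ _ _ c).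
  near=> x; rewrite normr_ge0/= fK//.
exact: cvg_cst.
Unshelve. all: by end_near. Qed.

Lemma decaying_mulr m n k c (F : R -> 'M[R]_(m, n)) (M : 'M[R]_(n, k)) :
  decaying c F -> decaying c (fun x => F x *m M).
Proof.
move=> [K HK]; apply: decaying_entries => i j.
exists (K * \sum_l `|M l j|) => x x0; rewrite mxE (le_trans (ler_norm_sum _ _ _))//.
rewrite mulrAC mulr_sumr ler_sum// => l _.
by rewrite normrM ler_wpM2r// HK.
Qed.

Lemma decaying_mull m n k c (F : R -> 'M[R]_(n, k)) (M : 'M[R]_(m, n)) :
  decaying c F -> decaying c (fun x => M *m F x).
Proof.
move=> [K HK]; apply: decaying_entries => i j.
exists ((\sum_l `|M i l|) * K) => x x0; rewrite mxE (le_trans (ler_norm_sum _ _ _))//.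
rewrite -mulrA mulr_suml ler_sum// => l _.
by rewrite normrM ler_wpM2l// HK.
Qed.

Lemma decaying_ge0 m n c (F : R -> 'M[R]_(m, n)) : decaying c F ->
  exists2 K : R, 0 <= K & forall (x : R) i j, 0 <= x -> `|F x i j| <= K * expR (- c * x).
Proof.
move=> [K HK]; exists `|K| => // x i j x0.
by rewrite (le_trans (HK x i j x0))// ler_wpM2r ?expR_ge0// ler_norm.
Qed.

Variables (a c : R) (n : nat) (A : 'M[R]_n).
Hypothesis a0 : 0 < a.
Hypothesis c0 : 0 < c.
Hypothesis Adec : decaying c (fun x => expmx (x *: A)).
Local Notation E x := (expmx (x *: A)).

Lemma expmx_decay_bounded m (M : 'M[R]_(n, m)) : exists2 K : R, 0 <= K &
  forall (x : R) i j, 0 <= x -> `|(E x *m M) i j| <= K.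
Proof.
have [K K0 HK] := decaying_ge0 (decaying_mulr M Adec).
exists K => // x i j x0; rewrite (le_trans (HK x i j x0))//.
by rewrite ler_piMr// -[leRHS]expR0 ler_expR mulNr oppr_le0 mulr_ge0// ltW.
Qed.

(** Deliberately crude: it is only used against a factor [exp(l A) = O(exp(- c l))], so any rate
    below [c] will do. *)
Lemma Theta_growth i j : exists C, forall l : R, 1 <= l ->
  `|Theta a A l i j| <= C * expR (c / 2 * l).
Proof.
have [K K0 HK] := expmx_decay_bounded 1%:M.
have [K1 K10 HK1] := expmx_decay_bounded (expint a A 1).
have [K2 K20 HK2] := expmx_decay_bounded (tailint a A 0).
have [K3 HK3] := powR_le_expR (ltW a0) (divr_gt0 c0 (ltr0Sn R 1)).
exists (a / 2 * ((K / a) * K3 + K1 + K2)) => l l1.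
have l0 : 0 <= l by lra.
(* With [l] frozen, the derivative of [exp(l A) expint u] is [u^(a-1) exp((l - u) A)], and the
   exponential is bounded. Starting at 1 avoids the singularity at 0. *)
have b1 : `|(E l *m expint a A l) i j - (E l *m expint a A 1) i j| <=
    K / a * l `^ a - K / a * 1 `^ a.
  apply: (@der_bound _ (fun u => (E l *m expint a A u) i j) (fun u => K / a * u `^ a)
    (fun u => (E l *m ((Num.sg u * `|u| `^ (a - 1)) *: expmx (- u *: A))) i j)
    (fun u => K / a * (a * u `^ (a - 1)))) => // u /andP[u1 ul].
  - have u0 : u != 0 by rewrite gt_eqF//; lra.
    exact: (mxderMl (E l) (expint_der a0 A u0) i j).
  - by apply: derZ; apply: is_derive1_powR; lra.
  - have u0 : 0 < u by lra.
    rewrite /= (gtr0_sg u0) (gtr0_norm u0) mul1r -scalemxAr -expmxD mxE normrM.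
    rewrite ger0_norm ?powR_ge0// mulrA divfK ?gt_eqF// mulrC ler_wpM2r ?powR_ge0//.
    by rewrite -[expmx _]mulmx1 HK// subr_ge0.
have e1 : 1 <= expR (c / 2 * l).
  by rewrite -[leLHS]expR0 ler_expR mulr_ge0// divr_ge0// ltW.
rewrite /Theta mxE normrM ger0_norm ?divr_ge0 ?(ltW a0)//.
rewrite -mulrA ler_wpM2l ?divr_ge0 ?(ltW a0)// mulmxBr mxBE.
have b2 : `|(E l *m expint a A l) i j| <= K / a * l `^ a + K1.
  have := ler_normD ((E l *m expint a A l) i j - (E l *m expint a A 1) i j)
    ((E l *m expint a A 1) i j).
  have b0 : 0 <= K / a * 1 `^ a by rewrite mulr_ge0 ?powR_ge0// divr_ge0// ltW.
  have b := HK1 l i j l0.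
  by rewrite subrK; lra.
rewrite (le_trans (ler_normB _ _))//.
have b3 := HK2 l i j l0.
have b4 : K / a * l `^ a <= K / a * (K3 * expR (c / 2 * l)).
  by rewrite ler_wpM2l ?HK3// divr_ge0// ltW.
have b5 : K1 * 1 <= K1 * expR (c / 2 * l) by rewrite ler_wpM2l.
have b6 : K2 * 1 <= K2 * expR (c / 2 * l) by rewrite ler_wpM2l.
by rewrite !mulrDl -mulrA; lra.
Qed.

Lemma cvg_Theta_y m (M : 'M[R]_n) (N : 'M[R]_(n, m)) i j :
  (E l *m M *m (Theta a A l)^T *m N) i j @[l --> +oo] --> 0.
Proof.
have [K K0 HK] := decaying_ge0 (decaying_mulr M Adec).
have [C HC] : exists C, forall j k, forall l : R, 1 <= l ->
    `|Theta a A l j k| <= C * expR (c / 2 * l).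
  have up j' k' (C C' : R) : C <= C' ->
      (forall l, 1 <= l -> `|Theta a A l j' k'| <= C * expR (c / 2 * l)) ->
      forall l, 1 <= l -> `|Theta a A l j' k'| <= C' * expR (c / 2 * l).
    by move=> CC h l l1; rewrite (le_trans (h l l1))// ler_wpM2r ?expR_ge0.
  apply: (@fin_choose_bound _ _ (fun j C => forall k l, 1 <= l ->
    `|Theta a A l j k| <= C * expR (c / 2 * l))) => [j'|j' C C' CC h k'].
    apply: (@fin_choose_bound _ _ (fun k C => forall l, 1 <= l ->
      `|Theta a A l j' k| <= C * expR (c / 2 * l))) => [k'|k' C C'].
      exact: Theta_growth.
    exact: up.
  exact: up (h k').
have -> : (fun l => (E l *m M *m (Theta a A l)^T *m N) i j) =
    (fun l => \sum_k (\sum_h (E l *m M) i h * Theta a A l k h) * N k j).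
  apply/funext => l; rewrite mxE; apply: eq_bigr => k _; congr (_ * _).
  by rewrite mxE; apply: eq_bigr => h _; rewrite [_^T _ _]mxE.
have z : \sum_(k < n) (\sum_(h < n) (0 : R)) * N k j = 0.
  by rewrite big1// => k _; rewrite big1 ?mul0r.
rewrite -[X in _ --> X]z; apply: cvg_sumr => k; apply: cvgMr_tmp; apply: cvg_sumr => h.
apply: (@expR_bound_cvg0 _ (K * C) (c / 2) 1); first by rewrite divr_gt0.
move=> l l1; rewrite normrM.
apply: (@le_trans _ _ ((K * expR (- c * l)) * (C * expR (c / 2 * l)))).
  by rewrite ler_pM// ?HK ?HC//; lra.
rewrite mulrACA -expRD le_eqVlt; apply/orP; left; apply/eqP; congr (_ * expR _).
by field.
Qed.

End theta_growth.

(** * Mean-square integrals *)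

Section riemann_stieltjes.
Context {R : realType}.

Lemma unif_continuous_itv (f : R -> R) (a b e : R) : continuous f -> 0 < e ->
  exists2 d : R, 0 < d & forall x y : R, a <= x <= b -> `|x - y| < d -> `|f x - f y| <= e.
Proof.
move=> cf e0.
have /compact_near_coveringP cov : compact `[a, b]%classic by exact: segment_compact.
pose Q (d : R) (x : R) := forall y, `|x - y| < d -> `|f x - f y| <= e.
have : \forall d \near 0^'+, `[a, b]%classic `<=` Q d.
  apply: cov => x _.
  have /cvgrPdist_lt/(_ (e / 2)) := cf x.
  move=> /(_ (divr_gt0 e0 (ltr0Sn R 1)))[r /= r0 Hr].
  have r20 : 0 < r / 2 by rewrite divr_gt0.
  exists (ball x (r / 2), [set d : R | d < r / 2]) => /=.
    split; first exact: nbhsx_ballx.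
    by apply: nbhs_right_lt.
  move=> [x' d]/= [xx' dr] y x'y.
  have h1 : `|f x - f x'| < e / 2 by apply: Hr => /=; rewrite (lt_trans xx')//; lra.
  have h2 : `|f x - f y| < e / 2.
    apply: Hr; rewrite /ball_/= -(subrK x' x) -addrA.
    rewrite (le_lt_trans (ler_normD _ _))//.
    have : `|x - x'| < r / 2 by [].
    lra.
  rewrite -(subrK (f x) (f x')) -addrA (le_trans (ler_normD _ _))//.
  rewrite (distrC (f x')); lra.
move=> H; have [d [d0 Hd]] := filter_ex (filterI (nbhs_right_gt (0 : R)) H).
by exists d => // x y xab xy; apply: (Hd x) => //=.
Qed.

Definition upart (a b : R) (N i : nat) : R := a + (b - a) / N%:R * i%:R.

(* [G' = - p' mu] makes [p mu + G] the integral of [p] against [mu]. *)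
Lemma riemann_stieltjes_sum (p dp mu G : R -> R) (a b K : R) : a <= b ->
  (forall x, is_derive x (1 : R) p (dp x)) ->
  (forall x, is_derive x (1 : R) G (- (dp x * mu x))) ->
  continuous mu ->
  (forall x, a <= x <= b -> `|dp x| <= K) ->
  forall e, 0 < e -> exists N0 : nat, forall N, (N0 <= N)%N -> (0 < N)%N ->
    `|\sum_(i < N) p (upart a b N i) * (mu (upart a b N i.+1) - mu (upart a b N i))
      - (p b * mu b + G b - (p a * mu a + G a))| <= e.
Proof.
move=> ab dP dG cmu dK e e0.
have K0 : 0 <= K by apply: le_trans (dK a _); rewrite ?lexx ?ab.
have ba : 0 <= b - a by rewrite subr_ge0.
(* A cell of length [h] will contribute at most [K e' h]; the [+ 1] keeps the denominator
   positive. *)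
pose e' := e / (K * (b - a) + 1).
have k1 : 0 < K * (b - a) + 1 by rewrite ltr_wpDl// mulr_ge0.
have e'0 : 0 < e' by rewrite divr_gt0.
have [d d0 Hd] := unif_continuous_itv a b cmu e'0.
exists (Num.truncn ((b - a) / d)).+1 => N N0N N0; set v := upart a b N.
pose h := (b - a) / N%:R.
have N0' : 0 < (N%:R : R) by rewrite ltr0n.
have hd : h < d.
  rewrite ltr_pdivrMr// mulrC -ltr_pdivrMr//.
  by rewrite (lt_le_trans (Num.Theory.truncnS_gt _))// ler_nat.
have h0 : 0 <= h by rewrite divr_ge0// ltW.
have vS i : v i.+1 = v i + h by rewrite /v /upart -addrA -natr1 mulrDr mulr1.
have va i : (i <= N)%N -> a <= v i <= b.
  move=> iN; rewrite /v /upart lerDl mulr_ge0//= -lerBrDl mulrAC ler_pdivrMr//.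
  by rewrite ler_wpM2l// ler_nat.
pose F x := p x * mu x + G x.
have vN : v N = b by rewrite /v /upart divfK ?gt_eqF// addrC subrK.
have v0 : v 0 = a by rewrite /v /upart mulr0 addr0.
have -> : p b * mu b + G b - (p a * mu a + G a) = \sum_(i < N) (F (v i.+1) - F (v i)).
  by rewrite -(big_mkord xpredT (fun i => F (v i.+1) - F (v i))) telescope_sumr// vN v0.
rewrite -sumrB (le_trans (ler_norm_sum _ _ _))//.
apply: (@le_trans _ _ (\sum_(i < N) K * e' * h)); last first.
  rewrite sumr_const card_ord -mulr_natr -mulrA divfK ?gt_eqF// /e'.
  have -> : K * (e / (K * (b - a) + 1)) * (b - a) = e * (K * (b - a)) / (K * (b - a) + 1).
    by field; rewrite gt_eqF.
  rewrite ler_pdivrMr// ler_wpM2l ?(ltW e0)//.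
  by rewrite lerDl.
apply: ler_sum => i _.
have /andP[a1 b1] := va i (ltnW (ltn_ord i)).
have /andP[a2 b2] := va i.+1 (ltn_ord i).
(* Freezing [mu] at the right end of the cell turns the error into an increment of [k], with
   [k' = dp (mu (v i.+1) - mu x)]. Uniform continuity of [mu] is then enough. *)
pose k x := G x + mu (v i.+1) * p x.
have -> : p (v i) * (mu (v i.+1) - mu (v i)) - (F (v i.+1) - F (v i)) =
    - (k (v i.+1) - k (v i)) by rewrite /F /k; ring.
rewrite normrN.
have vv : v i <= v i.+1 by rewrite vS lerDl.
have -> : K * e' * h = K * e' * v i.+1 - K * e' * v i by rewrite vS; ring.
have dk (x : R) : is_derive x (1 : R) k (- (dp x * mu x) + mu (v i.+1) * dp x).
  exact: (derD (dG x) (derZ _ (dP x))).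
apply: (@der_bound _ k (fun x => K * e' * x) (fun x => - (dp x * mu x) + mu (v i.+1) * dp x)
  (fun=> K * e')) => // x.
  by move=> _; apply: (is_derive_eq (derZ (K * e') (is_derive_id x (1 : R)))); rewrite mulr1.
move=> /andP[vx xv].
have -> : - (dp x * mu x) + mu (v i.+1) * dp x = dp x * (mu (v i.+1) - mu x) by ring.
rewrite normrM ler_pM// ?dK ?(le_trans a1 vx) ?(le_trans xv b2)//.
apply: Hd; first by rewrite a2.
by rewrite ger0_norm ?subr_ge0//; move: hd; rewrite vS in xv *; lra.
Qed.

End riemann_stieltjes.

(** * Square-integrable random variables *)

Section square_integrable.
Context d (T : measurableType d) (R : realType) (P : probability T R).
Implicit Types (X Y Z : T -> R).

Definition sqi X := measurable_fun setT X /\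
  P.-integrable setT (fun w => (X w * X w)%:E).

Definition ip X Y : R := \int[P]_w (X w * Y w).

Lemma sqi_prod X Y : sqi X -> sqi Y -> P.-integrable setT (fun w => (X w * Y w)%:E).
Proof.
move=> [mX iX] [mY iY].
have iXY := integrableD measurableT iX iY.
apply: le_integrable iXY => //.
  by apply/measurable_EFinP; exact: measurable_funM.
move=> w _; rewrite -EFinD !abse_EFin lee_fin.
rewrite (@ger0_norm _ (_ + _)) ?addr_ge0 -?expr2 ?sqr_ge0//.
rewrite ler_norml; apply/andP; split.
  rewrite -subr_ge0 opprK; have := sqr_ge0 (X w + Y w); have := sqr_ge0 (X w - Y w).
  by rewrite !expr2; lra.
by have := sqr_ge0 (X w + Y w); have := sqr_ge0 (X w - Y w); rewrite !expr2; lra.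
Qed.

Lemma sqiD X Y : sqi X -> sqi Y -> sqi (fun w => X w + Y w).
Proof.
move=> sX sY; have [mX iX] := sX; have [mY iY] := sY; split.
  exact: measurable_funD.
have iXY := sqi_prod sX sY.
have h := integrableD measurableT (integrableD measurableT iX iY)
  (integrableD measurableT iXY iXY).
apply: eq_integrable h => // w _ /=; rewrite -!EFinD; congr EFin.
by ring.
Qed.

Lemma sqiZ c X : sqi X -> sqi (fun w => c * X w).
Proof.
move=> [mX iX]; split; first exact: measurable_funM.
apply: eq_integrable (integrableZl measurableT (c * c) iX) => // w _.
by rewrite -EFinM; congr EFin; ring.
Qed.

Lemma sqiB X Y : sqi X -> sqi Y -> sqi (fun w => X w - Y w).
Proof.
move=> sX sY; have := sqiD sX (sqiZ (-1) sY).
by under eq_fun do rewrite mulN1r.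
Qed.

Lemma sqi_cst c : sqi (fun=> c).
Proof.
split; first exact: measurable_cst.
exact: (finite_measure_integrable_cst P (c * c)).
Qed.

Lemma sqi_sum n (X : 'I_n -> T -> R) : (forall i, sqi (X i)) ->
  sqi (fun w => \sum_i X i w).
Proof.
move=> sX; elim: n X sX => [|n IH] X sX.
  by under eq_fun do rewrite big_ord0; exact: sqi_cst.
under eq_fun do rewrite big_ord_recl.
by apply: sqiD => //; exact: IH.
Qed.

Lemma ipC X Y : ip X Y = ip Y X.
Proof. by apply: eq_Rintegral => w _; rewrite mulrC. Qed.

Lemma ipZ c X Y : sqi X -> sqi Y -> ip (fun w => c * X w) Y = c * ip X Y.
Proof.
move=> sX sY; rewrite -RintegralZl//; last exact: sqi_prod.
by apply: eq_Rintegral => w _; rewrite mulrA.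
Qed.

Lemma ipD X Y Z : sqi X -> sqi Y -> sqi Z ->
  ip (fun w => X w + Y w) Z = ip X Z + ip Y Z.
Proof.
move=> sX sY sZ; rewrite /ip -RintegralD//; try exact: sqi_prod.
by apply: eq_Rintegral => w _; rewrite mulrDl.
Qed.

Lemma ipB X Y Z : sqi X -> sqi Y -> sqi Z ->
  ip (fun w => X w - Y w) Z = ip X Z - ip Y Z.
Proof.
move=> sX sY sZ; rewrite -[X in _ = _ + X]mulN1r -ipZ// -ipD//; last exact: sqiZ.
by apply: eq_Rintegral => w _; rewrite mulN1r.
Qed.

Lemma ip_sum n (X : 'I_n -> T -> R) Z : (forall i, sqi (X i)) -> sqi Z ->
  ip (fun w => \sum_i X i w) Z = \sum_i ip (X i) Z.
Proof.
move=> sX sZ; elim: n X sX => [|n IH] X sX.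
  rewrite big_ord0 /ip; under eq_Rintegral do rewrite big_ord0 mul0r.
  by rewrite /Rintegral integral0.
rewrite big_ord_recl -IH// -ipD//; last by apply: sqi_sum => i.
by apply: eq_Rintegral => w _; rewrite big_ord_recl.
Qed.

Lemma ip_ge0 X : 0 <= ip X X.
Proof. by apply: Rintegral_ge0 => w _; rewrite -expr2 sqr_ge0. Qed.

(** A weighted inequality in place of Cauchy-Schwarz: a suitable [k] makes the pairing with a fixed
    [Z] continuous in mean square. *)
Lemma ip_bound X Z k : 0 < k -> sqi X -> sqi Z ->
  `|ip X Z| <= k * ip X X + ip Z Z / k.
Proof.
move=> k0 sX sZ.
rewrite (le_trans (le_normr_Rintegral measurableT (sqi_prod sX sZ)))//.
have iX := sX.2; have iZ := sZ.2.
have -> : ip Z Z / k = k^-1 * ip Z Z by rewrite mulrC.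
rewrite /ip -RintegralZl// -RintegralZl// -RintegralD//; last 2 first.
- by apply: eq_integrable (integrableZl measurableT k iX).
- by apply: eq_integrable (integrableZl measurableT k^-1 iZ).
apply: le_Rintegral => //.
- have := integrable_abse (sqi_prod sX sZ).
  by apply: eq_integrable.
- apply: eq_integrable (integrableD measurableT
    (integrableZl measurableT k iX) (integrableZl measurableT k^-1 iZ)) => // w _.
move=> w _.
have e : k * (X w * X w) + k^-1 * (Z w * Z w) - 2 * (X w * Z w) =
    (k * X w - Z w) ^+ 2 / k by field; rewrite gt_eqF.
have e' : k * (X w * X w) + k^-1 * (Z w * Z w) + 2 * (X w * Z w) =
    (k * X w + Z w) ^+ 2 / k by field; rewrite gt_eqF.
have h : 0 <= (k * X w - Z w) ^+ 2 / k by rewrite divr_ge0 ?sqr_ge0// ltW.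
have h' : 0 <= (k * X w + Z w) ^+ 2 / k by rewrite divr_ge0 ?sqr_ge0// ltW.
have p1 : 0 <= k * (X w * X w) by rewrite mulr_ge0 -?expr2 ?sqr_ge0// ltW.
have p2 : 0 <= k^-1 * (Z w * Z w) by rewrite mulr_ge0 -?expr2 ?sqr_ge0 ?invr_ge0// ltW.
by rewrite ler_norml; apply/andP; split; lra.
Qed.

Lemma ip_close Z e : sqi Z -> 0 < e -> exists2 q : R, 0 < q &
  forall X J, sqi X -> sqi J -> ip (fun w => X w - J w) (fun w => X w - J w) <= q ->
  `|ip X Z - ip J Z| <= e.
Proof.
move=> sZ e0; have C0 := ip_ge0 Z.
(* This makes [ip Z Z / k] at most [e / 2], and [q] does the same for the other term; the [+ 1]
   covers [ip Z Z = 0]. *)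
pose k := 2 * (ip Z Z + 1) / e.
have k0 : 0 < k by rewrite divr_gt0// mulr_gt0// ltr_wpDl.
exists (e / (2 * k)); first by rewrite divr_gt0// mulr_gt0.
move=> X J sX sJ qXJ; rewrite -ipB//.
rewrite (le_trans (ip_bound k0 (sqiB sX sJ) sZ))//.
have h1 : k * ip (fun w => X w - J w) (fun w => X w - J w) <= e / 2.
  apply: (@le_trans _ _ (k * (e / (2 * k)))); first by rewrite ler_wpM2l// ltW.
  by rewrite le_eqVlt; apply/orP; left; apply/eqP; field; rewrite gt_eqF.
have h2 : ip Z Z / k <= e / 2.
  rewrite ler_pdivrMr// /k.
  have -> : e / 2 * (2 * (ip Z Z + 1) / e) = ip Z Z + 1 by field; rewrite gt_eqF.
  by rewrite lerDl.
lra.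
Qed.

(** The expectation is an extended real, so a strict real bound excludes [+oo]. In this way the
    mean-square definitions themselves supply integrability. *)
Lemma sqi_expectation X e : measurable_fun setT X ->
  ('E_P[(fun w => X w ^+ 2)%R] < e%:E)%E -> sqi X /\ ip X X < e.
Proof.
move=> mX; rewrite unlock => h.
have sX : sqi X.
  split=> //; apply/integrableP; split.
    by apply/measurable_EFinP; exact: measurable_funM.
  rewrite (le_lt_trans _ (lt_trans h (ltry e)))//.
  apply: ge0_le_integral => //.
  - by apply/measurableT_comp => //; apply/measurable_EFinP; exact: measurable_funM.
  - by apply/measurable_EFinP; exact: measurable_funX.
  - by move=> w _; rewrite -expr2 /= ger0_norm ?sqr_ge0.
split=> //; rewrite -lte_fin (le_lt_trans _ h)// /ip /Rintegral fineK.
  by rewrite le_eqVlt; apply/orP; left; apply/eqP; apply: eq_integral => w _.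
exact: integrable_fin_num sX.2.
Qed.

End square_integrable.

(** * Pairing a mean-square integral with a random variable *)

Section ms_integral.
Context d (T : measurableType d) (R : realType) (P : probability T R).
Variable (B : R -> {RV P >-> R}).
Hypothesis sB : forall u, sqi P (B u).

Lemma nth_upart (a b : R) N i : (i <= N)%N ->
  nth b (a :: mkseq (fun i => upart a b N i.+1) N) i = upart a b N i.
Proof.
case: i => [|i] iN /=; last by rewrite nth_mkseq.
by rewrite /upart mulr0 addr0.
Qed.

Lemma upart_itv_partition (a b : R) N : a < b -> (0 < N)%N ->
  itv_partition a b (mkseq (fun i => upart a b N i.+1) N).
Proof.
move=> ab N0; have N0' : 0 < (N%:R : R) by rewrite ltr0n.
split.
  apply/(pathP b) => i; rewrite size_mkseq => iN.
  rewrite nth_upart 1?ltnW// nth_mkseq// /upart ltrD2l ltr_pM2l ?ltr_nat//.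
  by rewrite divr_gt0// subr_gt0.
rewrite (last_nth b) size_mkseq nth_upart//.
by rewrite /upart divfK ?lt0r_neq0// addrC subrK.
Qed.

Lemma riemann_sum_upart (p : R -> R) (a b : R) N w :
  riemann_sum B p a b (mkseq (fun i => upart a b N i.+1) N) (upart a b N) w =
  \sum_(i < N) p (upart a b N i) * (B (upart a b N i.+1) w - B (upart a b N i) w).
Proof.
rewrite /riemann_sum size_mkseq; apply: eq_bigr => i _.
by rewrite !nth_upart// ltnW.
Qed.

(** Pairing with [Z] is continuous in mean square, so both limits in the definition of the integral
    can be taken after pairing. [p mu + G] then acts as a primitive of [p] against [mu], whose value
    at the lower end vanishes in the limit. *)
Lemma ms_integral_ip (p dp G : R -> R) (t L : R) (J : {RV P >-> R}) (Z : T -> R) :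
  sqi P Z ->
  (forall x, is_derive x (1 : R) p (dp x)) -> continuous dp ->
  continuous (fun v => ip P (B v) Z) ->
  (forall x, is_derive x (1 : R) G (- (dp x * ip P (B x) Z))) ->
  p (t - l) * ip P (B (t - l)) Z + G (t - l) @[l --> +oo] --> 0 ->
  L = p t * ip P (B t) Z + G t ->
  is_ms_integral_ninfty B p t J ->
  sqi P J /\ ip P J Z = L.
Proof.
set mu := fun v => ip P (B v) Z.
move=> sZ dP cdp cmu dG pG0 LE [I [HI IJ]].
have sR a N : sqi P (riemann_sum B p a t (mkseq (fun i => upart a t N i.+1) N)
    (upart a t N)).
  rewrite (funext (riemann_sum_upart p a t N)).
  by apply: sqi_sum => i; apply: sqiZ; exact: sqiB.
(* Uniform partitions with left tags suffice on [[a, t]]: one error [e] comes from replacing [I a]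
   by a Riemann sum, the other from [riemann_stieltjes_sum]. *)
have key a e : a < t -> 0 < e -> sqi P (I a) /\
    `|ip P (I a) Z - (L - (p a * mu a + G a))| <= 2 * e.
  move=> at_ e0; have [q q0 Hq] := ip_close sZ e0.
  have [delta delta0 Hd] := HI a at_ q q0.
  have [K HK] : exists K, forall x, a <= x <= t -> `|dp x| <= K.
    have [x _ Hx] := EVT_max (ltW at_) (continuous_subspaceT
      (fun x => cvg_norm (cdp x) : {for x, continuous (fun x => `|dp x|)})).
    by exists `|dp x| => y yat; apply: Hx; rewrite in_itv.
  have [N0 HN] := riemann_stieltjes_sum (ltW at_) dP dG cmu HK e0.
  (* [N] must pass both the threshold of the deterministic sums and the one that brings the mesh
     below [delta]. *)
  pose N := maxn N0.+1 (Num.truncn ((t - a) / delta)).+1.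
  have N_gt0 : (0 < N)%N by rewrite leq_max.
  have N_gt0' : 0 < (N%:R : R) by rewrite ltr0n.
  have hd : (t - a) / N%:R < delta.
    rewrite ltr_pdivrMr// mulrC -ltr_pdivrMr//.
    by rewrite (lt_le_trans (Num.Theory.truncnS_gt _))// ler_nat leq_maxr.
  have N0N : (N0 <= N)%N by rewrite (leq_trans (leqnSn N0))// leq_maxl.
  have vS i : upart a t N i.+1 - upart a t N i = (t - a) / N%:R.
    by rewrite /upart -natr1; ring.
  pose Rs := riemann_sum B p a t (mkseq (fun i => upart a t N i.+1) N) (upart a t N).
  have mI : measurable_fun setT (I a) by exact: measurable_funP.
  have mRI : measurable_fun setT (fun w => Rs w - I a w).
    by apply: measurable_funB => //; exact: (sR a N).1.
  have [|sRI qRI] := @sqi_expectation _ _ _ P (fun w => Rs w - I a w) q mRI.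
    apply: (Hd _ (upart a t N) (upart_itv_partition at_ N_gt0)) => i.
    rewrite size_mkseq => iN; rewrite !nth_upart ?(ltnW iN)// vS; split=> //.
    by rewrite lexx/= -subr_ge0 vS divr_ge0 ?(ltW N_gt0')// subr_ge0 ltW.
  (* [I a] is a Riemann sum minus a mean-square error, both square integrable; the same device gives
     [sJ] below. *)
  have sI : sqi P (I a).
    have := sqiB (sR a N) sRI.
    by under eq_fun do rewrite opprB addrC subrK.
  split=> //.
  have h1 := Hq _ _ (sR a N) sI (ltW qRI).
  have h2 := HN N N0N N_gt0.
  have -> : ip P (I a) Z - (L - (p a * mu a + G a)) =
    (ip P Rs Z - (L - (p a * mu a + G a))) - (ip P Rs Z - ip P (I a) Z) by ring.
  rewrite (le_trans (ler_normB _ _))// mulr_natl mulr2n lerD//.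
  suff -> : ip P Rs Z = \sum_(i < N) p (upart a t N i) * (mu (upart a t N i.+1) - mu (upart a t N i)).
    by rewrite LE.
  rewrite /Rs (funext (riemann_sum_upart p a t N)) ip_sum// => [|i]; last first.
    by apply: sqiZ; exact: sqiB.
  by apply: eq_bigr => i _; rewrite ipZ ?ipB//; exact: sqiB.
have near_small (q : R) : 0 < q -> \forall a \near -oo,
    ('E_P[(fun w => (I a w - J w) ^+ 2)%R] < q%:E)%E.
  move=> q0; have nq : nbhs (0%E : \bar R) [set y | (y < q%:E)%E].
    by apply: open_nbhs_nbhs; split; [exact: open_ereal_lt_ereal|rewrite /= lte_fin].
  exact: IJ nq.
have mIJ a : measurable_fun setT (fun w => I a w - J w).
  by apply: measurable_funB; exact: measurable_funP.
have sJ : sqi P J.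
  have [a [a1 a2]] := filter_ex (filterI (near_small 1 ltr01) (nbhs_ninfty_lt (num_real t))).
  have [s1 _] := sqi_expectation (mIJ a) a1.
  have [s2 _] := key a 1 a2 ltr01.
  have := sqiB s2 s1.
  by under eq_fun do rewrite opprB addrC subrK.
split=> //; apply/eqP; rewrite -subr_eq0 -normr_le0; apply/ler_addgt0Pl => e e0.
rewrite addr0; have e40 : 0 < e / 4 by rewrite divr_gt0.
have [q q0 Hq] := ip_close sZ e40.
have pG : \forall a \near -oo, `|p a * mu a + G a| <= e / 4.
  have /cvgrPdist_le/(_ _ e40) := pG0.
  move=> [M [Mr HM]]; exists (t - M); split; first exact: num_real.
  move=> a aM; have := HM (t - a); rewrite subKr sub0r normrN; apply; lra.
have [a [[a1 a2] a3]] := filter_ex (filterI (filterI (near_small q q0) pG)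
  (nbhs_ninfty_lt (num_real t))).
(* [key] doubles its argument, so this costs [e / 4], as do the boundary term and the distance from
   [I a] to [J]. *)
have e80 : 0 < e / 8 by rewrite divr_gt0.
have [sI h1] := key a _ a3 e80.
have [_ h2] := sqi_expectation (mIJ a) a1.
have h3 := Hq _ _ sI sJ (ltW h2).
move: h1 a2 h3; rewrite !ler_norml => /andP[? ?] /andP[? ?] /andP[? ?].
by apply/andP; split; lra.
Qed.

End ms_integral.

(** * The Lyapunov equation *)

Section matrix_limits.
Context {R : realType}.

Definition mxcvg0 m n (F : R -> 'M[R]_(m, n)) :=
  forall i j, F l i j @[l --> +oo] --> 0.

Lemma eq_cvg0 (f g : R -> R) : f =1 g -> f l @[l --> +oo] --> 0 ->
  g l @[l --> +oo] --> 0.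
Proof. by move=> /funext->. Qed.

Lemma cvg0_sum n (f : 'I_n -> R -> R) : (forall i, f i l @[l --> +oo] --> 0) ->
  \sum_i f i l @[l --> +oo] --> 0.
Proof.
move=> f0; have z : \sum_(i < n) 0 = 0 :> R by rewrite big1.
suff : \sum_i f i l @[l --> +oo] --> \sum_(i < n) (0 : R) by rewrite z.
exact: cvg_sumr.
Qed.

Lemma cvg0_Ml c (f : R -> R) : f l @[l --> +oo] --> 0 ->
  c * f l @[l --> +oo] --> 0.
Proof.
move=> f0; suff : c * f l @[l --> +oo] --> c * 0 by rewrite mulr0.
exact: cvgMl_tmp.
Qed.

Lemma mxcvg0_mull m n k (M : 'M[R]_(m, n)) (F : R -> 'M[R]_(n, k)) :
  mxcvg0 F -> mxcvg0 (fun l => M *m F l).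
Proof.
move=> F0 i j; apply: (@eq_cvg0 (fun l => \sum_k M i k * F l k j)) => [l|].
  by rewrite mxE.
by apply: cvg0_sum => l; exact: cvg0_Ml.
Qed.

Lemma mxcvg0_mulr m n k (M : 'M[R]_(n, k)) (F : R -> 'M[R]_(m, n)) :
  mxcvg0 F -> mxcvg0 (fun l => F l *m M).
Proof.
move=> F0 i j; apply: (@eq_cvg0 (fun l => \sum_k M k j * F l i k)) => [l|].
  by rewrite mxE; apply: eq_bigr => h _; rewrite mulrC.
by apply: cvg0_sum => l; exact: cvg0_Ml.
Qed.

Lemma mxcvg0D m n (F G : R -> 'M[R]_(m, n)) :
  mxcvg0 F -> mxcvg0 G -> mxcvg0 (fun l => F l + G l).
Proof.
move=> F0 G0 i j; apply: (@eq_cvg0 (fun l => F l i j + G l i j)) => [l|].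
  by rewrite mxE.
suff : F l i j + G l i j @[l --> +oo] --> (0 + 0 : R) by rewrite addr0.
by apply: cvgD; [exact: F0|exact: G0].
Qed.

Lemma mxcvg0Z m n c (F : R -> 'M[R]_(m, n)) :
  mxcvg0 F -> mxcvg0 (fun l => c *: F l).
Proof.
move=> F0 i j; apply: (@eq_cvg0 (fun l => c * F l i j)) => [l|].
  by rewrite mxE.
exact: cvg0_Ml.
Qed.

Lemma mxcvg0N m n (F : R -> 'M[R]_(m, n)) :
  mxcvg0 F -> mxcvg0 (fun l => - F l).
Proof. by move=> /(mxcvg0Z (-1)); under eq_fun do rewrite scaleN1r. Qed.

Lemma mxcvg0_shift m n r (F : R -> 'M[R]_(m, n)) :
  mxcvg0 F -> mxcvg0 (fun l => F (l - r)).
Proof.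
move=> F0 i j; apply: (@cvg_comp _ _ _ (fun l => l - r) (fun l => F l i j)); last exact: F0.
exact: cvg_addrr.
Qed.

End matrix_limits.

(** * Commutation with the exponential and shifted limits *)

Section commutation.
Context {R : realType}.
Notation mu := (@lebesgue_measure R).

Lemma integrable_itvZ (I : interval R) c (f : R -> R) :
  mu.-integrable [set` I] (EFin \o f) ->
  mu.-integrable [set` I] (EFin \o (fun u => c * f u)).
Proof. by move=> fi; apply: eq_integrable (integrableZl _ c fi). Qed.

Lemma integrable_itvD (I : interval R) (f g : R -> R) :
  mu.-integrable [set` I] (EFin \o f) -> mu.-integrable [set` I] (EFin \o g) ->
  mu.-integrable [set` I] (EFin \o (fun u => f u + g u)).
Proof.
move=> fi gi.
have h : (mu.-integrable [set` I] (fun u => (EFin \o f) u + (EFin \o g) u))%E.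
  by apply: integrableD.
exact: h.
Qed.

Lemma Rintegral_lincomb (I : interval R) n (c : 'I_n -> R) (f : 'I_n -> R -> R) :
  (forall l, mu.-integrable [set` I] (EFin \o f l)) ->
  \int[mu]_(u in [set` I]) (\sum_l c l * f l u) = \sum_l c l * \int[mu]_(u in [set` I]) f l u.
Proof.
move=> fi.
suff : mu.-integrable [set` I] (EFin \o (fun u => \sum_l c l * f l u)) /\
    \int[mu]_(u in [set` I]) (\sum_l c l * f l u) = \sum_l c l * \int[mu]_(u in [set` I]) f l u.
  by case.
elim: n c f fi => [|n IH] c f fi.
  rewrite big_ord0; split.
    apply: eq_integrable (integrable0 mu [set` I]) => // u _ /=.
    by rewrite big_ord0.
  by under eq_Rintegral do rewrite big_ord0; rewrite /Rintegral integral0.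
have [i1 e1] := IH (fun l => c (lift ord0 l)) (fun l => f (lift ord0 l))
  (fun l => fi (lift ord0 l)).
have i0 := integrable_itvZ (c ord0) (fi ord0).
split.
  apply: eq_integrable (integrable_itvD i0 i1) => // u _ /=.
  by rewrite big_ord_recl.
rewrite big_ord_recl -e1 -RintegralZl// -RintegralD//.
by apply: eq_Rintegral => u _; rewrite big_ord_recl.
Qed.

Variables (a c : R) (n : nat) (A : 'M[R]_n).
Hypothesis a0 : 0 < a.
Hypothesis c0 : 0 < c.
Hypothesis Adec : decaying c (fun x => expmx (x *: A)).
Local Notation E x := (expmx (x *: A)).

Lemma mxRintegral_comm (I : interval R) (F : R -> 'M[R]_n) :
  (forall i j, mu.-integrable [set` I] (EFin \o (fun u => F u i j))) ->
  (forall u, A *m F u = F u *m A) ->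
  A *m mxRintegral [set` I] F = mxRintegral [set` I] F *m A.
Proof.
move=> iF AF; apply/matrixP => i j; rewrite !mxE.
under eq_bigr do rewrite mxE.
under [RHS]eq_bigr do rewrite mxE mulrC.
rewrite -Rintegral_lincomb// -Rintegral_lincomb//.
apply: eq_Rintegral => u _; have := congr1 (fun M : 'M[R]_n => M i j) (AF u).
by rewrite !mxE => ->; apply: eq_bigr => l _; rewrite mulrC.
Qed.

Let Eint i j : mu.-integrable `[0, +oo[ (EFin \o wfun a (fun u : R => E u i j)).
Proof.
have [K HK] := Adec; apply: (wfun_integrable a0 c0 (K := K)) => [|u u0].
  exact: expmx_ctns.
exact: HK.
Qed.

Lemma tailint_comm : A *m tailint a A 0 = tailint a A 0 *m A.
Proof.
apply: mxRintegral_comm => // [i j|u].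
  apply: eq_integrable (Eint i j) => // u _ /=.
  by rewrite mxE.
by rewrite -scalemxAr expmx_comm scalemxAl.
Qed.

Lemma expint_comm h : A *m expint a A h = expint a A h *m A.
Proof.
rewrite /expint; case: ifPn => _.
  apply: mxRintegral_comm => // [i j|u]; last first.
    rewrite -scalemxAr -scalemxAl; congr (_ *: _).
    exact: expmx_comm.
  have cE : continuous (fun u : R => expmx (- u *: A) i j).
    move=> x; apply: (@continuous_comp _ _ _ -%R (fun u : R => E u i j)).
      exact: continuousN.
    exact: expmx_ctns.
  apply: eq_integrable (wfun_integrable_itv h a0 cE) => // u _ /=.
  by rewrite mxE.
have -> : \matrix_(i, j) wJ a (fun u : R => E u i j) (- h) =
   mxRintegral `[0, - h]%classic (fun u : R => u `^ (a - 1) *: E u).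
  apply/matrixP => i j; rewrite !mxE; apply: eq_Rintegral => u _.
  by rewrite mxE.
apply: mxRintegral_comm => // [i j|u]; last first.
  by rewrite -scalemxAr expmx_comm scalemxAl.
have cE := @expmx_ctns _ _ A i j.
apply: eq_integrable (wfun_integrable_itv (- h) a0 cE) => // u _ /=.
by rewrite mxE.
Qed.

Lemma Theta_comm h : A *m Theta a A h = Theta a A h *m A.
Proof.
rewrite /Theta -scalemxAr -scalemxAl mulmxA expmx_comm -!mulmxA.
by rewrite mulmxBr mulmxBl expint_comm tailint_comm.
Qed.

Lemma mxcvg0_Theta_Ny r : mxcvg0 (fun l => E l *m Theta a A (r - l)).
Proof.
have H : mxcvg0 (fun l => E l *m Theta a A (- l)).
  by move=> i j; exact: (cvg_Theta_Ny a0 c0 Adec).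
have := mxcvg0_mull (E r) (mxcvg0_shift r H).
rewrite (_ : (fun l => E r *m _) = (fun l => E l *m Theta a A (r - l)))//.
by apply/funext => l; rewrite mulmxA -expmxD addrC subrK opprB.
Qed.

Lemma mxcvg0_Theta_y r m (M : 'M[R]_n) (N : 'M[R]_(n, m)) :
  mxcvg0 (fun l => E l *m M *m (Theta a A (l - r))^T *m N).
Proof.
have H : mxcvg0 (fun l => E l *m M *m (Theta a A l)^T *m N).
  by move=> i j; exact: (cvg_Theta_y a0 c0 Adec).
have := mxcvg0_mull (E r) (mxcvg0_shift r H).
rewrite (_ : (fun l => E r *m _) =
  (fun l => E l *m M *m (Theta a A (l - r))^T *m N))//.
by apply/funext => l; rewrite !mulmxA -expmxD addrC subrK.
Qed.

(** A row vector killed by [A] is fixed by every [exp(x A)], while the decay sends its image to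
    0. *)
Lemma decaying_unit : A \in unitmx.
Proof.
rewrite -row_free_unit -kermx_eq0; apply/eqP/row_matrixP => i.
have /sub_kermxP kA : (row i (kermx A) <= kermx A)%MS by exact: row_sub.
move: (row i (kermx A)) kA => v vA; rewrite row0.
have vE x : v *m E x = v.
  have d u : mxder (fun u => v *m E u) u 0.
    apply: mxder_eq (mxderMl v (expmx_derl A u)) _.
    by rewrite mulmxA vA mul0mx.
  by rewrite (@mxder0_cst _ _ _ (fun u => v *m E u) x 0 d) expmx0 mulmx1.
have [K K0 HK] := decaying_ge0 (decaying_mull v Adec).
apply/matrixP => k j; rewrite mxE; apply/eqP; rewrite -normr_le0.
have c1 : K * expR (- c * x) @[x --> +oo] --> 0.
  by rewrite -[X in _ --> X](mulr0 K); apply: cvgMl_tmp; exact: cvg_expRN.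
apply: (cvgr_to_ge c1); near=> x.
have -> : v k j = (v *m E x) k j by rewrite vE.
by rewrite HK.
Unshelve. all: by end_near. Qed.

End commutation.

Section lyapunov.
Context {R : realType}.
Notation mu := (@lebesgue_measure R).
Variables (c : R) (n : nat) (A D : 'M[R]_n).
Hypothesis c0 : 0 < c.
Hypothesis Adec : decaying c (fun x => expmx (x *: A)).
Local Notation E x := (expmx (x *: A)).

Let F (u : R) : 'M[R]_n := E u *m D *m expmx (u *: A^T).

Definition gramian := mxRintegral `[0, +oo[%classic F.

Let FE u : F u = E u *m D *m (E u)^T.
Proof. by rewrite /F expmx_tr. Qed.

Let F_der x : mxder F x (A *m F x + F x *m A^T).
Proof.
have d := mxderM (mxderMr D (expmx_derl A x)) (mxder_tr (expmx_derl A x)).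
apply: (@mxder_ext _ _ _ (fun u => E u *m D *m (E u)^T)) => [u|].
  by rewrite FE.
by apply: mxder_eq d _; rewrite FE trmx_mul !mulmxA.
Qed.

Let F_dec : exists K, forall i j (u : R), 0 <= u -> `|F u i j| <= K * expR (- c * u).
Proof.
have [K K0 HK] := decaying_ge0 (decaying_mulr D Adec).
have [K1 K10 HK1] := expmx_decay_bounded c0 Adec 1%:M.
exists ((K * K1) *+ n) => i j u u0; rewrite FE mxE.
rewrite (le_trans (ler_norm_sum _ _ _))//.
apply: (@le_trans _ _ (\sum_(l < n) K * expR (- c * u) * K1)).
  apply: ler_sum => l _; rewrite normrM ler_pM// ?HK//.
  have -> : (E u)^T l j = (E u *m 1%:M) j l by rewrite mulmx1 [LHS]mxE.
  by rewrite HK1.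
by rewrite sumr_const card_ord mulrAC mulrnAl.
Qed.

Let F_cts i j : continuous (fun u => F u i j).
Proof. by move=> x; exact: der_cts (F_der x i j). Qed.

Let F_int i j : mu.-integrable `[0, +oo[ (EFin \o (fun u => F u i j)).
Proof.
have [K HK] := F_dec.
(* With exponent 1 the weight is [u^0 = 1], also at [u = 0], so the weighted criterion covers
   ordinary integrals. *)
have h := wfun_integrable ltr01 c0 (F_cts (i := i) (j := j)) (HK i j).
apply: eq_integrable h => // u _ /=.
by rewrite /wfun subrr powRr0 mul1r.
Qed.

(** The integrand [F] satisfies [F' = A F + F A^T], [F 0 = D], and tends to 0; integrate [F'] over
    the half-line. *)
Lemma lyapunov : A *m gramian + gramian *m A^T = - D.
Proof.
apply/matrixP => i j; rewrite [LHS]mxE [X in X + _]mxE [X in _ + X]mxE [RHS]mxE.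
under eq_bigr do rewrite [gramian _ _]mxE.
under [X in _ + X]eq_bigr do rewrite [gramian _ _]mxE mulrC.
have i1 := F_int.
have iL : mu.-integrable `[0, +oo[ (EFin \o (fun u => (A *m F u) i j)).
  have [K HK] := F_dec.
  have dF : decaying c F by exists K => x k l; exact: HK.
  have [K' HK'] := decaying_mull A dF.
  have ct : continuous (fun u => (A *m F u) i j).
    by move=> x; exact: der_cts (mxderMl A (F_der x) i j).
  have h := wfun_integrable ltr01 c0 ct (fun u => HK' u i j).
  apply: eq_integrable h => // u _ /=.
  by rewrite /wfun subrr powRr0 mul1r.
have iR : mu.-integrable `[0, +oo[ (EFin \o (fun u => (F u *m A^T) i j)).
  have [K HK] := F_dec.
  have dF : decaying c F by exists K => x k l; exact: HK.
  have [K' HK'] := decaying_mulr A^T dF.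
  have ct : continuous (fun u => (F u *m A^T) i j).
    by move=> x; exact: der_cts (mxderMr A^T (F_der x) i j).
  have h := wfun_integrable ltr01 c0 ct (fun u => HK' u i j).
  apply: eq_integrable h => // u _ /=.
  by rewrite /wfun subrr powRr0 mul1r.
rewrite -!Rintegral_lincomb//.
have e1 : \int[mu]_(u in `[0, +oo[) (\sum_l A i l * F u l j) =
    \int[mu]_(u in `[0, +oo[) (A *m F u) i j.
  by apply: eq_Rintegral => u _; rewrite mxE.
have e2 : \int[mu]_(u in `[0, +oo[) (\sum_l A^T l j * F u i l) =
    \int[mu]_(u in `[0, +oo[) (F u *m A^T) i j.
  by apply: eq_Rintegral => u _; rewrite mxE; apply: eq_bigr => l _; rewrite mulrC.
rewrite e1 e2 -RintegralD//.
have e3 : \int[mu]_(u in `[0, +oo[) ((A *m F u) i j + (F u *m A^T) i j) =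
    \int[mu]_(u in `[0, +oo[) (A *m F u + F u *m A^T) i j.
  by apply: eq_Rintegral => u _; rewrite [RHS]mxE.
rewrite e3.
have -> : - D i j = 0 - F 0 i j by rewrite /F !expmx0 mulmx1 mul1mx sub0r.
apply: (@FTC_singular_y _ (fun u => (A *m F u + F u *m A^T) i j) (fun u => F u i j)).
- apply: eq_integrable (integrable_itvD iL iR) => // u _ /=.
  by rewrite [in RHS]mxE.
- move=> x _.
  have d := mxderD (mxderMl A (F_der x)) (mxderMr A^T (F_der x)).
  exact: der_cts (d i j).
- exact: F_cts.
- by move=> x _; exact: F_der.
- have [K HK] := F_dec.
  by apply: (@expR_bound_cvg0 _ (fun u => F u i j) K c 0) => //; exact: HK.
Qed.

Lemma gramian_sym : D^T = D -> gramian^T = gramian.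
Proof.
move=> DT; apply/matrixP => i j; rewrite !mxE; apply: eq_Rintegral => u _.
have : (F u)^T = F u by rewrite FE !trmx_mul trmxK DT mulmxA.
by move=> /matrixP/(_ i j); rewrite mxE.
Qed.

End lyapunov.

(** * Autocovariance *)

Section fbm_moments.
Context d (T : measurableType d) (R : realType) (P : probability T R).
Variables (H : R) (B : R -> {RV P >-> R}).
Hypothesis fB : fractional_brownian_motion H B.

Lemma fbm_sqi u : sqi P (B u).
Proof.
have [_ _ _ Bcov] := fB.
have mB : measurable_fun setT (B u) by exact: measurable_funP.
have h := Bcov u u.
(* The [+ 1] provides the strict inequality. *)
have [] // := @sqi_expectation _ _ _ P (B u) (fine 'E_P[(fun w => B u w * B u w)%R] + 1) mB.
under eq_fun do rewrite expr2.
by rewrite h /= lte_fin ltrDl.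
Qed.

Lemma fbm_ip u v : ip P (B u) (B v) =
  psi (2 * H) u + psi (2 * H) v - psi (2 * H) (u - v).
Proof.
have [_ _ _ Bcov] := fB.
have := Bcov u v; rewrite unlock /ip /Rintegral => -> /=.
by rewrite /psi; lra.
Qed.

Lemma fbm_mean u : ip P (B u) (fun=> 1) = 0.
Proof.
have [_ _ Bm _] := fB.
have := Bm u; rewrite unlock /ip /Rintegral => h.
under eq_integral do rewrite mulr1.
by rewrite h.
Qed.

End fbm_moments.

Section moving_average_aux.
Context {R : realType}.

Lemma mxDE m n (M N : 'M[R]_(m, n)) i j : (M + N) i j = M i j + N i j.
Proof. by rewrite mxE. Qed.

Lemma mxcvg0_ext m n (F G : R -> 'M[R]_(m, n)) : F =1 G -> mxcvg0 F -> mxcvg0 G.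
Proof. by move=> /funext ->. Qed.

Lemma mx_form_cts m n k l (M : 'M[R]_(m, n)) (N : 'M[R]_(k, l)) (F : R -> 'M[R]_(n, k)) i j :
  (forall i j, continuous (fun v => F v i j)) ->
  continuous (fun v => (M *m F v *m N) i j).
Proof.
move=> cF x.
have -> : (fun v => (M *m F v *m N) i j) =
    (fun v => \sum_h (\sum_g M i g * F v g h) * N h j).
  by apply/funext => v; rewrite mxE; apply: eq_bigr => h _; rewrite mxE.
apply: cvg_sumr => h; apply: cvgMr_tmp; apply: cvg_sumr => g; apply: cvgMl_tmp.
exact: cF.
Qed.

Lemma mul_mxBr n (b D : 'cV[R]_n) (T1 T2 : 'M[R]_n) :
  (b^T *m (T1 *m D - T2 *m D)) 0 0 = (b^T *m T1 *m D) 0 0 - (b^T *m T2 *m D) 0 0.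
Proof. by rewrite mulmxBr mxBE !mulmxA. Qed.

Lemma mul_mxBl n (M T1 T2 : 'M[R]_n) (D : 'cV[R]_n) :
  M *m (T1 *m D - T2 *m D) = M *m T1 *m D + - (M *m T2 *m D).
Proof. by rewrite mulmxBr !mulmxA. Qed.

(** A 1 by 1 matrix equals its transpose, which brings the second term to the shape of the first. *)
Lemma cov_form_algebra n (A T1 T2 G : 'M[R]_n) (b : 'cV[R]_n) :
  G^T = G -> A *m T2 = T2 *m A ->
  (b^T *m (A *m T1 *m G *m b + G *m A^T *m T2^T *m b)) 0 0 =
  (b^T *m A *m (T1 + T2) *m G *m b) 0 0.
Proof.
move=> GT AT; rewrite [in RHS]mulmxDr !mulmxDl mulmxDr !mxDE !mulmxA; congr (_ + _).
rewrite -[LHS]trace_mx11 -mxtrace_tr trace_mx11 !trmx_mul !trmxK GT !mulmxA.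
by rewrite -(mulmxA b^T T2 A) -AT mulmxA.
Qed.

Lemma fbm_ode_algebra n (A X1 X2 T1 T2 : 'M[R]_n) (D : 'cV[R]_n) (p1 p2 p : R) :
  A \in unitmx -> T1 = A *m X1 + p1%:M -> T2 = A *m X2 + p2%:M ->
  A *m (X1 *m D - X2 *m D - p *: (invmx A *m D)) + (p1 + p - p2) *: D =
  T1 *m D - T2 *m D.
Proof.
move=> Au -> ->; rewrite 2!mulmxBr -scalemxAr mulKVmx// !mulmxDl !mul_scalar_mx !mulmxA.
move: (A *m X1 *m D) (A *m X2 *m D) => x1 x2.
by apply/matrixP => i j; rewrite !mxE; ring.
Qed.

(** Here [(b^T T2 D) D = D D^T T2^T b], and the Lyapunov equation trades [D D^T + A G] for
    [- G A^T]. The terms [p A G b] coming from [X1] and [X2] cancel because both carry the same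
    [p]. *)
Lemma cov_ode_algebra n (A X1 X2 T1 T2 G : 'M[R]_n) (D b : 'cV[R]_n) (p k : R) :
  A \in unitmx -> T1 = A *m X1 + p%:M -> T2 = A *m X2 + p%:M ->
  X2 *m A = A *m X2 -> A *m G + G *m A^T = - (D *m D^T) ->
  A *m (- (k *: (invmx A *m D)) + (A *m X1 *m G *m b - G *m A^T *m X2^T *m b))
    + (k - (b^T *m T2 *m D) 0 0) *: D =
  A *m T1 *m G *m b + G *m A^T *m T2^T *m b.
Proof.
move=> Au T1E T2E XA lyap; pose y := T2^T *m b.
have -> : (k - (b^T *m T2 *m D) 0 0) *: D = k *: D - D *m D^T *m y.
  rewrite scalerBl; congr (_ - _).
  rewrite -!mulmxA -mul_mx_scalar; congr (D *m _).
  apply/matrixP => i j; rewrite !ord1 [LHS]mxE mulr1n.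
  by rewrite -[RHS]trace_mx11 -mxtrace_tr trace_mx11 /y !trmx_mul !trmxK mulmxA.
have AtXt : A^T *m X2^T = T2^T - p%:M.
  by rewrite -trmx_mul XA T2E linearD/= tr_scalar_mx addrK.
have {}lyap : A *m G = - (D *m D^T) - G *m A^T by rewrite -lyap addrK.
have e2 : A *m (A *m X1 *m G *m b) = A *m T1 *m G *m b - p *: (A *m G *m b).
  have -> : A *m X1 = T1 - p%:M by rewrite T1E addrK.
  by rewrite !mulmxA mulmxBr !mulmxBl mul_mx_scalar -!scalemxAl.
have e3 : A *m (G *m A^T *m X2^T *m b) = A *m G *m y - p *: (A *m G *m b).
  rewrite -(mulmxA G) AtXt !mulmxA mulmxBr mulmxBl mul_mx_scalar -!scalemxAl.
  by rewrite /y ?mulmxA.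
rewrite mulmxDr mulmxN mulmxBr -scalemxAr mulKVmx// e2 e3 -(mulmxA (G *m A^T)) -/y lyap.
rewrite !mulmxBl !mulNmx.
move: (k *: D) (A *m T1 *m G *m b) (D *m D^T *m b) => x1 x2 x3.
move: (D *m D^T *m y) (G *m A^T *m b) (G *m A^T *m y) => x4 x5 x6.
by apply/matrixP => i j; rewrite !mxE; ring.
Qed.

Lemma Xi_comm (a c : R) n (A : 'M[R]_n) (x : R) : 0 < a -> 0 < c ->
  decaying c (fun x => expmx (x *: A)) ->
  Xi a A x *m A = A *m Xi a A x.
Proof.
move=> a0 c0 Adec; have Au := decaying_unit c0 Adec.
rewrite /Xi mulKVmx// -mulmxA mulmxBl -(Theta_comm a0 c0 Adec) -scalar_mxC -mulmxBr.
by rewrite mulKmx.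
Qed.

End moving_average_aux.

(** * Moving averages of fractional Brownian motion *)

Section moving_average.
Context d (T : measurableType d) (R : realType) (P : probability T R).
Variables (H a c : R) (B : R -> {RV P >-> R}).
Hypothesis a0 : 0 < a.
Hypothesis aE : a = 2 * H.
Hypothesis fB : fractional_brownian_motion H B.
Variables (n : nat) (A : 'M[R]_n) (D b : 'cV[R]_n).
Hypothesis c0 : 0 < c.
Hypothesis Adec : decaying c (fun x => expmx (x *: A)).
Local Notation E x := (expmx (x *: A)).
Let Au : A \in unitmx. Proof. exact: decaying_unit c0 Adec. Qed.
Let sB u : sqi P (B u). Proof. exact: fbm_sqi fB u. Qed.

Definition ma_kernel x : R := (b^T *m E x *m D) 0 0.

Let Er_der t x : mxder (fun v => E (t - v)) x (- (A *m E (t - x))).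
Proof.
apply: (@mxder_ext _ _ _ (fun v => E (-1 * v + t))) => [v|].
  by rewrite mulN1r addrC.
apply: mxder_eq; first by apply: (@mxder_aff _ _ _ (fun u => E u)); exact: expmx_derl.
by rewrite scaleN1r mulN1r (addrC _ t).
Qed.

(* [W' = A W + mu D] makes [b^T E (t - v) U v] a primitive of
   [ma_kernel (t - v) d mu v], where [mu v = ip P (B v) Z]. *)
Lemma ms_integral_mx (W : R -> 'cV[R]_n) (t : R) (J : {RV P >-> R}) (Z : T -> R) :
  let U v := A *m W v + ip P (B v) Z *: D in
  sqi P Z ->
  continuous (fun v => ip P (B v) Z) ->
  (forall v, mxder W v (U v)) ->
  mxcvg0 (fun l => E l *m U (t - l)) ->
  is_ms_integral_ninfty B (fun u => ma_kernel (t - u)) t J ->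
  sqi P J /\ ip P J Z = (b^T *m U t) 0 0.
Proof.
move=> U sZ cmu dW U0 IJ.
pose G v := (b^T *m A *m E (t - v) *m W v) 0 0.
pose dp v := - (b^T *m A *m E (t - v) *m D) 0 0.
have dP x : is_derive x (1 : R) (fun u => ma_kernel (t - u)) (dp x).
  have h := mxderMr D (mxderMl b^T (Er_der t x)).
  apply: (is_derive_eq (h 0 0)); rewrite /dp mulmxN mulNmx mxNE.
  by rewrite !mulmxA.
have key v : ma_kernel (t - v) * ip P (B v) Z + G v = (b^T *m E (t - v) *m U v) 0 0.
  rewrite /ma_kernel /G /U mulmxDr -scalemxAr [RHS]mxE [X in _ = _ + X]mxE.
  rewrite addrC mulrC; congr (_ + _); rewrite -!mulmxA; congr ((_ *m _) _ _).
  by rewrite !mulmxA expmx_comm.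
have tt : E (t - t) = 1%:M by rewrite subrr expmx0.
apply: (@ms_integral_ip _ _ _ P B sB (fun u => ma_kernel (t - u)) dp G t) => //.
- move=> x; rewrite /dp.
  have h := mxderMr D (mxderMl (b^T *m A) (Er_der t x)).
  by apply: cvgN; exact: der_cts (h 0 0).
- move=> x; rewrite /G.
  have h := mxderM (mxderMl (b^T *m A) (Er_der t x)) (dW x).
  (* Differentiating the exponential and inserting [W' = A W + mu D] produce opposite terms in [W];
     what is left is [- dp mu]. *)
  apply: (is_derive_eq (h 0 0)).
  rewrite mulmxN mulNmx /U mulmxDr addrA -scalemxAr.
  have -> : b^T *m A *m E (t - x) *m (A *m W x) =
      b^T *m A *m (A *m E (t - x)) *m W x by rewrite expmx_comm !mulmxA.
  by rewrite addNr add0r mxE /dp mulNr opprK mulrC.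
- have h : mxcvg0 (fun l => b^T *m (E l *m U (t - l))) by exact: mxcvg0_mull.
  apply: eq_cvg0 (h 0 0) => l.
  by rewrite key subKr mulmxA.
- by rewrite key tt mulmx1.
Qed.

(** With [Z = 1] the function [mu] is 0 and [W = 0] solves the equation. The square integrability
    obtained on the way is what later allows [J] to be taken as [Z]. *)
Lemma ms_integral_mean t (J : {RV P >-> R}) :
  is_ms_integral_ninfty B (fun u => ma_kernel (t - u)) t J ->
  sqi P J /\ ip P J (fun=> 1) = 0.
Proof.
move=> IJ.
have Z (v : R) : A *m (0 : 'cV[R]_n) + ip P (B v) (fun=> 1) *: D = 0.
  by rewrite mulmx0 (fbm_mean fB) scale0r addr0.
have [|||||] := @ms_integral_mx (fun=> 0) t J (fun=> 1) => //.
- exact: sqi_cst.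
- by rewrite (funext (fbm_mean fB)) => x; exact: cvg_cst.
- by move=> v; rewrite Z; exact: mxder_cst.
- move=> i j; apply: (@eq_cvg0 _ (fun=> 0)) => [l|]; last exact: cvg_cst.
  by rewrite Z mulmx0 mxE.
- by move=> sJ ->; split => //; rewrite Z mulmx0 mxE.
Qed.

Let theta_der (s v : R) : mxder (fun u => Xi a A (u - s)) v (Theta a A (v - s)).
Proof.
apply: (@mxder_ext _ _ _ (fun u => Xi a A (1 * u - s))) => [u|].
  by rewrite mul1r.
apply: mxder_eq; first by apply: mxder_aff; exact: Xi_der.
by rewrite scale1r mul1r.
Qed.

Lemma ms_integral_fbm t s (J : {RV P >-> R}) :
  is_ms_integral_ninfty B (fun u => ma_kernel (t - u)) t J ->
  ip P J (B s) = (b^T *m Theta a A t *m D) 0 0 - (b^T *m Theta a A (t - s) *m D) 0 0.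
Proof.
move=> IJ.
(* One term for each part of the covariance [psi v - psi (v - s) + psi s]: the first two complete
   [A Xi] to [Theta], the constant part is cancelled by [A^-1 D]. Writing [v - 0] lets [theta_der]
   handle both copies of [Xi]. *)
pose W v := Xi a A (v - 0) *m D - Xi a A (v - s) *m D - psi a s *: (invmx A *m D).
have UE v : A *m W v + ip P (B v) (B s) *: D =
    Theta a A (v - 0) *m D - Theta a A (v - s) *m D.
  rewrite (fbm_ip fB) -aE; apply: fbm_ode_algebra => //; last exact: ThetaE.
  by rewrite subr0; exact: ThetaE.
have [|||||_ ->] := @ms_integral_mx W t J (B s) => //.
- rewrite (funext (fun v => fbm_ip fB v s)) -aE => x.
  apply: cvgB; first by apply: cvgD; [exact: psi_cts|exact: cvg_cst].
  apply: (@continuous_comp _ _ _ (fun v => v - s) (psi a)).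
    by apply: cvgB; [exact: cvg_id|exact: cvg_cst].
  exact: psi_cts.
- move=> v; rewrite UE.
  have dW := mxderB (mxderB (mxderMr D (theta_der 0 v)) (mxderMr D (theta_der s v)))
    (mxder_cst (psi a s *: (invmx A *m D)) v).
  by apply: mxder_eq dW _; rewrite subr0.
- have h : mxcvg0 (fun l => E l *m Theta a A (t - l) *m D
      + - (E l *m Theta a A (t - s - l) *m D)).
    apply: mxcvg0D; last apply: mxcvg0N; apply: mxcvg0_mulr;
      exact: (mxcvg0_Theta_Ny a0 c0 Adec).
  apply: mxcvg0_ext h => l.
  have -> : t - s - l = t - l - s by ring.
  by rewrite UE mul_mxBl subr0.
- by rewrite UE subr0 mul_mxBr.
Qed.

Let G := gramian A (D *m D^T).

Lemma ms_integral_cov t h (Js J : {RV P >-> R}) :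
  is_ms_integral_ninfty B (fun u => ma_kernel (t - u)) t J ->
  is_ms_integral_ninfty B (fun u => ma_kernel (t + h - u)) (t + h) Js ->
  ip P Js J = (b^T *m A *m (Theta a A h + Theta a A (- h)) *m G *m b) 0 0.
Proof.
move=> IJ IJs.
have [sJ _] := ms_integral_mean IJ.
pose k := (b^T *m Theta a A t *m D) 0 0.
have muE v : ip P (B v) J = k - (b^T *m Theta a A (t - v) *m D) 0 0.
  by rewrite ipC (ms_integral_fbm v IJ).
have XiN_der v : mxder (fun u => Xi a A (t - u)) v (- Theta a A (t - v)).
  apply: (@mxder_ext _ _ _ (fun u => Xi a A (-1 * u + t))) => [u|].
    by rewrite mulN1r addrC.
  apply: mxder_eq; first by apply: mxder_aff; exact: Xi_der.
  by rewrite scaleN1r mulN1r addrC.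
(* [W] solves the required equation by the Lyapunov equation for [G]. *)
pose U v := A *m Theta a A (v - t) *m G *m b
    + G *m A^T *m (Theta a A (t - v))^T *m b.
pose W v := - (k *: (invmx A *m D)) + (A *m Xi a A (v - t) *m G *m b
    - G *m A^T *m (Xi a A (t - v))^T *m b).
have UE v : A *m W v + ip P (B v) J *: D = U v.
  (* Evenness of [psi] supplies the common scalar [p] of [cov_ode_algebra]. *)
  have psiE : psi a (v - t) = psi a (t - v) by rewrite -opprB psiN.
  rewrite muE /W /U; apply: (@cov_ode_algebra _ _ _ _ _ _ _ _ _ _ (psi a (t - v))) => //.
  - by rewrite -psiE; exact: ThetaE.
  - exact: ThetaE.
  - exact: Xi_comm a0 c0 Adec.
  - exact: lyapunov c0 Adec.
have [|||||_ ->] := @ms_integral_mx W (t + h) Js J => //.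
- rewrite (funext muE) => x.
  apply: cvgB; first exact: cvg_cst.
  apply: (@mx_form_cts _ _ _ _ _ b^T D (fun v => Theta a A (t - v))) => i j y.
  apply: (@continuous_comp _ _ _ (fun v => t - v) (fun v => Theta a A v i j)).
    by apply: cvgB; [exact: cvg_cst|exact: cvg_id].
  exact: Theta_cts.
- move=> v; rewrite UE.
  have dW := mxderD (mxderN (mxder_cst (k *: (invmx A *m D)) v))
    (mxderB (mxderMr b (mxderMr G (mxderMl A (theta_der t v))))
            (mxderMr b (mxderMl (G *m A^T) (mxder_tr (XiN_der v))))).
  apply: mxder_eq dW _.
  by rewrite oppr0 add0r linearN/= mulmxN mulNmx opprK.
(* As [l] grows, the argument of [Theta] tends to [-oo] in the first term and to [+oo] in the
   second, so each of the two limit lemmas for [Theta] is used once. *)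
- have h1 : mxcvg0 (fun l => A *m (E l *m Theta a A (h - l) *m G *m b)
      + E l *m (G *m A^T) *m (Theta a A (l - h))^T *m b).
    apply: mxcvg0D; last exact: (mxcvg0_Theta_y a0 c0 Adec).
    apply: mxcvg0_mull; do 2 apply: mxcvg0_mulr.
    exact: (mxcvg0_Theta_Ny a0 c0 Adec).
  apply: mxcvg0_ext h1 => l.
  rewrite UE /U.
  have -> : t + h - l - t = h - l by ring.
  have -> : t - (t + h - l) = l - h by ring.
  by rewrite mulmxDr !mulmxA expmx_comm.
rewrite UE /U.
have -> : t + h - t = h by ring.
have -> : t - (t + h) = - h by ring.
apply: cov_form_algebra; last exact: Theta_comm a0 c0 Adec _.
by apply: gramian_sym; rewrite trmx_mul trmxK.
Qed.

End moving_average.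

Section autocovariance.
Context d (T : measurableType d) (R : realType) (P : probability T R).

Lemma sqi_Lfun1 (X : T -> R) : sqi P X -> X \in Lfun P 1.
Proof.
move=> sX; apply/Lfun1_integrable.
have h := sqi_prod sX (sqi_cst P 1).
by apply: eq_integrable h => // w _ /=; rewrite mulr1.
Qed.

Lemma sqi_expectationE (X : T -> R) : sqi P X -> ('E_P[X] = (ip P X (fun=> 1))%:E)%E.
Proof.
move=> sX; have h := sqi_prod sX (sqi_cst P 1).
rewrite unlock /ip /Rintegral fineK; last exact: integrable_fin_num h.
by apply: eq_integral => w _; rewrite mulr1.
Qed.

Lemma covariance_affine (X Y : T -> R) (m s : R) : sqi P X -> sqi P Y ->
  ip P X (fun=> 1) = 0 -> ip P Y (fun=> 1) = 0 ->
  (covariance P (fun w => m + s * X w)%R (fun w => m + s * Y w)%R =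
    (s ^+ 2 * ip P X Y)%:E)%E.
Proof.
move=> sX sY X0 Y0.
have s1 := sqi_cst P 1.
have aff (Z : T -> R) : sqi P Z -> sqi P (fun w => m + s * Z w).
  by move=> sZ; apply: sqiD; [exact: sqi_cst|exact: sqiZ].
have m1 : ip P (fun=> m) (fun=> 1) = m.
  rewrite /ip /Rintegral.
  under eq_integral do rewrite mulr1.
  by rewrite integral_cst//= probability_setT mule1.
have mean (Z : T -> R) : sqi P Z -> ip P Z (fun=> 1) = 0 ->
    ip P (fun w => m + s * Z w) (fun=> 1) = m.
  move=> sZ Z0; rewrite ipD//; [|exact: sqi_cst|exact: sqiZ].
  by rewrite ipZ// Z0 mulr0 addr0.
have cst_ip (Z : T -> R) : sqi P Z -> ip P (fun=> m) Z = m * ip P Z (fun=> 1).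
  by move=> sZ; rewrite -ipZ//; apply: eq_Rintegral => w _; rewrite mulr1.
have sXY : ((fun w => m + s * X w) * (fun w => m + s * Y w))%R \in Lfun P 1.
  apply/Lfun1_integrable; exact: sqi_prod (aff _ sX) (aff _ sY).
rewrite (covarianceE (sqi_Lfun1 (aff _ sX)) (sqi_Lfun1 (aff _ sY)) sXY).
rewrite (sqi_expectationE (aff _ sX)) (sqi_expectationE (aff _ sY)) (mean _ sX X0) (mean _ sY Y0) -EFinM.
have -> : ('E_P[((fun w => m + s * X w) * (fun w => m + s * Y w))%R] =
   (ip P (fun w => m + s * X w)%R (fun w => m + s * Y w)%R)%:E)%E.
  rewrite unlock /ip /Rintegral fineK//.
  by apply: integrable_fin_num => //; exact: sqi_prod (aff _ sX) (aff _ sY).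
rewrite -EFinB; congr EFin.
rewrite ipD//; [|exact: sqi_cst|exact: sqiZ|exact: aff].
rewrite (cst_ip _ (aff _ sY)) (mean _ sY Y0) (ipZ _ sX (aff _ sY)) (ipC P X).
rewrite ipD//; [|exact: sqi_cst|exact: sqiZ].
by rewrite (cst_ip _ sX) X0 (ipZ _ sY sX) (ipC P Y X); ring.
Qed.

Lemma form_expand n (b : 'cV[R]_n) (A V E1 E2 I1 I2 I3 : 'M[R]_n) (h : R) :
  (b^T *m A *m (h *: (E1 *m I1) - h *: (E2 *m I2) - h *: (E1 *m I3)) *m V *m b) 0 0 =
  h * (b^T *m A *m E1 *m I1 *m V *m b) 0 0 - h * (b^T *m A *m E2 *m I2 *m V *m b) 0 0
  - h * (b^T *m A *m E1 *m I3 *m V *m b) 0 0.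
Proof.
have e M : (b^T *m A *m (h *: M) *m V *m b) 0 0 = h * (b^T *m A *m M *m V *m b) 0 0.
  by rewrite -scalemxAr -!scalemxAl [LHS]mxE.
rewrite 2!mulmxBr 2!(mulmxBl _ _ V) 2!(mulmxBl _ _ b) 2!mxBE !e.
by rewrite !mulmxA.
Qed.

Variables (H : R) (B : R -> {RV P >-> R}) (p q : nat) (alpha beta : nat -> R)
  (sigma : R) (Y : R -> {RV P >-> R}).
Hypothesis H0 : 0 < H.
Hypothesis fB : fractional_brownian_motion H B.
Hypothesis sY : stationary_carfima p q alpha beta sigma B Y.
Let A := companion p alpha.
Let b := beta_vec p q beta.
Let V := Vstar p alpha sigma.

Lemma VstarE : V = sigma ^+ 2 *: gramian A (@delta_vec R p *m (@delta_vec R p)^T).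
Proof.
rewrite /V /Vstar -/A; congr (_ *: _).
apply/matrixP => i j; rewrite [LHS]mxE [RHS]mxE; apply: eq_Rintegral => u _.
by rewrite [in RHS]mulmxA.
Qed.

Lemma carfima_decay : exists2 c, 0 < c & decaying c (fun x => expmx (x *: A)).
Proof. by apply: expmx_decay; exact: sY.1. Qed.

Lemma autocovE t h : (autocov Y t h =
  ((b^T *m A *m (Theta (2 * H) A h + Theta (2 * H) A (- h)) *m V *m b) 0 0)%:E)%E.
Proof.
have [c c0 Adec] := carfima_decay.
have [J IJ YJ] := sY.2 t.
have [Js IJs YJs] := sY.2 (t + h).
have a0 : 0 < 2 * H by rewrite mulr_gt0.
have [sJ J0] := ms_integral_mean fB IJ.
have [sJs Js0] := ms_integral_mean fB IJs.
have := ms_integral_cov a0 erefl fB c0 Adec IJ IJs.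
move=> cov; rewrite /autocov (funext YJs) (funext YJ) covariance_affine//; congr EFin.
by rewrite cov VstarE -scalemxAr -scalemxAl [RHS]mxE.
Qed.

(** The first and third integrals are the two pieces of [Theta h], on either side of the singularity
    at [w = h]; the second is [Theta (- h)]. *)
Lemma autocov_integrals t h : 0 <= h -> autocov Y t h =
        (H * (b^T *m A *m expmx (h *: A)
                *m mxRintegral `[0, h]%classic
                     (fun u => u `^ (2 * H - 1) *: expmx (- u *: A))
                *m V *m b) 0 0
         - H * (b^T *m A *m expmx (- h *: A)
                *m mxRintegral `[h, +oo[%classic
                     (fun u => u `^ (2 * H - 1) *: expmx (u *: A))
                *m V *m b) 0 0
         - H * (b^T *m A *m expmx (h *: A)
                *m mxRintegral `[0, +oo[%classic
                     (fun u => u `^ (2 * H - 1) *: expmx (u *: A))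
                *m V *m b) 0 0)%:E.
Proof.
move=> h0; have [c c0 Adec] := carfima_decay.
have a0 : 0 < 2 * H by rewrite mulr_gt0.
rewrite autocovE; congr EFin.
rewrite (Theta_ge0 _ _ h0) (Theta_le0 a0 c0 Adec h0).
have -> : 2 * H / 2 = H by field.
rewrite -/(intN (2 * H) A h) -/(tailint (2 * H) A h) -/(tailint (2 * H) A 0).
move: (intN _ _ _) (tailint _ _ h) (tailint _ _ 0) => I1 I2 I3.
by rewrite addrAC; exact: form_expand.
Qed.

End autocovariance.

(** * Asymptotics at infinity *)

Section tail_asymptotics.
Context {R : realType}.

(** The restriction to [u >= 1] permits exponents of either sign, through [u^s <= u^|s|]. *)
Lemma powR_le_expR_ge1 (s c : R) : 0 < c ->
  exists2 K : R, 0 <= K & forall u : R, 1 <= u -> u `^ s <= K * expR (c * u).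
Proof.
move=> c0; have [K HK] := powR_le_expR (normr_ge0 s) c0.
exists `|K| => // u u1.
rewrite (le_trans (ler_powR u1 (ler_norm s)))//.
rewrite (le_trans (HK u _))//; first by lra.
by rewrite ler_wpM2r ?expR_ge0// ler_norm.
Qed.

Lemma peel_algebra n (A M X I : 'M[R]_n) (p : R) :
  - (M *m A) *m X + M *m (A *m X + p *: I) = p *: (M *m I).
Proof. by rewrite mulNmx mulmxDr mulmxA addKr -scalemxAr. Qed.

Lemma peel_algebraN n (A M X I : 'M[R]_n) (p : R) :
  M *m A *m X + M *m (- (A *m X) + p *: I) = p *: (M *m I).
Proof. by rewrite mulmxDr mulmxN mulmxA addNKr -scalemxAr. Qed.

Variables (a c : R) (n : nat) (A : 'M[R]_n).
Hypothesis a0 : 0 < a.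
Hypothesis a2 : a < 2.
Hypothesis c0 : 0 < c.
Hypothesis Adec : decaying c (fun x => expmx (x *: A)).
Local Notation E x := (expmx (x *: A)).
Let Au : A \in unitmx. Proof. exact: decaying_unit c0 Adec. Qed.
Let Ai := invmx A.

Lemma mxcvg0_powR m (s : R) (M : 'M[R]_(n, m)) :
  mxcvg0 (fun u => u `^ s *: (E u *m M)).
Proof.
move=> i j; have [K K0 HK] := decaying_ge0 (decaying_mulr M Adec).
have c20 : 0 < c / 2 by rewrite divr_gt0.
have [K' K'0 HK'] := powR_le_expR_ge1 s c20.
apply: (@expR_bound_cvg0 _ _ (K' * K) (c / 2) 1) => // u u1.
rewrite mxE normrM ger0_norm ?powR_ge0//.
apply: (@le_trans _ _ ((K' * expR (c / 2 * u)) * (K * expR (- c * u)))).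
  by rewrite ler_pM ?powR_ge0 ?HK' ?HK//; lra.
rewrite mulrACA -expRD le_eqVlt; apply/orP; left; apply/eqP; congr (_ * expR _).
by field.
Qed.

Let d1 (x : R) := a / 2 * x `^ (a - 1).
Let d2 (x : R) := a / 2 * (a - 1) * x `^ (a - 2).
Let d3 (x : R) := a / 2 * (a - 1) * (a - 2) * x `^ (a - 3).

Let d1_der (x : R) : 0 < x -> is_derive x (1 : R) d1 (d2 x).
Proof.
move=> x0; apply: (is_derive_eq (derZ (a / 2) (is_derive1_powR (a - 1) x0))).
have -> : a - 1 - 1 = a - 2 by ring.
by rewrite /d2 mulrA.
Qed.

Let d2_der (x : R) : 0 < x -> is_derive x (1 : R) d2 (d3 x).
Proof.
move=> x0; apply: (is_derive_eq (derZ (a / 2 * (a - 1)) (is_derive1_powR (a - 2) x0))).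
have -> : a - 2 - 1 = a - 3 by ring.
by rewrite /d3 mulrA.
Qed.

Lemma Theta_diff_algebra (T I1 I2 : 'M[R]_n) (p1 p2 p3 : R) :
  A *m I1 = 1%:M -> A *m I2 = I1 ->
  A *m T + p1%:M + p2 *: I1 + p3 *: I2 = A *m (T + p1 *: I1 + p2 *: I2) + p3 *: I2.
Proof.
move=> e1 e2; rewrite !mulmxDr -!scalemxAr e1 e2.
by rewrite scalemx1.
Qed.

Lemma Theta_diff_algebraN (T I1 I2 : 'M[R]_n) (p1 p2 p3 : R) :
  A *m I1 = 1%:M -> A *m I2 = I1 ->
  - (A *m T + (- p1)%:M) + (- p2) *: I1 + p3 *: I2 =
  - (A *m (T + (- p1) *: I1 + p2 *: I2)) + p3 *: I2.
Proof.
move=> e1 e2; rewrite !mulmxDr -!scalemxAr e1 e2 scalemx1 !opprD.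
by rewrite [(- p2) *: _]scaleNr.
Qed.

Let Ai2 := Ai *m Ai.
Let AAi : A *m Ai = 1%:M. Proof. exact: mulmxV. Qed.
Let AAi2 : A *m Ai2 = Ai. Proof. exact: mulKVmx. Qed.

(* Removing the first two terms of its expansion at infinity from [Theta] leaves
   a solution of the same linear equation forced by [d3 = O(h^(a - 3))] only. *)
Definition Theta_rest_y h := Theta a A h + d1 h *: Ai + d2 h *: Ai2.

(** The sign of [d1] changes because [psi'] is odd, while [psi''] is even. *)
Definition Theta_rest_Ny h := Theta a A (- h) + (- d1 h) *: Ai + d2 h *: Ai2.

Lemma Theta_rest_y_der (x : R) : 0 < x ->
  mxder Theta_rest_y x (A *m Theta_rest_y x + d3 x *: Ai2).
Proof.
move=> x0; have xn0 : x != 0 by rewrite gt_eqF.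
have h := mxderD (mxderD (Theta_der a0 A xn0) (mxderZ (d1_der x0) (mxder_cst Ai x)))
  (mxderZ (d2_der x0) (mxder_cst Ai2 x)).
apply: mxder_eq h _; rewrite !scaler0 !addr0 dpsi_pos// -/(d1 x).
exact: Theta_diff_algebra.
Qed.

Lemma Theta_rest_Ny_der (x : R) : 0 < x ->
  mxder Theta_rest_Ny x (- (A *m Theta_rest_Ny x) + d3 x *: Ai2).
Proof.
move=> x0; have xn0 : -1 * x + 0 != 0 by rewrite addr0 mulN1r oppr_eq0 gt_eqF.
have h0 : mxder (fun u => Theta a A (- u)) x (- (A *m Theta a A (- x) + (- d1 x)%:M)).
  apply: (@mxder_ext _ _ _ (fun u => Theta a A (-1 * u + 0))) => [u|].
    by rewrite mulN1r addr0.
  apply: mxder_eq; first exact: (mxder_aff (Theta_der a0 A xn0)).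
  by rewrite scaleN1r addr0 mulN1r dpsiN dpsi_pos.
have h := mxderD (mxderD h0 (mxderZ (derN (d1_der x0)) (mxder_cst Ai x)))
  (mxderZ (d2_der x0) (mxder_cst Ai2 x)).
apply: mxder_eq h _; rewrite !scaler0 !addr0.
exact: Theta_diff_algebraN.
Qed.

(** Variation of constants from a fixed [u0]: the derivative of [exp((h - u) A) Theta_rest_y u] in
    [u] contains only the forcing, and is dominated by that of a multiple of
    [exp(- c (h - u)) u^(a-3)]. *)
Lemma Theta_rest_y_bound i j : exists K, exists x0 : R,
  forall h, x0 <= h -> `|Theta_rest_y h i j| <= K * h `^ (a - 3).
Proof.
have [K1 K10 HK1] := decaying_ge0 (decaying_mulr Ai2 Adec).
have [k3 k3E] : exists k3 : R, k3 = `|a / 2 * (a - 1) * (a - 2)| by eexists.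
have k30 : 0 <= k3 by rewrite k3E.
have [K KE] : exists K : R, K = 2 * K1 * k3 / c by eexists.
have a3 : (0 : R) < 3 - a by rewrite subr_gt0 (lt_trans a2)// ltr_nat.
(* Beyond [2 (3 - a) / c], differentiating [u^(a-3)] in the majorant costs at most half of the rate
   [c]; this is the factor 2 in [K]. *)
have [u0 u0E u01] : exists2 u0, u0 = 2 * (3 - a) / c + 1 & 1 < u0.
  by exists (2 * (3 - a) / c + 1) => //; rewrite ltrDr divr_gt0// mulr_gt0.
have u00 : 0 < u0 by lra.
have [K2 K20 HK2] := decaying_ge0 (decaying_mulr (Theta_rest_y u0) Adec).
have [K3 K30 HK3] := powR_le_expR_ge1 (3 - a) c0.
exists (K2 * expR (c * u0) * K3 + K), u0 => h u0h.
have h0 : 0 < h by lra.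
have K0 : 0 <= K by rewrite KE divr_ge0 ?(ltW c0)// mulr_ge0// mulr_ge0.
have b1 : `|(E (h - h) *m Theta_rest_y h) i j - (E (h - u0) *m Theta_rest_y u0) i j| <=
    K * (expR (- c * (h - h)) * h `^ (a - 3)) - K * (expR (- c * (h - u0)) * u0 `^ (a - 3)).
  apply: (@der_bound _ (fun u => (E (h - u) *m Theta_rest_y u) i j)
    (fun u => K * (expR (- c * (h - u)) * u `^ (a - 3)))
    (fun u => (d3 u *: (E (h - u) *m Ai2)) i j)
    (fun u => K * (c * expR (- c * (h - u)) * u `^ (a - 3)
       + expR (- c * (h - u)) * ((a - 3) * u `^ (a - 3 - 1)))) u0 h u0h)
      => u /andP[uu uh].
  - have up : 0 < u by lra.
    have dE : mxder (fun v => E (h - v)) u (- (E (h - u) *m A)).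
      apply: (@mxder_ext _ _ _ (fun v => E (-1 * v + h))) => [v|].
        by rewrite mulN1r addrC.
      apply: mxder_eq; first by apply: (@mxder_aff _ _ _ (fun u => E u)); exact: expmx_der.
      by rewrite scaleN1r mulN1r (addrC _ h).
    have hh := mxderM dE (Theta_rest_y_der up).
    apply: (mxder_eq hh).
    exact: peel_algebra.
  - have up : 0 < u by lra.
    apply: derZ; apply: derM; last exact: is_derive1_powR.
    have e1 : (fun v : R => expR (- c * (h - v))) =
        (fun v => expR (c * v) * expR (- c * h)).
      by apply/funext => v; rewrite -expRD; congr expR; ring.
    rewrite e1; apply: (is_derive_eq (derM (der_expR c u) (der_cst (expR (- c * h)) u))).
    rewrite mulr0 addr0 -mulrA -expRD; congr (_ * expR _); ring.
  - have up : 0 < u by lra.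
    rewrite mxE normrM.
    have hu : 0 <= h - u by lra.
    have e3 : `|d3 u| = k3 * u `^ (a - 3).
      by rewrite /d3 normrM -k3E [X in _ * X]ger0_norm ?powR_ge0.
    have e4 : (a - 3) * u `^ (a - 3 - 1) >= - (c / 2) * u `^ (a - 3).
      rewrite (@powRB _ u (a - 3) 1); last by rewrite (gt_eqF up) implybT.
      rewrite (powRr1 (ltW up)) mulrCA [leRHS]mulrC ler_wpM2r ?powR_ge0//.
      rewrite ler_pdivlMr// mulNr -lerN2 opprK opprB.
      have : 2 * (3 - a) / c <= u by rewrite u0E in uu; lra.
      by rewrite ler_pdivrMr//; lra.
    have eh : 0 <= expR (- c * (h - u)) by exact: expR_ge0.
    rewrite e3 (le_trans (ler_wpM2l _ (HK1 _ _ _ hu))) ?mulr_ge0 ?powR_ge0//.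
    have m1 : expR (- c * (h - u)) * (- (c / 2) * u `^ (a - 3)) <=
        expR (- c * (h - u)) * ((a - 3) * u `^ (a - 3 - 1)) by rewrite ler_wpM2l.
    apply: (@le_trans _ _ (K * (c * expR (- c * (h - u)) * u `^ (a - 3) +
        expR (- c * (h - u)) * (- (c / 2) * u `^ (a - 3))))); last first.
      by rewrite ler_wpM2l// lerD2l.
    rewrite le_eqVlt; apply/orP; left; apply/eqP; rewrite KE; field.
    by rewrite gt_eqF.
have hh : E (h - h) *m Theta_rest_y h = Theta_rest_y h by rewrite subrr expmx0 mul1mx.
rewrite hh in b1.
have hu0 : 0 <= h - u0 by lra.
have b2 := HK2 (h - u0) i j hu0.
(* The contribution of the initial value is exponentially small and is absorbed into [h^(a-3)]. *)
have b3 : expR (- c * (h - u0)) <= expR (c * u0) * K3 * h `^ (a - 3).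
  have -> : expR (- c * (h - u0)) = expR (c * u0) * expR (- c * h).
    by rewrite -expRD; congr expR; ring.
  rewrite -mulrA ler_wpM2l ?expR_ge0//.
  have -> : a - 3 = - (3 - a) by ring.
  rewrite powRN mulNr expRN ler_pdivlMr ?powR_gt0// mulrC ler_pdivrMr ?expR_gt0//.
  by apply: HK3; lra.
have b4 : 0 <= K * (expR (- c * (h - u0)) * u0 `^ (a - 3)).
  by rewrite !mulr_ge0 ?expR_ge0 ?powR_ge0.
have b5 : expR (- c * (h - h)) = 1 by rewrite subrr mulr0 expR0.
rewrite b5 mul1r in b1.
have b6 := ler_wpM2l K20 b3.
have b7 := ler_normD (Theta_rest_y h i j - (E (h - u0) *m Theta_rest_y u0) i j)
  ((E (h - u0) *m Theta_rest_y u0) i j).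
rewrite subrK in b7.
have -> : (K2 * expR (c * u0) * K3 + K) * h `^ (a - 3) =
   K2 * (expR (c * u0) * K3 * h `^ (a - 3)) + K * h `^ (a - 3) by ring.
lra.
Qed.

(** The equation now has matrix [- A] and is unstable forwards, so it is solved backwards from
    infinity, where [exp((u - h) A) Theta_rest_Ny u] vanishes. On [[h, +oo[] the forcing is largest
    at [h], because [a - 3 < 0]. *)
Lemma Theta_rest_Ny_bound i j : exists K,
  forall h, 1 <= h -> `|Theta_rest_Ny h i j| <= K * h `^ (a - 3).
Proof.
have [K1 K10 HK1] := decaying_ge0 (decaying_mulr Ai2 Adec).
have [k3 k3E] : exists k3 : R, k3 = `|a / 2 * (a - 1) * (a - 2)| by eexists.
have k30 : 0 <= k3 by rewrite k3E.
have [K KE] : exists K : R, K = K1 * k3 / c by eexists.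
exists K => h h1.
have h0 : 0 < h by lra.
have K0 : 0 <= K by rewrite KE divr_ge0 ?(ltW c0)// mulr_ge0.
have b1 u : h <= u ->
    `|(E (u - h) *m Theta_rest_Ny u) i j - (E (h - h) *m Theta_rest_Ny h) i j| <=
    - K * h `^ (a - 3) * expR (- c * (u - h)) - (- K * h `^ (a - 3) * expR (- c * (h - h))).
  move=> hu.
  apply: (@der_bound _ (fun u => (E (u - h) *m Theta_rest_Ny u) i j)
    (fun u => - K * h `^ (a - 3) * expR (- c * (u - h)))
    (fun u => (d3 u *: (E (u - h) *m Ai2)) i j)
    (fun u => - K * h `^ (a - 3) * (- c * expR (- c * (u - h)))) h u hu) => v /andP[hv vu].
  - have vp : 0 < v by lra.
    have dE : mxder (fun v => E (v - h)) v (E (v - h) *m A).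
      apply: (@mxder_ext _ _ _ (fun v => E (1 * v - h))) => [w|].
        by rewrite mul1r.
      apply: mxder_eq; first by apply: (@mxder_aff _ _ _ (fun u => E u)); exact: expmx_der.
      by rewrite scale1r mul1r.
    have hh := mxderM dE (Theta_rest_Ny_der vp).
    apply: (mxder_eq hh).
    exact: peel_algebraN.
  - have e1 : (fun v : R => expR (- c * (v - h))) =
        (fun v => expR (- c * v) * expR (c * h)).
      by apply/funext => w; rewrite -expRD; congr expR; ring.
    apply: derZ; rewrite e1.
    apply: (is_derive_eq (derM (der_expR (- c) v) (der_cst (expR (c * h)) v))).
    rewrite mulr0 addr0 -mulrA -expRD; congr (_ * expR _); ring.
  - have vp : 0 < v by lra.
    rewrite mxE normrM.
    have hu' : 0 <= v - h by lra.
    have e3 : `|d3 v| = k3 * v `^ (a - 3).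
      by rewrite /d3 normrM -k3E [X in _ * X]ger0_norm ?powR_ge0.
    have e5 : v `^ (a - 3) <= h `^ (a - 3).
      have -> : a - 3 = - (3 - a) by ring.
      rewrite !powRN lef_pV2 ?posrE ?powR_gt0//.
      have a3 : (0 : R) <= 3 - a by rewrite subr_ge0 ltW// (lt_trans a2)// ltr_nat.
      by apply: (ge0_ler_powR a3); rewrite ?nnegrE// ltW.
    have eh : 0 <= expR (- c * (v - h)) by exact: expR_ge0.
    rewrite e3 (le_trans (ler_wpM2l _ (HK1 _ _ _ hu'))) ?mulr_ge0 ?powR_ge0//.
    have -> : - K * h `^ (a - 3) * (- c * expR (- c * (v - h))) =
      k3 * h `^ (a - 3) * (K1 * expR (- c * (v - h))).
      by rewrite KE; field; rewrite gt_eqF.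
    by rewrite ler_wpM2r ?mulr_ge0// ler_wpM2l.
have lim0 : mxcvg0 (fun u => E (u - h) *m Theta_rest_Ny u).
  have z1 : mxcvg0 (fun u => E u *m Theta a A (- u)).
    by move=> k l; exact: (cvg_Theta_Ny a0 c0 Adec).
  have z : mxcvg0 (fun u => E (- h) *m (E u *m Theta a A (- u)
     + ((- (a / 2)) *: (u `^ (a - 1) *: (E u *m Ai))
     + (a / 2 * (a - 1)) *: (u `^ (a - 2) *: (E u *m Ai2))))).
    apply: mxcvg0_mull; apply: mxcvg0D => //.
    by apply: mxcvg0D; apply: mxcvg0Z; exact: mxcvg0_powR.
  apply: mxcvg0_ext z => u.
  rewrite (addrC u) expmxD -mulmxA; congr (_ *m _).
  by rewrite /Theta_rest_Ny !mulmxDr -!scalemxAr !scalerA addrA mulNr.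
have l0 := lim0 i j.
have lim : `|(E (u - h) *m Theta_rest_Ny u) i j - (E (h - h) *m Theta_rest_Ny h) i j|
    @[u --> +oo] --> `|0 - (E (h - h) *m Theta_rest_Ny h) i j|.
  by apply: cvg_norm; apply: cvgB => //; exact: cvg_cst.
have -> : `|Theta_rest_Ny h i j| = `|0 - (E (h - h) *m Theta_rest_Ny h) i j|.
  by rewrite subrr expmx0 mul1mx sub0r normrN.
apply: (cvgr_to_le lim); near=> u.
have hu : h <= u by near: u; apply: nbhs_pinfty_ge; exact: num_real.
rewrite (le_trans (b1 u hu))// subrr mulr0 expR0 mulr1.
have : 0 <= K * h `^ (a - 3) * expR (- c * (u - h)).
  by rewrite !mulr_ge0 ?powR_ge0 ?expR_ge0.
by rewrite !mulNr; lra.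
Unshelve. all: by end_near. Qed.

End tail_asymptotics.

(** * The power law of the autocovariance *)

Section carfima_asymptotics.
Context {R : realType}.

Lemma mxcvg0_powR_bound n (F : R -> 'M[R]_n) (s : R) :
  (forall i j, exists K, exists x0 : R, forall h, x0 <= h -> `|F h i j| <= K * h `^ (s - 1)) ->
  mxcvg0 (fun h => h `^ (- s) *: F h).
Proof.
move=> HF i j; have [K [x0 HK]] := HF i j.
have lim : K * h^-1 @[h --> +oo] --> (0 : R).
  suff : K * (id h)^-1 @[h --> +oo] --> K * (0 : R) by rewrite mulr0.
  apply: cvgMl_tmp; apply/(gtr0_cvgV0 (f := id)) => //.
  by near=> h; near: h; apply: nbhs_pinfty_gt; exact: num_real.
apply/norm_cvg0P; apply: (@squeeze_cvgr _ _ _ _ (fun=> 0) _ _ _ _ _ lim); last exact: cvg_cst.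
near=> h; rewrite normr_ge0 /= mxE normrM ger0_norm ?powR_ge0//.
have h0 : 0 < h by near: h; apply: nbhs_pinfty_gt; exact: num_real.
apply: (@le_trans _ _ (h `^ (- s) * (K * h `^ (s - 1)))).
  by rewrite ler_wpM2l ?powR_ge0// HK.
rewrite mulrCA -powRD; last by rewrite (lt0r_neq0 h0) implybT.
by rewrite addrA addNr sub0r powR_inv1// ltW.
Unshelve. all: by end_near. Qed.

Lemma Theta_rest_sum a n (A : 'M[R]_n) h :
  Theta_rest_y a A h + Theta_rest_Ny a A h =
  Theta a A h + Theta a A (- h) +
    (2 * (a / 2 * (a - 1) * h `^ (a - 2))) *: (invmx A *m invmx A).
Proof.
rewrite /Theta_rest_y /Theta_rest_Ny; cbv zeta.
move: (Theta _ _ h) (Theta _ _ (- h)) (invmx A) (invmx A *m invmx A) (_ * h `^ (a - 1)) (_ * h `^ (a - 2)).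
move=> T1 T2 I1 I2 p1 p2.
rewrite addrACA -scalerDl; congr (_ + _ *: _); last by ring.
by rewrite addrACA -scalerDl subrr scale0r addr0.
Qed.

Lemma form_sum_algebra n (A V I2 S : 'M[R]_n) (b : 'cV[R]_n) (w : R) :
  (b^T *m A *m (S + w *: I2) *m V *m b) 0 0 =
  (b^T *m A *m S *m V *m b) 0 0 + w * (b^T *m (A *m I2) *m V *m b) 0 0.
Proof.
rewrite mulmxDr 2!mulmxDl mxDE -scalemxAr -!scalemxAl [X in _ + X]mxE.
by rewrite !mulmxA.
Qed.

Lemma form_scale_algebra n (A V S : 'M[R]_n) (b : 'cV[R]_n) (k w : R) :
  (k *: (b^T *m A *m (w *: S) *m V *m b)) 0 0 =
  k * (w * (b^T *m A *m S *m V *m b) 0 0).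
Proof. by rewrite -scalemxAr -!scalemxAl 2!mxE. Qed.

(** Multiplying the Lyapunov equation by [A^-1] on the left and its transpose on the right makes the
    right side a rank-one square and the left side twice a symmetrized [A^-1 V]. *)
Lemma lyapunov_form n (A V : 'M[R]_n) (b dl : 'cV[R]_n) (s : R) : A \in unitmx ->
  V^T = V -> A *m V + V *m A^T = - (s *: (dl *m dl^T)) ->
  2 * (b^T *m invmx A *m V *m b) 0 0 = - s * ((b^T *m invmx A *m dl) 0 0) ^+ 2.
Proof.
move=> Au VT lyap.
have e : invmx A *m (A *m V + V *m A^T) *m (invmx A)^T = V *m (invmx A)^T + invmx A *m V.
  rewrite mulmxDr mulKmx// mulmxDl -!mulmxA -trmx_mul.
  by rewrite (mulVmx Au) trmx1 mulmx1.
have e1 : b^T *m (V *m (invmx A)^T + invmx A *m V) *m b =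
    - (s *: ((b^T *m invmx A *m dl) *m (b^T *m invmx A *m dl)^T)).
  rewrite -e lyap !trmx_mul trmxK mulmxN mulNmx mulmxN mulNmx.
  by rewrite -scalemxAr -scalemxAl -scalemxAr -scalemxAl !mulmxA.
have e2 : (b^T *m V *m (invmx A)^T *m b) 0 0 = (b^T *m invmx A *m V *m b) 0 0.
  have <- : (b^T *m V *m (invmx A)^T *m b)^T 0 0 = (b^T *m V *m (invmx A)^T *m b) 0 0.
    by rewrite mxE.
  by rewrite !trmx_mul !trmxK VT !mulmxA.
have := congr1 (fun M : 'M[R]_1 => M 0 0) e1.
rewrite /= mulmxDr mulmxDl mxDE !mulmxA e2 -mulr2n mulr_natl => ->.
rewrite mxNE mulNr; congr (- _); rewrite [LHS]mxE; congr (_ * _).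
by rewrite [LHS]mxE big_ord1 [X in _ * X]mxE expr2.
Qed.

Lemma companion_e0 p (alpha : nat -> R) :
  companion p.+1 alpha *m delta_mx 0 (0 : 'I_1) = alpha 1%N *: delta_vec p.+1.
Proof.
apply/matrixP => i j; rewrite -colE !mxE /=.
by case: ifP => // _; rewrite ?mulr1 ?mulr0.
Qed.

Lemma beta_vec_e0 p q (beta : nat -> R) :
  ((beta_vec p.+1 q beta)^T *m delta_mx 0 (0 : 'I_1)) 0 0 = 1.
Proof. by rewrite -colE !mxE. Qed.

Lemma alpha_poly_at0 p (alpha : nat -> R) :
  (alpha_poly p.+1 alpha).[0] = - alpha 1%N.
Proof.
rewrite /alpha_poly hornerD hornerN hornerXn expr0n sub0r horner_sum big_ord_recl.
rewrite big1 => [|i _]; first by rewrite hornerZ hornerXn expr0 mulr1 addr0.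
by rewrite hornerZ hornerXn expr0n mulr0.
Qed.

Lemma beta_poly_at0 q (beta : nat -> R) : (beta_poly q beta).[0] = 1.
Proof.
rewrite /beta_poly hornerD hornerC horner_sum big_nat big1 ?addr0// => i /andP[i0 _].
by rewrite hornerZ hornerXn expr0n (gtn_eqF i0) mulr0.
Qed.

Context d (T : measurableType d) (P : probability T R).
Variables (H : R) (B : R -> {RV P >-> R}) (p' q : nat) (alpha beta : nat -> R)
  (sigma : R) (Y : R -> {RV P >-> R}).
Let p := p'.+1.
Hypothesis H0 : 0 < H.
Hypothesis H1 : H < 1.
Hypothesis sigma0 : 0 < sigma.
Hypothesis fB : fractional_brownian_motion H B.
Hypothesis sY : stationary_carfima p q alpha beta sigma B Y.
Hypothesis alpha10 : alpha 1%N != 0.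
Let A := companion p alpha.
Let b := beta_vec p q beta.
Let V := Vstar p alpha sigma.

Lemma Vstar_lyapunov :
  A *m V + V *m A^T = - (sigma ^+ 2 *: (delta_vec p *m (delta_vec p)^T)).
Proof.
have [c c0 Adec] := carfima_decay sY.
rewrite /V VstarE -scalemxAr -scalemxAl -scalerDr.
by rewrite (lyapunov (delta_vec p *m (delta_vec p)^T) c0 Adec) scalerN.
Qed.

Lemma Vstar_sym : V^T = V.
Proof.
have [c c0 Adec] := carfima_decay sY.
rewrite /V VstarE linearZ /= gramian_sym//.
by rewrite trmx_mul trmxK.
Qed.

(** The first column of the companion matrix is [alpha 1] times [delta_vec], so [A^-1] sends
    [delta_vec] to a multiple of the first basis vector, on which [b] is 1. *)
Lemma b_invA_delta : (b^T *m invmx A *m delta_vec p) 0 0 = (alpha 1%N)^-1.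
Proof.
have [c c0 Adec] := carfima_decay sY.
have Au := decaying_unit c0 Adec.
have -> : delta_vec p = (alpha 1%N)^-1 *: (A *m delta_mx 0 (0 : 'I_1)).
  by rewrite companion_e0 scalerA mulVf// scale1r.
by rewrite -scalemxAr [LHS]mxE -mulmxA mulKmx// beta_vec_e0 mulr1.
Qed.

Lemma autocov_asymptotic t : H != 2^-1 ->
  fine (autocov Y t h) /
    (sigma ^+ 2 * H * (2 * H - 1)
     * ((beta_poly q beta).[0] ^+ 2 / (alpha_poly p alpha).[0] ^+ 2)
     * h `^ (2 * H - 2)) @[h --> +oo] --> (1 : R).
Proof.
move=> H2; have [c c0 Adec] := carfima_decay sY.
have Au := decaying_unit c0 Adec.
rewrite alpha_poly_at0 beta_poly_at0 sqrrN expr1n mul1r.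
have [k kE] : exists k : R, k = sigma ^+ 2 * H * (2 * H - 1) * (alpha 1%N ^+ 2)^-1 by eexists.
rewrite -kE.
have k0 : k != 0.
  rewrite kE !mulf_neq0 ?invr_eq0 ?expf_neq0 ?(lt0r_neq0 sigma0) ?(lt0r_neq0 H0)//.
  apply: contra H2 => /eqP e; apply/eqP.
  have : H = 1 / 2 by lra.
  by rewrite mul1r.
have a0 : 0 < 2 * H by rewrite mulr_gt0.
have a2 : 2 * H < 2 by rewrite gtr_pMr.
have s3 : 2 * H - 3 = (2 * H - 2) - 1 by ring.
have r1 : mxcvg0 (fun h => h `^ (- (2 * H - 2)) *: Theta_rest_y (2 * H) A h).
  apply: mxcvg0_powR_bound => i j; rewrite -s3.
  exact: (Theta_rest_y_bound a0 a2 c0 Adec).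
have r2 : mxcvg0 (fun h => h `^ (- (2 * H - 2)) *: Theta_rest_Ny (2 * H) A h).
  apply: mxcvg0_powR_bound => i j; rewrite -s3.
  have [K HK] := Theta_rest_Ny_bound a0 a2 c0 Adec i j.
  by exists K, 1.
(* This form is the ratio of the goal minus 1: by [lyapunov_form] the terms in [psi''] contribute
   exactly [- k h^(2H-2)]. *)
have lim := mxcvg0Z (k^-1) (mxcvg0_mulr b (mxcvg0_mulr V (mxcvg0_mull (b^T *m A) (mxcvg0D r1 r2)))).
have lim1 : (k^-1 *: (b^T *m A *m (h `^ (- (2 * H - 2)) *: Theta_rest_y (2 * H) A h
    + h `^ (- (2 * H - 2)) *: Theta_rest_Ny (2 * H) A h) *m V *m b)) 0 0 + 1
    @[h --> +oo] --> (0 + 1 : R).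
  by apply: cvgD; [exact: lim|exact: cvg_cst].
rewrite add0r in lim1.
apply: cvg_trans lim1; apply: near_eq_cvg; near=> h.
have h0 : 0 < h by near: h; apply: nbhs_pinfty_gt; exact: num_real.
have hp0 : h `^ (2 * H - 2) != 0 by rewrite lt0r_neq0// powR_gt0.
rewrite (autocovE H0 fB sY) -/A -/b -/V [fine _]/=.
have W := lyapunov_form b Au Vstar_sym Vstar_lyapunov.
rewrite b_invA_delta exprVn in W.
rewrite -scalerDr Theta_rest_sum form_scale_algebra form_sum_algebra (mulKVmx Au).
move: W; move: (b^T *m invmx A *m V *m b) => W0 W.
rewrite powRN; move: hp0; move: (h `^ _) => y y0.
move: ((b^T *m A *m _ *m V *m b) 0 0) => F.
have -> : 2 * (2 * H / 2 * (2 * H - 1) * y) * W0 0 0 = - (k * y).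
  have -> : 2 * (2 * H / 2 * (2 * H - 1) * y) * W0 0 0 = H * (2 * H - 1) * y * (2 * W0 0 0).
    by field.
  by rewrite W kE; ring.
by field; rewrite k0 y0.
Unshelve. all: by end_near. Qed.

End carfima_asymptotics.

(** * Complex gamma integrals *)

Section oscillating_gamma.
Context {R : realType}.
Notation mu := (@lebesgue_measure R).

(* The phase [f = - pi / 2] turns the cosine into a sine. *)
Definition osc (x y f u : R) : R := expR (- x * u) * cos (y * u + f).

(** The real part of [exp(i f)] times the integral of [u^(a-1) exp(- (x - i y) u)]. *)
Definition oscI (a x y f : R) : R := \int[mu]_(u in `[0, +oo[) wfun a (osc x y f) u.

Lemma osc_der x y f (u : R) :
  is_derive u (1 : R) (osc x y f) (- x * osc x y f u + y * osc x y (f + pi / 2) u).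
Proof.
have d1 : is_derive u (1 : R) (fun u => cos (y * u + f)) (y * - sin (y * u + f)).
  exact: der_comp_aff (is_derive_cos (y * u + f)).
apply: (is_derive_eq (derM (der_expR (- x) u) d1)).
by rewrite /osc addrA cosDpihalf; ring.
Qed.

Lemma osc_cts x y f : continuous (osc x y f).
Proof. by move=> u; exact: der_cts (osc_der x y f u). Qed.

Lemma osc_bound c x y f (u : R) : c <= x -> 0 <= u -> `|osc x y f u| <= expR (- c * u).
Proof.
move=> cx u0; rewrite /osc normrM ger0_norm ?expR_ge0//.
rewrite -[leRHS]mulr1 ler_pM ?expR_ge0// ?cos_max// ler_expR !mulNr lerN2.
exact: ler_wpM2r.
Qed.

Lemma osc_integrable a x y f : 0 < a -> 0 < x ->
  mu.-integrable `[0, +oo[ (EFin \o wfun a (osc x y f)).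
Proof.
move=> a0 x0; apply: (@wfun_integrable _ a x 1) => //; first exact: osc_cts.
by move=> u u0; rewrite mul1r; exact: osc_bound.
Qed.

Lemma wfunS a f (u : R) : 0 < a -> 0 <= u -> wfun (a + 1) f u = u * wfun a f u.
Proof.
move=> a0; rewrite le_eqVlt => /predU1P[<-|u0].
  by rewrite mul0r /wfun addrK powR0 ?mul0r// gt_eqF.
rewrite /wfun addrK mulrA; congr (_ * _).
rewrite -[X in X * _](powRr1 (ltW u0)) -powRD; last by rewrite (gt_eqF u0) implybT.
by congr powR; ring.
Qed.

Lemma oscI_parts a x y f : 0 < a -> 0 < x ->
  a * oscI a x y f = x * oscI (a + 1) x y f - y * oscI (a + 1) x y (f + pi / 2).
Proof.
move=> a0 x0; have a10 : 0 < a + 1 by rewrite addr_gt0.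
pose g u := a * wfun a (osc x y f) u +
  ((- x) * wfun (a + 1) (osc x y f) u + y * wfun (a + 1) (osc x y (f + pi / 2)) u).
have i1 := integrable_itvZ a (osc_integrable y f a0 x0).
have i2 := integrable_itvZ (- x) (osc_integrable y f a10 x0).
have i3 := integrable_itvZ y (osc_integrable y (f + pi / 2) a10 x0).
have i23 := integrable_itvD i2 i3.
have ig : mu.-integrable `[0, +oo[ (EFin \o g) by exact: integrable_itvD i1 i23.
have : \int[mu]_(u in `[0, +oo[) g u = 0 - 2 * psi a 0 * osc x y f 0.
  (* [2 * psi a u] is [|u|^a], a continuous extension of [u^a] to the whole line, as the lemma
     requires. *)
  apply: (@FTC_singular_y _ g (fun u => 2 * psi a u * osc x y f u)) => //.
  - move=> u u0; apply: cvgD; first by apply: cvgMl_tmp; exact: (wfun_continuous u0 (@osc_cts _ _ _)).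
    by apply: cvgD; apply: cvgMl_tmp; exact: (wfun_continuous u0 (@osc_cts _ _ _)).
  - move=> u; apply: cvgM; last exact: osc_cts.
    by apply: cvgMl_tmp; exact: psi_cts.
  - move=> u u0; have un0 : u != 0 by rewrite lt0r_neq0.
    apply: (is_derive_eq (derM (derZ 2 (psi_der a un0)) (osc_der x y f u))).
    by rewrite /g /wfun addrK dpsi_pos// /psi gtr0_norm//; field.
  - have [K HK] := powR_le_expR (ltW a0) (divr_gt0 x0 (ltr0Sn R 1)).
    apply: (@expR_bound_cvg0 _ _ K (x / 2) 0) => [|u u0]; first exact: divr_gt0.
    have -> : 2 * psi a u = u `^ a by rewrite /psi ger0_norm//; field.
    rewrite normrM ger0_norm ?powR_ge0//.
    rewrite (le_trans (ler_pM _ _ (HK u u0) (osc_bound y f (lexx x) u0))) ?powR_ge0//.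
    rewrite -mulrA -expRD le_eqVlt; apply/orP; left; apply/eqP.
    by congr (_ * expR _); field.
rewrite /psi normr0 powR0 ?lt0r_neq0// mul0r mulr0 mul0r subr0.
rewrite /g RintegralD//= RintegralD//= !RintegralZl//.
- by rewrite -!/(oscI _ _ _ _) => h; lra.
- exact: osc_integrable.
- exact: osc_integrable.
- exact: osc_integrable.
Qed.

(** Differentiation under the integral sign. Continuity of [dx] and [dy] at [t0] provides the bound
    [M], and [x > c > 0] nearby provides the exponential in the dominating function. *)
Lemma oscI_der a (x y dx dy : R -> R) f (t0 : R) : 0 < a -> 0 < x t0 ->
  (forall t, is_derive t (1 : R) x (dx t)) -> (forall t, is_derive t (1 : R) y (dy t)) ->
  {for t0, continuous dx} -> {for t0, continuous dy} ->
  is_derive t0 (1 : R) (fun t => oscI a (x t) (y t) f)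
    (- dx t0 * oscI (a + 1) (x t0) (y t0) f +
     dy t0 * oscI (a + 1) (x t0) (y t0) (f + pi / 2)).
Proof.
move=> a0 x0 dX dY cdx cdy.
have a10 : 0 < a + 1 by rewrite addr_gt0.
have [c cx c0] : exists2 c, c < x t0 & 0 < c by exists (x t0 / 2); lra.
have [M [Mx My]] : exists M, `|dx t0| < M /\ `|dy t0| < M.
  exists (`|dx t0| + `|dy t0| + 1).
  have := normr_ge0 (dx t0); have := normr_ge0 (dy t0).
  by split; lra.
have M0 : 0 < M by apply: le_lt_trans Mx.
have : \forall t \near t0, [/\ c < x t, `|dx t| < M & `|dy t| < M].
  have n1 : \forall t \near t0, c < x t.
    by have /cvgr_gt := der_cts (dX t0); apply.
  have n2 : \forall t \near t0, `|dx t| < M.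
    by have /cvgr_norm_lt := cdx; apply.
  have n3 : \forall t \near t0, `|dy t| < M.
    by have /cvgr_norm_lt := cdy; apply.
  by near=> t; split; near: t.
move=> [e /= e0 He].
have HI t : t \in `]t0 - e, t0 + e[ -> [/\ c < x t, `|dx t| < M & `|dy t| < M].
  rewrite in_itv/= => tI; apply: He => /=.
  by rewrite ltr_distlC; lra.
pose F t u := wfun a (osc (x t) (y t) f) u.
pose dF t u := wfun a (fun u => (- dx t * u) * osc (x t) (y t) f u
    + (dy t * u) * osc (x t) (y t) (f + pi / 2) u) u.
have FD t u : is_derive t (1 : R) (F^~ u) (dF t u).
  apply: derZ; rewrite /osc.
  have d1 : is_derive t (1 : R) (fun t => expR (- x t * u)) (- dx t * u * expR (- x t * u)).
    apply: (is_derive_eq (der_comp (derM (derN (dX t)) (der_cst u t)) (is_derive_expR _))).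
    by rewrite mulr0 addr0.
  have d2 : is_derive t (1 : R) (fun t => cos (y t * u + f)) (dy t * u * - sin (y t * u + f)).
    apply: (is_derive_eq (der_comp (derD (derM (dY t) (der_cst u t)) (der_cst f t))
      (is_derive_cos _))).
    by rewrite mulr0 !addr0.
  apply: (is_derive_eq (derM d1 d2)).
  by rewrite addrA cosDpihalf; ring.
have t0I : (`]t0 - e, t0 + e[%classic : set R) t0.
  by rewrite /= in_itv/=; lra.
have intF t : (`]t0 - e, t0 + e[%classic : set R) t ->
    mu.-integrable `[0, +oo[ (EFin \o F t).
  by move=> /HI[cxt _ _]; apply: osc_integrable => //; exact: lt_trans cxt.
(* Differentiation brings down a factor [u], hence the exponent [a + 1 - 1]; the 2 counts the terms
   in [dx] and [dy]. *)
pose G u := 2 * M * `|u `^ (a + 1 - 1) * expR (- c * u)|.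
have intG : mu.-integrable `[0, +oo[ (EFin \o G).
  apply: integrable_itvZ; apply: integrable_norm.
  exact: powR_exp_integrable.
have dFE t u : partial1of2 F t u = dF t u.
  by rewrite partial1of2E; exact: derive_val.
have GB t u : (`]t0 - e, t0 + e[%classic : set R) t -> (`[0, +oo[%classic : set R) u ->
    `|partial1of2 F t u| <= G u.
  move=> /HI[cxt dxM dyM]; rewrite /= in_itv/= andbT => u0.
  rewrite dFE /dF.
  have -> : wfun a (fun u => (- dx t * u) * osc (x t) (y t) f u
      + (dy t * u) * osc (x t) (y t) (f + pi / 2) u) u =
    (u `^ (a + 1 - 1)) * (- dx t * osc (x t) (y t) f u
      + dy t * osc (x t) (y t) (f + pi / 2) u).
    have := wfunS (fun=> 1) a0 u0; rewrite /wfun !mulr1 => ->; ring.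
  have -> : G u = u `^ (a + 1 - 1) * (2 * M * expR (- c * u)).
    by rewrite /G ger0_norm ?mulr_ge0 ?powR_ge0 ?expR_ge0//; ring.
  rewrite normrM ger0_norm ?powR_ge0// ler_wpM2l ?powR_ge0//.
  rewrite (le_trans (ler_normD _ _))// !(normrM _ (osc _ _ _ _)) normrN.
  have -> : 2 * M * expR (- c * u) = M * expR (- c * u) + M * expR (- c * u) by ring.
  by apply: lerD; apply: ler_pM => //; rewrite ?(ltW dxM) ?(ltW dyM)// osc_bound// ltW.
have mB : measurable (`[0, +oo[%classic : set R) by [].
have G0 u : 0 <= G u by rewrite mulr_ge0// mulr_ge0// ltW.
have dbl t u : (`]t0 - e, t0 + e[%classic : set R) t -> (`[0, +oo[%classic : set R) u ->
    derivable (F^~ u) t 1 by move=> _ _; exact: ex_derive.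
have h1 := @derivable_under_integral _ _ _ mu F _ mB t0 _ _ t0I intF dbl G G0 intG GB.
have h2 := @differentiation_under_integral _ _ _ mu F _ mB t0 _ _ t0I intF dbl G G0 intG GB.
apply: DeriveDef; first exact: h1.
rewrite -derive1E [LHS]h2.
have i2 := integrable_itvZ (- dx t0) (osc_integrable (y t0) f a10 x0).
have i3 := integrable_itvZ (dy t0) (osc_integrable (y t0) (f + pi / 2) a10 x0).
transitivity (\int[mu]_(u in `[0, +oo[) (- dx t0 * wfun (a + 1) (osc (x t0) (y t0) f) u +
   dy t0 * wfun (a + 1) (osc (x t0) (y t0) (f + pi / 2)) u)).
  apply: eq_Rintegral => u; rewrite inE/= in_itv/= andbT => u0.
  by rewrite dFE !(wfunS _ a0 u0) /dF /wfun; ring.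
rewrite RintegralD//= !RintegralZl//; exact: osc_integrable.
Unshelve. all: by end_near. Qed.

End oscillating_gamma.

(** * The gamma integral along a path to a complex argument *)

Section polar_gamma.
Context {R : realType}.
Notation mu := (@lebesgue_measure R).

Lemma oscI_antiphase (a x y : R) : 0 < a -> 0 < x ->
  oscI a x y (pi / 2) = - oscI a x y (- (pi / 2)).
Proof.
move=> a0 x0; rewrite -mulN1r /oscI -RintegralZl//; last exact: osc_integrable.
apply: eq_Rintegral => u _; rewrite /wfun /osc cosDpihalf cosBpihalf; ring.
Qed.

Lemma der0_cst (f : R -> R) (s t : R) : s <= t ->
  (forall u, s <= u <= t -> is_derive u (1 : R) f 0) -> f t = f s.
Proof.
move=> st df; apply/eqP; rewrite -subr_eq0 -normr_le0.
have b := der_bound st df (fun x _ => der_cst 0 x).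
by rewrite subrr in b; apply: b => x _; rewrite normr0.
Qed.

Lemma GammaE (a : R) : 0 < a -> Gamma a = oscI a 1 0 0.
Proof.
move=> a0; rewrite /oscI /Gamma.
have e : \int[mu]_(u in `[0, +oo[) wfun a (osc 1 0 0) u =
  \int[mu]_(u in `[0, +oo[) (u `^ (a - 1) * expR (- u)).
  by apply: eq_Rintegral => u _; rewrite /wfun /osc mulN1r mul0r addr0 cos0 mulr1.
rewrite e Rintegral_itv_obnd_cbnd//.
have := powR_exp_integrable a0 (@ltr01 R).
rewrite (_ : (fun u => _) = (fun u => u `^ (a - 1) * expR (- u))); last first.
  by apply/funext => u; rewrite mulN1r.
by apply: integrableS => //; apply: subset_itvr; rewrite bnd_simp.
Qed.

Variables (a L th : R).
Hypothesis a0 : 0 < a.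
Hypothesis th2 : - (pi / 2) < th < pi / 2.

Let x (t : R) := expR (L * t) * cos (th * t).
Let y (t : R) := expR (L * t) * sin (th * t).

Let cos_der (t : R) : is_derive t (1 : R) (fun t => cos (th * t)) (- th * sin (th * t)).
Proof.
apply: (is_derive_eq (der_comp (derZ th (is_derive_id t (1 : R))) (is_derive_cos _))).
by rewrite mulr1 mulrN mulNr.
Qed.

Let sin_der (t : R) : is_derive t (1 : R) (fun t => sin (th * t)) (th * cos (th * t)).
Proof.
apply: (is_derive_eq (der_comp (derZ th (is_derive_id t (1 : R))) (is_derive_sin _))).
by rewrite mulr1.
Qed.

Let x_der (t : R) : is_derive t (1 : R) x (L * x t - th * y t).
Proof. by apply: (is_derive_eq (derM (der_expR L t) (cos_der t))); rewrite /x /y; ring. Qed.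

Let y_der (t : R) : is_derive t (1 : R) y (L * y t + th * x t).
Proof. by apply: (is_derive_eq (derM (der_expR L t) (sin_der t))); rewrite /x /y; ring. Qed.

(** The path stays in the open right half-plane, where the integrals converge. *)
Let x_gt0 (t : R) : 0 <= t <= 1 -> 0 < x t.
Proof.
move=> /andP[t0 t1]; rewrite /x mulr_gt0 ?expR_gt0// cos_gt0_pihalf//.
have /andP[h1 h2] := th2; apply/andP; split.
  have [th0|th0] := leP 0 th.
    by rewrite (lt_le_trans _ (mulr_ge0 th0 t0))// oppr_lt0 divr_gt0// pi_gt0.
  by rewrite (lt_le_trans h1)// ler_nMr.
have [th0|th0] := leP th 0.
  by rewrite (le_lt_trans (mulr_le0_ge0 th0 t0))// divr_gt0// pi_gt0.
by rewrite (le_lt_trans _ h2)// ler_piMr// ltW.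
Qed.

(* Along the path [t |-> exp (t (L + i th))] the real and imaginary parts [C], [S]
   of the integral solve a linear system with constant coefficients. *)
Let C (t : R) := oscI a (x t) (y t) 0.
Let S (t : R) := oscI a (x t) (y t) (- (pi / 2)).

Let dx_cts (t : R) : {for t, continuous (fun t => L * x t - th * y t)}.
Proof. exact: der_cts (derB (derZ L (x_der t)) (derZ th (y_der t))). Qed.

Let dy_cts (t : R) : {for t, continuous (fun t => L * y t + th * x t)}.
Proof. exact: der_cts (derD (derZ L (y_der t)) (derZ th (x_der t))). Qed.

(** Differentiation raises the exponent to [a + 1] and [oscI_parts] brings it back to [a]. In
    complex form, [(C + i S)' = - a (L - i th) (C + i S)]. *)
Let CS_der (t : R) : 0 <= t <= 1 ->
  is_derive t (1 : R) C (- a * (L * C t + th * S t)) /\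
  is_derive t (1 : R) S (- a * (L * S t - th * C t)).
Proof.
move=> t01; have x0 := x_gt0 t01; have a10 : 0 < a + 1 by rewrite addr_gt0.
have dC := @oscI_der _ a x y _ _ 0 t a0 x0 x_der y_der (dx_cts (t := t)) (dy_cts (t := t)).
have dS := @oscI_der _ a x y _ _ (- (pi / 2)) t a0 x0 x_der y_der
  (dx_cts (t := t)) (dy_cts (t := t)).
have eC := oscI_parts (y t) 0 a0 x0.
have eS := oscI_parts (y t) (- (pi / 2)) a0 x0.
rewrite add0r (oscI_antiphase _ a10 x0) in dC eC.
rewrite addNr in dS eS.
have -> : - a * (L * C t + th * S t) = - (L * (a * C t) + th * (a * S t)) by ring.
have -> : - a * (L * S t - th * C t) = - (L * (a * S t) - th * (a * C t)) by ring.
rewrite /C /S eC eS; split; [apply: (is_derive_eq dC)|apply: (is_derive_eq dS)]; ring.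
Qed.

Let ex_der (t : R) : is_derive t (1 : R) (fun t => expR (a * L * t)) (a * L * expR (a * L * t)).
Proof. exact: der_expR. Qed.

Let acos_der (t : R) : is_derive t (1 : R) (fun t => cos (a * th * t)) (- (a * th) * sin (a * th * t)).
Proof.
apply: (is_derive_eq (der_comp (derZ (a * th) (is_derive_id t (1 : R))) (is_derive_cos _))).
by rewrite mulr1 mulrN mulNr.
Qed.

Let asin_der (t : R) : is_derive t (1 : R) (fun t => sin (a * th * t)) (a * th * cos (a * th * t)).
Proof.
apply: (is_derive_eq (der_comp (derZ (a * th) (is_derive_id t (1 : R))) (is_derive_sin _))).
by rewrite mulr1.
Qed.

(** [P + i Q] is [C + i S] times the integrating factor [exp(a t (L - i th))], hence constant along
    the path. *)
Let P (t : R) := expR (a * L * t) * (C t * cos (a * th * t) + S t * sin (a * th * t)).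
Let Q (t : R) := expR (a * L * t) * (S t * cos (a * th * t) - C t * sin (a * th * t)).

Let PE : P 1 = P 0.
Proof.
apply: der0_cst => // t t01; have [dC dS] := CS_der t01.
apply: (is_derive_eq (derM (ex_der t) (derD (derM dC (acos_der t)) (derM dS (asin_der t))))).
by ring.
Qed.

Let QE : Q 1 = Q 0.
Proof.
apply: der0_cst => // t t01; have [dC dS] := CS_der t01.
apply: (is_derive_eq (derM (ex_der t) (derB (derM dS (acos_der t)) (derM dC (asin_der t))))).
by ring.
Qed.

Let C0 : C 0 = Gamma a.
Proof. by rewrite /C /x /y !mulr0 expR0 cos0 sin0 mulr0 mulr1 GammaE. Qed.

Let S0 : S 0 = 0.
Proof.
rewrite /S /x /y !mulr0 expR0 cos0 sin0 mulr0 mulr1 /oscI.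
rewrite [LHS](_ : _ = \int[mu]_(u in `[0, +oo[) (0 : R)).
  by rewrite Rintegral_cst// mul0r.
apply: eq_Rintegral => u _.
by rewrite /wfun /osc mul0r cosBpihalf sin0 !mulr0.
Qed.

Let E1 : expR (- a * L) * expR (a * L) = 1.
Proof. by rewrite -expRD -[RHS]expR0; congr expR; ring. Qed.

Lemma oscI_polar_cos : oscI a (expR L * cos th) (expR L * sin th) 0 =
  Gamma a * (expR (- a * L) * cos (a * th)).
Proof.
have := PE; have := QE; rewrite /P /Q S0 C0 !mulr0 !mulr1 expR0 cos0 sin0.
rewrite !mulr0 !mulr1 !mul1r subr0 addr0 => q1 p1.
have -> : oscI a (expR L * cos th) (expR L * sin th) 0 = C 1 by rewrite /C /x /y !mulr1.
have e := cos2Dsin2 (a * th).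
(* Rotating [(P 1, Q 1)] back by the angle [a th] recovers [C 1]. *)
transitivity (expR (- a * L) * (cos (a * th) *
  (expR (a * L) * (C 1 * cos (a * th) + S 1 * sin (a * th)))
  - sin (a * th) * (expR (a * L) * (S 1 * cos (a * th) - C 1 * sin (a * th))))).
  transitivity ((expR (- a * L) * expR (a * L)) * C 1 * (cos (a * th) ^+ 2 + sin (a * th) ^+ 2)).
    by rewrite E1 e mul1r mulr1.
  by ring.
by rewrite q1 p1; ring.
Qed.

Lemma oscI_polar_sin : oscI a (expR L * cos th) (expR L * sin th) (- (pi / 2)) =
  Gamma a * (expR (- a * L) * sin (a * th)).
Proof.
have := PE; have := QE; rewrite /P /Q S0 C0 !mulr0 !mulr1 expR0 cos0 sin0.
rewrite !mulr0 !mulr1 !mul1r subr0 addr0 => q1 p1.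
have -> : oscI a (expR L * cos th) (expR L * sin th) (- (pi / 2)) = S 1.
  by rewrite /S /x /y !mulr1.
have e := cos2Dsin2 (a * th).
transitivity (expR (- a * L) * (sin (a * th) *
  (expR (a * L) * (C 1 * cos (a * th) + S 1 * sin (a * th)))
  + cos (a * th) * (expR (a * L) * (S 1 * cos (a * th) - C 1 * sin (a * th))))).
  transitivity ((expR (- a * L) * expR (a * L)) * S 1 * (cos (a * th) ^+ 2 + sin (a * th) ^+ 2)).
    by rewrite E1 e mul1r mulr1.
  by ring.
by rewrite q1 p1; ring.
Qed.

End polar_gamma.

(** * Principal logarithm and principal powers *)

Section complex_powers.
Context {R : realType}.
Implicit Types (z w : R[i]) (a b t : R).
Local Notation Re := complex.Re.
Local Notation Im := complex.Im.
Local Notation normc := ComplexField.Normc.normc.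

Lemma complex_ext z w : Re z = Re w -> Im z = Im w -> z = w.
Proof. by case: z w => [x y] [u v] /= -> ->. Qed.

Lemma Re_mul z w : Re (z * w) = Re z * Re w - Im z * Im w.
Proof. by case: z w => [x y] [u v]. Qed.

Lemma Im_mul z w : Im (z * w) = Re z * Im w + Im z * Re w.
Proof. by case: z w => [x y] [u v]. Qed.

Lemma Re_opp z : Re (- z) = - Re z. Proof. by case: z. Qed.

Lemma Im_opp z : Im (- z) = - Im z. Proof. by case: z. Qed.

Lemma Re_cexp z : Re (cexp z) = expR (Re z) * cos (Im z).
Proof. by rewrite /cexp Re_mul /= mul0r subr0. Qed.

Lemma Im_cexp z : Im (cexp z) = expR (Re z) * sin (Im z).
Proof. by rewrite /cexp Im_mul /= mul0r addr0. Qed.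

Lemma cexpD z w : cexp (z + w) = cexp z * cexp w.
Proof.
by apply: complex_ext; rewrite ?(Re_mul, Im_mul) ?Re_cexp ?Im_cexp !raddfD /= expRD ?(cosD, sinD); ring.
Qed.

Lemma cexp0 : cexp (0 : R[i]) = 1.
Proof.
apply: complex_ext; rewrite ?Re_cexp ?Im_cexp /=.
  by rewrite expR0 cos0 mul1r.
by rewrite sin0 mulr0.
Qed.

Lemma normc_sqr z : normc z ^+ 2 = Re z ^+ 2 + Im z ^+ 2.
Proof. by case: z => x y /=; rewrite sqr_sqrtr// addr_ge0 ?sqr_ge0. Qed.

Lemma normc_gt0 z : z != 0 -> 0 < normc z.
Proof.
move=> z0; rewrite lt0r; apply/andP; split; last by case: z {z0} => x y /=; rewrite sqrtr_ge0.
by apply: contra z0 => /eqP/ComplexField.Normc.eq0_normc ->.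
Qed.

Lemma Re_le_normc z : z != 0 -> -1 <= Re z / normc z <= 1.
Proof.
move=> z0; have n0 := normc_gt0 z0; have e := normc_sqr z.
rewrite -ler_norml normf_div (gtr0_norm n0) ler_pdivrMr// mul1r.
rewrite -(ler_pXn2r (ltn0Sn 1)) ?nnegrE ?normr_ge0 ?(ltW n0)//.
by rewrite real_normK ?num_real// e lerDl sqr_ge0.
Qed.

Lemma cos_carg z : z != 0 -> cos (carg z) = Re z / normc z.
Proof.
move=> z0; rewrite /carg; case: ifP => _; rewrite ?cosN acosK// in_itv/=; exact: Re_le_normc.
Qed.

Lemma sin_carg z : z != 0 -> sin (carg z) = Im z / normc z.
Proof.
move=> z0; have n0 := normc_gt0 z0; have e := normc_sqr z.
have s : sin (acos (Re z / normc z)) = `|Im z| / normc z.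
  rewrite sin_acos ?Re_le_normc//.
  have -> : 1 - (Re z / normc z) ^+ 2 = (Im z / normc z) ^+ 2.
    rewrite !expr_div_n e -(mulfV (x := Re z ^+ 2 + Im z ^+ 2)); last first.
      by rewrite -e expf_neq0// lt0r_neq0.
    by rewrite -mulrBl addrAC subrr add0r.
  by rewrite sqrtr_sqr normf_div (gtr0_norm n0).
rewrite /carg; case: ifP => [i0|/negbT]; first by rewrite s ger0_norm.
by rewrite -ltNge => i0; rewrite sinN s ltr0_norm// mulNr opprK.
Qed.

Lemma cexp_clog z : z != 0 -> cexp (clog z) = z.
Proof.
move=> z0; have n0 := normc_gt0 z0; have nn0 := lt0r_neq0 n0.
apply: complex_ext; rewrite ?Re_cexp ?Im_cexp /= lnK ?posrE// ?cos_carg ?sin_carg// mulrC.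
  by rewrite divfK.
by rewrite divfK.
Qed.

Lemma carg_pihalf z : 0 < Re z -> - (pi / 2) < carg z < pi / 2.
Proof.
move=> x0; have z0 : z != 0 by apply: contraTneq x0 => ->; rewrite ltxx.
have n0 := normc_gt0 z0; have bd := Re_le_normc z0.
have a1 : acos (Re z / normc z) < pi / 2.
  rewrite -ltr_cos ?in_itv/= ?acos_ge0 ?acos_lepi//.
    by rewrite cos_pihalf acosK ?in_itv//= divr_gt0.
  have p0 := @pi_gt0 R.
  by rewrite divr_ge0 ?(ltW p0)//= ler_pdivrMr// ler_peMr ?(ltW p0)// ler1n.
have a0 := acos_ge0 bd.
have p0 : - (pi / 2) < (0 : R) by rewrite oppr_lt0 divr_gt0// pi_gt0.
rewrite /carg; case: ifP => _.
  by rewrite a1 (lt_le_trans p0).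
by rewrite ltrN2 a1 (le_lt_trans (y := 0))// ?oppr_le0// -oppr_lt0.
Qed.

Lemma cpowE z a : z != 0 -> cpow z a = cexp (a%:C * clog z).
Proof. by rewrite /cpow => /negbTE ->. Qed.

Lemma cpowD z a b : z != 0 -> cpow z (a + b) = cpow z a * cpow z b.
Proof. by move=> z0; rewrite !cpowE// -cexpD rmorphD mulrDl. Qed.

Lemma cpowr0 z : cpow z 0 = 1.
Proof.
rewrite /cpow eqxx; case: eqP => // _.
by rewrite mul0r cexp0.
Qed.

Lemma cpowr1 z : z != 0 -> cpow z 1 = z.
Proof. by move=> z0; rewrite cpowE// mul1r cexp_clog. Qed.

Lemma clogZ t z : 0 < t -> z != 0 -> clog (t%:C * z) = (ln t)%:C + clog z.
Proof.
move=> t0 z0; have n0 := normc_gt0 z0.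
have nE : normc (t%:C * z) = t * normc z.
  by rewrite ComplexField.Normc.normcM /= expr0n /= addr0 sqrtr_sqr gtr0_norm.
apply: complex_ext; rewrite /= ?addr0 ?add0r.
  by rewrite nE lnM ?posrE// raddfD.
rewrite /carg nE Re_mul Im_mul /= !mul0r subr0 addr0.
rewrite pmulr_rge0//; congr (if _ then acos _ else - acos _);
  by rewrite -mulf_div divff ?mul1r// lt0r_neq0.
Qed.

(* At [t = 0] both sides follow the convention of [powR]. *)
Lemma cpowZ t z a : 0 <= t -> z != 0 ->
  cpow (t%:C * z) (a - 1) = (t `^ (a - 1))%:C * cpow z (a - 1).
Proof.
rewrite le_eqVlt => /predU1P[<- z0|t0 z0].
  rewrite mul0r {1}/cpow eqxx /powR eqxx.
  by have [->|] := eqVneq (a - 1) 0; rewrite ?cpowr0 ?mul1r// mul0r.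
have tn0 := lt0r_neq0 t0.
have tz0 : t%:C * z != 0.
  rewrite mulf_neq0//; apply: contra tn0 => /eqP e.
  by have := congr1 (fun w : R[i] => Re w) e => /= ->.
rewrite !cpowE// clogZ// mulrDr cexpD; congr (_ * _).
apply: complex_ext; rewrite ?Re_cexp ?Im_cexp Re_mul Im_mul /=.
  by rewrite !mul0r mulr0 subr0 addr0 cos0 mulr1 /powR (negbTE tn0).
by rewrite ?(mul0r, mulr0, addr0, sin0).
Qed.

End complex_powers.

(** * Radial integrals and the function u *)

Section radial_integrals.
Context {R : realType}.
Notation mu := (@lebesgue_measure R).
Local Notation Re := complex.Re.
Local Notation Im := complex.Im.

(** Serves to cancel the [1 / Gamma] in [incP]. The part of the integral over [[0, 1]] is already at
    least [exp(- 1) / a]. *)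
Lemma Gamma_gt0 (a : R) : 0 < a -> 0 < Gamma a.
Proof.
move=> a0; rewrite GammaE// /oscI.
have i0 := @osc_integrable _ a 1 0 0 a0 ltr01.
have t := Rintegral_tail ler01 i0.
have w0 (u : R) : 0 <= wfun a (osc 1 0 0) u.
  by rewrite /wfun /osc mul0r addr0 cos0 mulr1 mulr_ge0 ?powR_ge0 ?expR_ge0.
have t0 : 0 <= \int[mu]_(u in `[1, +oo[) wfun a (osc 1 0 0) u by exact: Rintegral_ge0.
suff i1 : 0 < \int[mu]_(u in `[0, 1]) wfun a (osc 1 0 0) u.
  have := ltr_wpDl t0 i1; rewrite t subrK; exact.
have m1 : mu.-integrable `[0, 1] (EFin \o wfun a (fun=> expR (- 1))).
  by apply: wfun_integrable_itv => // x; exact: cvg_cst.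
have e1 : \int[mu]_(u in `[0, 1]) wfun a (fun=> expR (- 1)) u = expR (- 1) / a.
  transitivity (2 / a * psi a 1 * expR (- 1) - 2 / a * psi a 0 * expR (-1) : R).
    apply: (@FTC_singular _ (wfun a (fun=> expR (- 1)))
      (fun u => 2 / a * psi a u * expR (- 1)) 1 ler01).
    - exact: m1.
    - by move=> x x0; apply: wfun_continuous => // y; exact: cvg_cst.
    - move=> u; apply: cvgM; last exact: cvg_cst.
      by apply: cvgMl_tmp; exact: psi_cts.
    - move=> u u0; have un0 : u != 0 by rewrite lt0r_neq0.
      apply: (is_derive_eq (derM (derZ (2 / a) (psi_der a un0)) (der_cst (expR (- 1)) u))).
      by rewrite dpsi_pos// /wfun mulr0 addr0; field; rewrite lt0r_neq0.
  rewrite /psi normr0 powR0 ?lt0r_neq0// normr1 powR1.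
  by field; rewrite lt0r_neq0.
apply: (@lt_le_trans _ _ (expR (- 1) / a)); first by rewrite divr_gt0// expR_gt0.
rewrite -e1; apply: le_Rintegral => //.
  exact: wfun_integrable_itv a0 (@osc_cts _ _ _ _).
move=> u; rewrite /= in_itv/= => /andP[u0 u1].
rewrite /wfun ler_wpM2l ?powR_ge0// /osc mul0r addr0 cos0 mulr1 mulN1r ler_expR lerN2.
exact: u1.
Qed.

Lemma GammaS (a : R) : 0 < a -> Gamma (a + 1) = a * Gamma a.
Proof.
move=> a0; have a10 : 0 < a + 1 by rewrite addr_gt0.
by rewrite !GammaE// (oscI_parts _ _ a0 ltr01) mul1r mul0r subr0.
Qed.

(** The substitution [u = t h], read off from the primitive [wJ a g (|t| h)]; the absolute value
    makes it a continuous function of [t] on the whole line, as [FTC_singular] asks. *)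
Lemma wJ_scale (a h : R) (g : R -> R) : 0 < a -> 0 <= h -> continuous g ->
  \int[mu]_(t in `[0, 1]) (h * wfun a g (t * h)) = wJ a g h.
Proof.
move=> a0; rewrite le_eqVlt => /predU1P[<- cg|h0 cg].
  rewrite wJ0 [LHS](_ : _ = \int[mu]_(t in `[0, 1]) (0 : R)).
    by rewrite Rintegral_cst// mul0r.
  by apply: eq_Rintegral => u _; rewrite mul0r.
have cgh : continuous (fun t : R => g (t * h)).
  move=> t; apply: (@continuous_comp _ _ _ (fun t : R => t * h) g); last exact: cg.
  by apply: cvgMr_tmp; exact: cvg_id.
have wE (t : R) : 0 <= t -> h * wfun a g (t * h) =
    h * h `^ (a - 1) * wfun a (fun t => g (t * h)) t.
  by move=> t0; rewrite /wfun powRM// ?ltW//; ring.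
rewrite [LHS](_ : _ = \int[mu]_(t in `[0, 1]) (h * h `^ (a - 1) * wfun a (fun t => g (t * h)) t)); last first.
  by apply: eq_Rintegral => t; rewrite inE/= in_itv/= => /andP[t0 _]; exact: wE.
transitivity (wJ a g (`|1 : R| * h) - wJ a g (`|0 : R| * h)); last first.
  by rewrite normr1 normr0 mul1r mul0r wJ0 subr0.
apply: (@FTC_singular _ _ (fun t : R => wJ a g (`|t| * h)) 1 ler01).
- apply: integrable_itvZ; exact: wfun_integrable_itv.
- by move=> t t0; apply: cvgMl_tmp; exact: wfun_continuous.
- move=> t; apply: (@continuous_comp _ _ _ (fun t : R => `|t| * h) (wJ a g)).
    by apply: cvgMr_tmp; exact: norm_continuous.
  have [->|t0] := eqVneq t 0; first by rewrite normr0 mul0r; exact: wJ_cts0.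
  by apply: der_cts (wJ_der a0 cg _); rewrite mulr_gt0// normr_gt0.
- move=> t t0; rewrite -wE ?ltW//.
  have th0 : 0 < h * t + 0 by rewrite addr0 mulr_gt0.
  have E : \forall s \near t, wJ a g (h * s + 0) = wJ a g (`|s| * h).
    by apply: filterS (near_gt0 t0) => s s0; rewrite gtr0_norm// addr0 mulrC.
  apply: (near_eq_is_derive E).
  apply: (is_derive_eq (der_comp_aff (wJ_der a0 cg th0))).
  by rewrite addr0 (mulrC h t).
Qed.

Definition cintegrable (D : set R) (f : R -> R[i]) :=
  mu.-integrable D (EFin \o (fun u => Re (f u))) /\
  mu.-integrable D (EFin \o (fun u => Im (f u))).

Lemma cintegralZr (I : interval R) (f : R -> R[i]) (z : R[i]) :
  cintegrable [set` I] f -> cintegral [set` I] (fun u => f u * z) = cintegral [set` I] f * z.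
Proof.
move=> [f1 f2]; apply: complex_ext.
  rewrite [RHS](Re_mul (cintegral [set` I] f) z) /cintegral /= -!RintegralZr// -RintegralB//; first by apply: eq_Rintegral => u _; rewrite Re_mul.
  - by have := integrable_itvZ (Re z) f1; apply: eq_integrable => // u _ /=; rewrite mulrC.
  - by have := integrable_itvZ (Im z) f2; apply: eq_integrable => // u _ /=; rewrite mulrC.
rewrite [RHS](Im_mul (cintegral [set` I] f) z) /cintegral /= -!RintegralZr// -RintegralD//; first by apply: eq_Rintegral => u _; rewrite Im_mul.
- by have := integrable_itvZ (Im z) f1; apply: eq_integrable => // u _ /=; rewrite mulrC.
- by have := integrable_itvZ (Re z) f2; apply: eq_integrable => // u _ /=; rewrite mulrC.
Qed.

Lemma eq_cintegral (D : set R) (f g : R -> R[i]) : {in D, f =1 g} ->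
  cintegral D f = cintegral D g.
Proof. by move=> fg; apply: complex_ext => /=; apply: eq_Rintegral => u /fg ->. Qed.

Definition cwfun (a : R) (z : R[i]) (u : R) : R[i] := (u `^ (a - 1))%:C * cexp (u%:C * z).

Lemma Re_cwfun a z (u : R) : Re (cwfun a z u) = wfun a (osc (- Re z) (Im z) 0) u.
Proof.
rewrite /cwfun Re_mul Re_cexp Re_mul Im_mul /= !mul0r !subr0 addr0.
by rewrite /wfun /osc opprK addr0 (mulrC (Re z)) (mulrC (Im z)).
Qed.

Lemma Im_cwfun a z (u : R) : Im (cwfun a z u) = wfun a (osc (- Re z) (Im z) (- (pi / 2))) u.
Proof.
rewrite /cwfun Im_mul Im_cexp Re_mul Im_mul /= !mul0r !subr0 !addr0.
by rewrite /wfun /osc opprK cosBpihalf (mulrC (Re z)) (mulrC (Im z)).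
Qed.

Lemma cwfun_integrable_itv a z (h : R) : 0 < a -> cintegrable `[0, h]%classic (cwfun a z).
Proof.
move=> a0; split.
  have := @wfun_integrable_itv _ a _ h a0 (@osc_cts _ (- Re z) (Im z) 0).
  by apply: eq_integrable => // u _; rewrite /comp Re_cwfun.
have := @wfun_integrable_itv _ a _ h a0 (@osc_cts _ (- Re z) (Im z) (- (pi / 2))).
by apply: eq_integrable => // u _; rewrite /comp Im_cwfun.
Qed.

Lemma cwfun_integrable a z : 0 < a -> Re z < 0 -> cintegrable `[0, +oo[%classic (cwfun a z).
Proof.
move=> a0 z0; have x0 : 0 < - Re z by rewrite oppr_gt0.
split.
  have := osc_integrable (Im z) 0 a0 x0.
  by apply: eq_integrable => // u _; rewrite /comp Re_cwfun.
have := osc_integrable (Im z) (- (pi / 2)) a0 x0.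
by apply: eq_integrable => // u _; rewrite /comp Im_cwfun.
Qed.

Lemma cintegral_tail (h : R) (f : R -> R[i]) : 0 <= h -> cintegrable `[0, +oo[%classic f ->
  cintegral `[h, +oo[%classic f = cintegral `[0, +oo[%classic f - cintegral `[0, h]%classic f.
Proof.
move=> h0 [f1 f2]; apply: complex_ext; rewrite raddfB /=;
  [rewrite (Rintegral_tail h0 f1)|rewrite (Rintegral_tail h0 f2)]; by [].
Qed.

Lemma cintegral_cwfun a z : cintegral `[0, +oo[%classic (cwfun a z) =
  oscI a (- Re z) (Im z) 0 +i* oscI a (- Re z) (Im z) (- (pi / 2)).
Proof.
by congr (_ +i* _); apply: eq_Rintegral => u _; rewrite ?Re_cwfun ?Im_cwfun.
Qed.

Lemma oscIN (a x y : R) : oscI a x (- y) 0 = oscI a x y 0.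
Proof.
by apply: eq_Rintegral => u _; rewrite /wfun /osc !addr0 [- y * _]mulNr cosN.
Qed.

Lemma oscIN_pihalf (a x y : R) : 0 < a -> 0 < x ->
  oscI a x (- y) (- (pi / 2)) = - oscI a x y (- (pi / 2)).
Proof.
move=> a0 x0; rewrite -[RHS]mulN1r /oscI -RintegralZl//; last exact: osc_integrable.
by apply: eq_Rintegral => u _; rewrite /wfun /osc !cosBpihalf [- y * _]mulNr sinN; ring.
Qed.

(** [- z] lies in the right half-plane, so its principal argument is an admissible angle [th] for
    the polar formulas; [oscIN] and [oscIN_pihalf] account for the sign of [Im z]. *)
Lemma cintegral_Gamma a z : 0 < a -> Re z < 0 ->
  cintegral `[0, +oo[%classic (cwfun a z) = (Gamma a)%:C * cpow (- z) (- a).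
Proof.
move=> a0 z0; have x0 : 0 < Re (- z) by rewrite Re_opp oppr_gt0.
have nz0 : - z != 0 by apply: contraTneq x0 => ->; rewrite ltxx.
rewrite cintegral_cwfun -Re_opp -[Im z]opprK -Im_opp oscIN oscIN_pihalf//.
have ar := carg_pihalf x0.
rewrite (cpowE _ nz0) -[in LHS](cexp_clog nz0) Re_cexp Im_cexp.
rewrite (oscI_polar_cos _ a0 ar) (oscI_polar_sin _ a0 ar).
apply: complex_ext.
  rewrite [RHS]Re_mul Re_cexp Re_mul Im_mul /=.
  by rewrite !mul0r !subr0 !addr0 [- a * carg _]mulNr cosN.
rewrite [RHS]Im_mul Im_cexp Re_mul Im_mul /=.
by rewrite !mul0r !subr0 !addr0 [- a * carg _]mulNr sinN !mulrN.
Qed.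

(** Positive factors come out of the principal power, so the radial integral reduces to one over the
    real interval [[0, h]]. *)
Lemma incP_cwfun a z (h : R) : 0 < a -> z != 0 -> 0 <= h ->
  incP a (z * h%:C) =
  (Gamma a)^-1%:C * (cpow z (a - 1) * z * cintegral `[0, h]%classic (cwfun a (- z))).
Proof.
move=> a0 z0 h0; rewrite /incP; congr (_ * _).
have ig : cintegrable `[0, 1]%classic (fun t => h%:C * cwfun a (- z) (t * h)).
  have cE (g : R -> R) : continuous g ->
      mu.-integrable `[0, 1] (EFin \o (fun t => h * wfun a g (t * h))).
    move=> cg; have cgh : continuous (fun t : R => g (t * h)).
      move=> t; apply: (@continuous_comp _ _ _ (fun t : R => t * h) g); last exact: cg.
      by apply: cvgMr_tmp; exact: cvg_id.
    have := integrable_itvZ (h * h `^ (a - 1)) (wfun_integrable_itv 1 a0 cgh).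
    apply: eq_integrable => // u; rewrite inE/= in_itv/= => /andP[u0 _].
    by rewrite /wfun powRM//; congr EFin; ring.
  split.
    have := cE _ (@osc_cts _ (- Re (- z)) (Im (- z)) 0).
    by apply: eq_integrable => // u _; rewrite /comp Re_mul Re_cwfun/= mul0r subr0.
  have := cE _ (@osc_cts _ (- Re (- z)) (Im (- z)) (- (pi / 2))).
  by apply: eq_integrable => // u _; rewrite /comp Im_mul Im_cwfun/= mul0r addr0.
have -> : cintegral `[0, h]%classic (cwfun a (- z)) =
    cintegral `[0, 1]%classic (fun t => h%:C * cwfun a (- z) (t * h)).
  rewrite /cintegral; congr (_ +i* _).
    transitivity (wJ a (osc (- Re (- z)) (Im (- z)) 0) h).
      by apply: eq_Rintegral => u _; rewrite Re_cwfun.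
    rewrite -wJ_scale//; last exact: osc_cts.
    by apply: eq_Rintegral => u _; rewrite Re_mul Re_cwfun/= mul0r subr0.
  transitivity (wJ a (osc (- Re (- z)) (Im (- z)) (- (pi / 2))) h).
    by apply: eq_Rintegral => u _; rewrite Im_cwfun.
  rewrite -wJ_scale//; last exact: osc_cts.
  by apply: eq_Rintegral => u _; rewrite Im_mul Im_cwfun/= mul0r addr0.
rewrite [RHS]mulrC -cintegralZr//; apply: eq_cintegral => t; rewrite inE/= in_itv/= => /andP[t0 _].
have -> : t%:C * (z * h%:C) = (t * h)%:C * z by rewrite rmorphM /=; ring.
rewrite cpowZ ?mulr_ge0// /cwfun mulrN; ring.
Qed.

(** Here [k] is [Gamma(2H)], [A] and [B] are [z^(1-2H)] and [z^(2H-1)], the primed letters their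
    values at [- z], [D] is [(- z)^(-2H)], [e] and [f] are [exp(z h)] and [exp(- z h)], and [J], [I]
    the integrals over [[0, h]]. As [k D] is the half-line integral, the hyperbolic cosine supplies
    two copies of it, one of which becomes the tail [k D - I]. *)
Lemma ufun_algebra (F : numFieldType) (k A B A' B' D e f J I z : F) : k != 0 ->
  A * B = 1 -> A' * B' = 1 -> A' = - z * D ->
  k * (2%:R * A' * ((e + f) / 2%:R) + A * e * (k^-1 * (B * z * J)) -
    A' * f * (k^-1 * (B' * - z * I))) =
  z * (e * J - f * (k * D - I) - e * (k * D)).
Proof.
move=> k0 AB AB' A'D.
transitivity (k * A' * (e + f) + (A * B) * e * z * J + (A' * B') * f * z * I).
  by field.
by rewrite AB AB' A'D; ring.
Qed.

Lemma ufunE (H : R) z (h : R) : 0 < H -> Re z < 0 -> 0 <= h ->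
  (Gamma (2 * H))%:C * ufun H z h =
  z * (cexp (h%:C * z) * cintegral `[0, h]%classic (cwfun (2 * H) (- z))
       - cexp (- (h%:C * z)) * cintegral `[h, +oo[%classic (cwfun (2 * H) z)
       - cexp (h%:C * z) * cintegral `[0, +oo[%classic (cwfun (2 * H) z)).
Proof.
move=> H0 x0 h0; have a0 : 0 < 2 * H by rewrite mulr_gt0.
have z0 : z != 0 by apply: contraTneq x0 => ->; rewrite ltxx.
have nz0 : - z != 0 by rewrite oppr_eq0.
have G0 := Gamma_gt0 a0.
have Gn0 : (Gamma (2 * H))%:C != 0 :> R[i].
  by apply: contra (lt0r_neq0 G0) => /eqP e; have := congr1 (fun w : R[i] => Re w) e => /= ->.
have cE : (1 - 2 * H) = - (2 * H - 1) by ring.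
rewrite /ufun -[- (z * _)]mulNr !incP_cwfun// opprK mulNr.
have c1 w : w != 0 -> cpow w (1 - 2 * H) * cpow w (2 * H - 1) = 1.
  by move=> w0; rewrite -cpowD// cE addNr cpowr0.
have c2 : cpow (- z) (1 - 2 * H) = - z * cpow (- z) (- (2 * H)).
  by rewrite cpowD// cpowr1.
have T0 := cintegral_Gamma a0 x0.
rewrite (cintegral_tail h0 (cwfun_integrable a0 x0)) T0.
rewrite fmorphV /= /ccosh (mulrC h%:C z).
exact: (ufun_algebra _ _ _ _ Gn0 (c1 _ z0) (c1 _ nz0) c2).
Qed.

End radial_integrals.

(** * Spectral decomposition *)

Section complex_eigenvectors.
Context {R : realType}.
Notation mu := (@lebesgue_measure R).
Local Notation Re := complex.Re.
Local Notation Im := complex.Im.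
Local Notation toC := (map_mx (real_complex R)).

Lemma linear_ode_unique n m (A : 'M[R]_n) (F : R -> 'M[R]_(n, m)) x :
  (forall u, mxder F u (A *m F u)) -> F x = expmx (x *: A) *m F 0.
Proof.
move=> dF; have d (u : R) : mxder (fun u => expmx (- u *: A) *m F u) u 0.
  have dE : mxder (fun v => expmx (- v *: A)) u (- (expmx (- u *: A) *m A)).
    apply: (@mxder_ext _ _ _ (fun v => expmx ((-1 * v + 0) *: A))) => [v|].
      by rewrite mulN1r addr0.
    apply: mxder_eq; first by apply: (@mxder_aff _ _ _ (fun u => expmx (u *: A))); exact: expmx_der.
    by rewrite scaleN1r mulN1r addr0.
  apply: mxder_eq (mxderM dE (dF u)) _.
  by rewrite mulNmx mulmxA addNr.
have := mxder0_cst x 0 d; rewrite oppr0 expmx0 mul1mx => <-.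
by rewrite mulmxA expmxKN mul1mx.
Qed.

Lemma cexp_der (z : R[i]) (u : R) :
  is_derive u (1 : R) (fun v : R => Re (cexp (v%:C * z)))
    (Re z * Re (cexp (u%:C * z)) - Im z * Im (cexp (u%:C * z))) /\
  is_derive u (1 : R) (fun v : R => Im (cexp (v%:C * z)))
    (Re z * Im (cexp (u%:C * z)) + Im z * Re (cexp (u%:C * z))).
Proof.
have e1 (v : R) : Re (v%:C * z) = Re z * v by rewrite Re_mul /= mul0r subr0 mulrC.
have e2 (v : R) : Im (v%:C * z) = Im z * v by rewrite Im_mul /= mul0r addr0 mulrC.
have dl := derZ (Im z) (is_derive_id u (1 : R)).
have dc := der_comp dl (is_derive_cos _).
have ds := der_comp dl (is_derive_sin _).
split.
  have -> : (fun v : R => Re (cexp (v%:C * z))) = (fun v => expR (Re z * v) * cos (Im z * v)).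
    by apply/funext => v; rewrite Re_cexp e1 e2.
  apply: (is_derive_eq (derM (der_expR (Re z) u) dc)).
  by rewrite Re_cexp Im_cexp e1 e2; ring.
have -> : (fun v : R => Im (cexp (v%:C * z))) = (fun v => expR (Re z * v) * sin (Im z * v)).
  by apply/funext => v; rewrite Im_cexp e1 e2.
apply: (is_derive_eq (derM (der_expR (Re z) u) ds)).
by rewrite Re_cexp Im_cexp e1 e2; ring.
Qed.

Variables (n : nat) (A : 'M[R]_n) (r : 'cV[R[i]]_n) (z : R[i]).
Hypothesis Ar : toC A *m r = z *: r.

Let Ar1 : A *m mxRe r = Re z *: mxRe r - Im z *: mxIm r.
Proof.
by rewrite -mxRe_mulCl Ar; apply/matrixP => i j; rewrite !mxE Re_mul.
Qed.

Let Ar2 : A *m mxIm r = Re z *: mxIm r + Im z *: mxRe r.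
Proof.
by rewrite -mxIm_mulCl Ar; apply/matrixP => i j; rewrite !mxE Im_mul.
Qed.

(** [expmx] is real, so the claim is split into the real and imaginary parts of [exp(x z) r]; each
    solves [F' = A F], and uniqueness identifies them. *)
Lemma expmx_eigen (x : R) : toC (expmx (x *: A)) *m r = cexp (x%:C * z) *: r.
Proof.
pose c (u : R) := Re (cexp (u%:C * z)); pose s (u : R) := Im (cexp (u%:C * z)).
have d (u : R) := cexp_der z u.
have E1 : c x *: mxRe r - s x *: mxIm r = expmx (x *: A) *m mxRe r.
  rewrite (@linear_ode_unique _ _ A (fun u => c u *: mxRe r - s u *: mxIm r)) => [|u].
    by congr (_ *m _); rewrite /c /s mul0r cexp0 scale1r scale0r subr0.
  have [d1 d2] := d u.
  apply: mxder_eq (mxderB (mxderZ d1 (mxder_cst (mxRe r) u)) (mxderZ d2 (mxder_cst (mxIm r) u))) _.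
  rewrite !scaler0 !addr0 mulmxBr -!scalemxAr Ar1 Ar2 -/(c u) -/(s u).
  by apply/matrixP => i j; rewrite !mxE; ring.
have E2 : s x *: mxRe r + c x *: mxIm r = expmx (x *: A) *m mxIm r.
  rewrite (@linear_ode_unique _ _ A (fun u => s u *: mxRe r + c u *: mxIm r)) => [|u].
    by congr (_ *m _); rewrite /c /s mul0r cexp0 scale1r scale0r add0r.
  have [d1 d2] := d u.
  apply: mxder_eq (mxderD (mxderZ d2 (mxder_cst (mxRe r) u)) (mxderZ d1 (mxder_cst (mxIm r) u))) _.
  rewrite !scaler0 !addr0 mulmxDr -!scalemxAr Ar1 Ar2 -/(c u) -/(s u).
  by apply/matrixP => i j; rewrite !mxE; ring.
apply/matrixP => i j; apply: complex_ext.
  have : (mxRe (toC (expmx (x *: A)) *m r)) i j = (c x *: mxRe r - s x *: mxIm r) i j.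
    by rewrite mxRe_mulCl E1.
  by rewrite [LHS]mxE => ->; rewrite !mxE Re_mul.
have : (mxIm (toC (expmx (x *: A)) *m r)) i j = (s x *: mxRe r + c x *: mxIm r) i j.
  by rewrite mxIm_mulCl E2.
by rewrite [LHS]mxE => ->; rewrite !mxE Im_mul addrC.
Qed.

Lemma cintegral_lincomb (I : interval R) m (f : 'I_m -> R -> R) (k : 'I_m -> R[i]) :
  (forall l, mu.-integrable [set` I] (EFin \o f l)) ->
  cintegral [set` I] (fun u => \sum_l (f l u)%:C * k l) =
  \sum_l (\int[mu]_(u in [set` I]) f l u)%:C * k l.
Proof.
move=> fi; rewrite /cintegral.
have e1 w (x : R) : Re (x%:C * w) = Re w * x by rewrite Re_mul /= mul0r subr0 mulrC.
have e2 w (x : R) : Im (x%:C * w) = Im w * x by rewrite Im_mul /= mul0r addr0 mulrC.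
apply: complex_ext.
  rewrite [RHS]Re_sum; under [RHS]eq_bigr do rewrite e1.
  rewrite -Rintegral_lincomb//; apply: eq_Rintegral => u _.
  by rewrite Re_sum; apply: eq_bigr => l _; rewrite e1.
rewrite [RHS]Im_sum; under [RHS]eq_bigr do rewrite e2.
rewrite -Rintegral_lincomb//; apply: eq_Rintegral => u _.
by rewrite Im_sum; apply: eq_bigr => l _; rewrite e2.
Qed.

Lemma mxRintegral_eigen (I : interval R) (F : R -> 'M[R]_n) (f : R -> R[i]) :
  (forall i j, mu.-integrable [set` I] (EFin \o (fun u => F u i j))) ->
  cintegrable [set` I] f ->
  (forall u : R, toC (F u) *m r = f u *: r) ->
  toC (mxRintegral [set` I] F) *m r = cintegral [set` I] f *: r.
Proof.
move=> Fi fi Ff; apply/matrixP => i j; rewrite mxE [RHS]mxE -cintegralZr//.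
transitivity (\sum_l (\int[mu]_(u in [set` I]) F u i l)%:C * r l j).
  by apply: eq_bigr => l _; rewrite !mxE.
rewrite -(cintegral_lincomb (fun l => r l j) (Fi i)); apply: eq_cintegral => u _.
have := congr1 (fun M : 'M[R[i]]_(n, 1) => M i j) (Ff u); rewrite /= [RHS]mxE => <-.
by rewrite mxE; apply: eq_bigr => l _; rewrite mxE.
Qed.

Variables (a c : R).
Hypothesis a0 : 0 < a.
Hypothesis c0 : 0 < c.
Hypothesis Adec : decaying c (fun x => expmx (x *: A)).
Hypothesis z0 : Re z < 0.

Let WE (u : R) : toC (u `^ (a - 1) *: expmx (u *: A)) *m r = cwfun a z u *: r.
Proof. by rewrite map_mxZ -scalemxAl expmx_eigen scalerA. Qed.

Let WNE (u : R) : toC (u `^ (a - 1) *: expmx (- u *: A)) *m r = cwfun a (- z) u *: r.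
Proof. by rewrite map_mxZ -scalemxAl expmx_eigen scalerA /cwfun rmorphN mulrN mulNr. Qed.

Lemma intN_eigen (h : R) : toC (intN a A h) *m r = cintegral `[0, h]%classic (cwfun a (- z)) *: r.
Proof.
apply: mxRintegral_eigen => //; last exact: cwfun_integrable_itv.
move=> i j; have ct : continuous (fun u : R => expmx (- u *: A) i j).
  move=> x; apply: (@continuous_comp _ _ _ -%R (fun u : R => expmx (u *: A) i j)).
    exact: continuousN.
  exact: expmx_ctns.
have := wfun_integrable_itv h a0 ct.
by apply: eq_integrable => // u _; rewrite /comp mxE.
Qed.

Lemma tailint_eigen (h : R) : 0 <= h ->
  toC (tailint a A h) *m r = cintegral `[h, +oo[%classic (cwfun a z) *: r.
Proof.
move=> h0; have sub : `[h, +oo[%classic `<=` (`[0, +oo[%classic : set R).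
  by apply: subset_itvr; rewrite bnd_simp.
apply: mxRintegral_eigen => //.
  move=> i j; have [K HK] := Adec.
  have i1 := wfun_integrable a0 c0 (@expmx_ctns _ _ A i j) (fun x => HK x i j).
  suff i2 : mu.-integrable `[0, +oo[
      (EFin \o (fun u => (u `^ (a - 1) *: expmx (u *: A)) i j)).
    by apply: integrableS i2.
  by apply: eq_integrable i1 => // u _; rewrite /comp mxE.
have [i1 i2] := cwfun_integrable a0 z0.
by split; [apply: integrableS i1|apply: integrableS i2].
Qed.

(** The bracket is that of [ufunE], so one further factor [z], supplied by [A], turns it into
    [Gamma(2H)] times [ufun]. *)
Lemma Theta_eigen (h : R) : 0 <= h ->
  toC (Theta a A h + Theta a A (- h)) *m r =
  ((a / 2)%:C * (cexp (h%:C * z) * cintegral `[0, h]%classic (cwfun a (- z))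
    - cexp (- (h%:C * z)) * cintegral `[h, +oo[%classic (cwfun a z)
    - cexp (h%:C * z) * cintegral `[0, +oo[%classic (cwfun a z))) *: r.
Proof.
move=> h0; rewrite (Theta_ge0 _ _ h0) (Theta_le0 a0 c0 Adec h0).
have key (I : 'M[R]_n) (w : R[i]) x : toC I *m r = w *: r ->
    toC ((a / 2) *: (expmx (x *: A) *m I)) *m r = ((a / 2)%:C * (cexp (x%:C * z) * w)) *: r.
  move=> e; rewrite map_mxZ map_mxM -scalemxAl -mulmxA e -scalemxAr expmx_eigen !scalerA.
  by congr (_ *: _); ring.
have k1 := key _ _ h (intN_eigen h).
have k2 := key _ _ h (tailint_eigen (lexx 0)).
have k3 := key _ _ (- h) (tailint_eigen h0).
have alg (M1 M2 M3 : 'M[R]_n) (w1 w2 w3 : R[i]) : toC M1 *m r = w1 *: r ->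
    toC M2 *m r = w2 *: r -> toC M3 *m r = w3 *: r ->
    toC (M1 - M2 + - M3) *m r = (w1 - w2 - w3) *: r.
  move=> e1 e2 e3.
  by rewrite map_mxD map_mxB map_mxN mulmxDl mulmxBl mulNmx e1 e2 e3 -!scalerBl.
rewrite (alg _ _ _ _ _ _ k1 k2 k3); congr (_ *: _).
by rewrite rmorphN mulNr; ring.
Qed.

End complex_eigenvectors.

(** * Eigenvectors of the companion matrix and residues *)

Section spectral_form.
Context {R : realType}.
Local Notation Re := complex.Re.
Local Notation toC := (map_mx (real_complex R)).
Variables (p' q : nat) (alpha beta : nat -> R).
Let p := p'.+1.
Let C := companionC p alpha.
Let aC := alpha_polyC p alpha.
Let bC := beta_polyC q beta.
Let dC : 'cV[R[i]]_p := toC (delta_vec p).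

Definition monomials (z : R[i]) : 'cV[R[i]]_p := \col_i z ^+ i.

(** As an identity of polynomials it can be both evaluated, which gives the eigenvectors, and
    differentiated, which gives their normalization. *)
Lemma companion_poly (i : 'I_p) :
  \sum_j C i j *: 'X^j = 'X * 'X^i - (i.+1 == p)%:R *: aC.
Proof.
have aE : aC = 'X^p - \sum_(j < p) (alpha j.+1)%:C *: 'X^j.
  rewrite /aC /alpha_polyC /alpha_poly rmorphB /= map_polyXn rmorph_sum /=.
  by congr (_ - _); apply: eq_bigr => j _; rewrite map_polyZ map_polyXn.
have CE j : C i j = if i.+1 == p then (alpha j.+1)%:C else (j == i.+1 :> nat)%:R.
  by rewrite !mxE; case: ifP => // _; case: eqP.
under eq_bigr do rewrite CE.
have [ip|ip] := eqVneq i.+1 p.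
  by rewrite scale1r aE -exprS ip opprB addrC subrK.
rewrite scale0r subr0 -exprS.
have ilt : (i.+1 < p)%N by rewrite ltn_neqAle ip ltn_ord.
rewrite (bigD1 (Ordinal ilt)) //= eqxx scale1r big1 ?addr0// => j ji.
by rewrite (_ : (j == i.+1 :> nat) = false) ?scale0r//; apply: negbTE.
Qed.

Lemma companion_monomials z :
  C *m monomials z = z *: monomials z - aC.[z] *: dC.
Proof.
apply/matrixP => i j; have := congr1 (fun P : {poly R[i]} => P.[z]) (companion_poly i).
rewrite /= horner_sum !hornerE => e.
rewrite mxE [RHS]mxE [X in _ = X + _]mxE [X in _ = _ + X]mxE.
rewrite [monomials z i j]mxE.
transitivity (\sum_k (C i k *: 'X^k).[z]).
  by apply: eq_bigr => k _; rewrite [monomials z k j]mxE !hornerE.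
rewrite e; congr (_ - _).
rewrite !mxE mulrC; congr (_ * _).
by case: eqP.
Qed.

(* Differentiating [(C - z) monomials z = - aC.[z] dC] in [z] is what produces the
   factor [aC^`().[lam j]] of the residues. *)
Definition dmonomials (z : R[i]) : 'cV[R[i]]_p := \col_i ('X^i)^`().[z].

Lemma companion_dmonomials z :
  C *m dmonomials z = monomials z + z *: dmonomials z - aC^`().[z] *: dC.
Proof.
apply/matrixP => i j.
have := congr1 (fun P : {poly R[i]} => P^`().[z]) (companion_poly i).
rewrite /= raddf_sum horner_sum derivB derivM derivX mul1r derivZ hornerD hornerN hornerZ.
rewrite hornerD hornerM hornerX hornerXn => e.
rewrite mxE.
transitivity (\sum_k ((C i k *: 'X^k)^`()).[z]).
  by apply: eq_bigr => k _; rewrite [dmonomials z k j]mxE derivZ hornerZ.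
rewrite e !mxE; congr (_ - _); rewrite mulrC; congr (_ * _).
by case: eqP.
Qed.

(** Pairing a left eigenvector [v] with [monomials z] leaves [aC.[z]] times the last entry of [v],
    and that entry cannot be 0. *)
Lemma eigenvalue_alpha z : eigenvalue C z -> aC.[z] = 0.
Proof.
move=> /eigenvalueP[v vC v0].
have e : v *m (C *m monomials z) = z *: (v *m monomials z) by rewrite mulmxA vC scalemxAl.
rewrite companion_monomials mulmxBr -!scalemxAr in e.
have {}e : aC.[z] *: (v *m dC) = 0.
  by apply/eqP; rewrite -oppr_eq0 -(addKr (z *: (v *m monomials z)) (- _)) e addNr.
have vd : (v *m dC) 0 0 = v 0 ord_max.
  rewrite mxE (bigD1 ord_max)//= big1 ?addr0 => [|i im]; rewrite !mxE.
    by rewrite eqxx mulr1.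
  by rewrite (_ : (i.+1 == p) = false) ?mulr0//; apply: contra_neqF im => /eqP[im]; apply: val_inj.
have := congr1 (fun M : 'M[R[i]]_1 => M 0 0) e; rewrite /= mxE vd mxE => /eqP.
rewrite mulf_eq0 => /orP[/eqP//|/eqP vm].
exfalso; move/eqP: v0; apply; apply/rowP => i; rewrite mxE.
(* If the last entry is 0, column [i + 1] of [v C = z v] gives [v_i = z v_(i+1)], so descending from
   the last index kills all of [v]. *)
have H k : forall i : 'I_p, (p' - i)%N = k -> v 0 i = 0.
  elim: k => [|k IH] {}i ik.
    have -> : i = ord_max; last exact: vm.
    by apply: val_inj => /=; apply/eqP; rewrite eqn_leq -ltnS ltn_ord -subn_eq0 ik.
  have ilt : (i.+1 < p)%N by rewrite /p ltnS -subn_gt0 ik.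
  have := congr1 (fun M : 'rV[R[i]]_p => M 0 (Ordinal ilt)) vC.
  rewrite /= [RHS]mxE (IH (Ordinal ilt)) ?mulr0; last by rewrite /= subnS ik.
  rewrite mxE (bigD1 i)//= big1 => [|j ji].
    by rewrite !mxE (ltn_eqF ilt) /= eqxx addr0 /= mulr1.
  rewrite !mxE; case: ifP => [/eqP[jm]|_].
    by rewrite (_ : j = ord_max) ?vm ?mul0r//; apply: val_inj.
  rewrite eqSS (_ : (i == j :> nat) = false) ?mulr0//.
  by apply: contra_neqF ji => /eqP ij; apply: val_inj.
exact: H _ _ erefl.
Qed.

Lemma eigenvalueN_unit n (M : 'M[R[i]]_n) z : ~~ eigenvalue M z -> M - z%:M \in unitmx.
Proof. by rewrite /eigenvalue negbK => e; rewrite -row_free_unit -kermx_eq0. Qed.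

(** [monomials z] is then in the kernel of [C - z], and its first entry is 1. *)
Lemma alpha_eigenvalue z : aC.[z] = 0 -> eigenvalue C z.
Proof.
move=> az; apply: contraT => /eigenvalueN_unit Cu; exfalso.
have e : (C - z%:M) *m monomials z = 0.
  by rewrite mulmxBl companion_monomials mul_scalar_mx az scale0r subr0 subrr.
have := mulKmx Cu (monomials z); rewrite e mulmx0 => /colP/(_ ord0).
by rewrite !mxE expr0 => /eqP; rewrite eq_sym oner_eq0.
Qed.

Lemma beta_monomials z : (q < p)%N -> ((toC (beta_vec p q beta))^T *m monomials z) 0 0 = bC.[z].
Proof.
move=> qp; rewrite mxE /bC /beta_polyC /beta_poly rmorphD /= rmorph1 rmorph_sum /=.
rewrite hornerD hornerC horner_sum.
have -> : \sum_(1 <= j < q.+1) (map_poly (real_complex R) (beta j *: 'X^j)).[z] =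
    \sum_(1 <= j < p) (beta_coef q beta j)%:C * z ^+ j.
  rewrite [RHS](@big_cat_nat _ _ _ q.+1)//= [X in _ + X]big_nat_cond [X in _ + X]big1 ?addr0.
    rewrite !big_nat; apply: eq_bigr => j /andP[j1 jq].
    by rewrite map_polyZ map_polyXn hornerZ hornerXn /beta_coef gtn_eqF// -ltnS jq.
  move=> j /andP[/andP[jq _] _].
  by rewrite /beta_coef gtn_eqF ?(leq_ltn_trans _ jq)// leqNgt jq mul0r.
rewrite (eq_bigr (fun j : 'I_p => (beta_coef q beta j)%:C * z ^+ j)); last first.
  by move=> j _; rewrite !mxE.
rewrite -(big_mkord xpredT (fun j => (beta_coef q beta j)%:C * z ^+ j)) big_ltn//.
by rewrite expr0 mulr1.
Qed.

Variables (V : 'M[R]_p) (s : R).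
Let A := companion p alpha.
Let b := beta_vec p q beta.
Let VC := toC V.
Let beC := toC b.
Hypothesis qp : (q < p)%N.
Hypothesis VT : V^T = V.
Hypothesis lyap : A *m V + V *m A^T = - (s *: (delta_vec p *m (delta_vec p)^T)).
Hypothesis stable : forall z : R[i], eigenvalue C z -> Re z < 0.

Lemma alpha_neq0 z : 0 < Re z -> aC.[z] != 0.
Proof.
by move=> z0; apply/negP => /eqP/alpha_eigenvalue/stable; rewrite ltNge ltW.
Qed.

(** The Lyapunov equation, multiplied by [l] and transposed, gives [(C + z) V l^T = - s (l dC) dC];
    also [(C + z) monomials (- z) = - aC.[- z] dC]. Since [- z] is not an eigenvalue, [C + z] is
    invertible and the two vectors are proportional. *)
Lemma left_eigen_gramian (l : 'rV[R[i]]_p) z : Re z < 0 -> l *m C = z *: l ->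
  aC.[- z] * (l *m VC *m beC) 0 0 = s%:C * (l *m dC) 0 0 * bC.[- z].
Proof.
move=> z0 lC.
have lyapC : C *m VC + VC *m C^T = - (s%:C *: (dC *m dC^T)).
  have := congr1 toC lyap.
  by rewrite map_mxD map_mxN !map_mxM map_mxZ map_mxM !map_trmx.
have VCT : VC^T = VC by rewrite /VC map_trmx VT.
have Nz0 : 0 < Re (- z) by rewrite Re_opp oppr_gt0.
have Cu : C - (- z)%:M \in unitmx.
  by apply: eigenvalueN_unit; apply/negP => /stable; rewrite ltNge ltW.
pose t := VC *m l^T.
have e1 : (C - (- z)%:M) *m t = - (s%:C * (l *m dC) 0 0) *: dC.
  have h := congr1 (fun M => (l *m M)^T) lyapC.
  rewrite /= mulmxDr mulmxA lC -scalemxAl mulmxN -scalemxAr mulmxA in h.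
  rewrite linearD linearZ linearN linearZ /= !trmx_mul !trmxK VCT in h.
  rewrite mulmxBl mul_scalar_mx scaleNr opprK addrC /t h.
  rewrite scaleNr; congr (- _); rewrite -scalerA; congr (_ *: _).
  by rewrite -mulmxA -trmx_mul [in LHS](mx11_scalar (l *m dC)) tr_scalar_mx mul_mx_scalar.
have e2 : (C - (- z)%:M) *m monomials (- z) = - aC.[- z] *: dC.
  by rewrite mulmxBl companion_monomials mul_scalar_mx addrAC subrr add0r scaleNr.
have e3 : aC.[- z] *: t = (s%:C * (l *m dC) 0 0) *: monomials (- z).
  rewrite -[LHS](mulKmx Cu) -[RHS](mulKmx Cu); congr (_ *m _).
  by rewrite -!scalemxAr e1 e2 !scalerA !mulrN mulrC.
have e4 : (l *m VC *m beC) 0 0 = (beC^T *m t) 0 0.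
  have <- : (l *m VC *m beC)^T 0 0 = (l *m VC *m beC) 0 0 by rewrite mxE.
  by rewrite !trmx_mul VCT.
have e5 := congr1 (fun M : 'cV[R[i]]_p => (beC^T *m M) 0 0) e3.
rewrite /= -!scalemxAr in e5.
by rewrite e4 -(beta_monomials _ qp) -/b -/beC; move: e5; rewrite mxE [RHS]mxE.
Qed.

Variable lam : 'I_p -> R[i].
Hypothesis lam_inj : injective lam.
Hypothesis lam_eig : forall i, eigenvalue C (lam i).

Let M : 'M[R[i]]_p := \matrix_(i, j) lam j ^+ i.

Let M_unit : M \in unitmx.
Proof.
have -> : M = Vandermonde p (\row_j lam j).
  by apply/matrixP => i j; rewrite !mxE.
rewrite unitmxE det_Vandermonde unitfE prodf_seq_neq0; apply/allP => i _.
rewrite implyTb prodf_seq_neq0; apply/allP => j _; apply/implyP => ij.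
rewrite !mxE subr_eq0; apply: contraTneq ij => /lam_inj ->.
by rewrite ltnn.
Qed.

Lemma monomials_eigen j : C *m monomials (lam j) = lam j *: monomials (lam j).
Proof. by rewrite companion_monomials eigenvalue_alpha// scale0r subr0. Qed.

(** Its rows are the left eigenvectors dual to the [monomials (lam j)]. *)
Let W := invmx M.

Let rowW i j : (row i W *m monomials (lam j)) 0 0 = (i == j)%:R.
Proof.
have := congr1 (fun N : 'M[R[i]]_p => N i j) (mulVmx M_unit); rewrite /= mxE [RHS]mxE => <-.
by rewrite mxE; apply: eq_bigr => k _; rewrite !mxE.
Qed.

Let mulM (X : 'rV[R[i]]_p) j : (X *m M) 0 j = (X *m monomials (lam j)) 0 0.
Proof. by rewrite mxE [RHS]mxE; apply: eq_bigr => k _; rewrite !mxE. Qed.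

Let rowW_C i : row i W *m C = lam i *: row i W.
Proof.
apply: (can_inj (mulmxK M_unit)); apply/rowP => j; rewrite !mulM -mulmxA.
rewrite monomials_eigen -scalemxAr -scalemxAl [LHS]mxE [RHS]mxE rowW.
by case: eqP => [->|]; rewrite ?mulr0.
Qed.

(** Pairing [companion_dmonomials] with the left eigenvector cancels the terms in [dmonomials] and
    leaves the normalization [rowW j j = 1]. *)
Let rowW_delta j : aC^`().[lam j] * (row j W *m dC) 0 0 = 1.
Proof.
have e := congr1 (fun N => row j W *m N) (companion_dmonomials (lam j)).
rewrite /= mulmxA rowW_C mulmxBr mulmxDr -scalemxAl -!scalemxAr addrAC in e.
move: e; rewrite -[LHS]add0r => /addIr/esym/eqP; rewrite subr_eq0 => /eqP e.
have := congr1 (fun N : 'M[R[i]]_1 => N 0 0) e.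
by rewrite /= rowW eqxx mxE.
Qed.

Lemma spectral_form (N : 'M[R]_p) (th : 'I_p -> R[i]) :
  (forall j, toC N *m monomials (lam j) = th j *: monomials (lam j)) ->
  ((b^T *m A *m N *m V *m b) 0 0)%:C =
  s%:C * \sum_j bC.[lam j] * bC.[- lam j] / (aC^`().[lam j] * aC.[- lam j]) * (lam j * th j).
Proof.
move=> Nr.
have -> : ((b^T *m A *m N *m V *m b) 0 0)%:C = (beC^T *m (C *m (toC N *m (VC *m beC)))) 0 0.
  have <- : (toC (b^T *m A *m N *m V *m b)) 0 0 = ((b^T *m A *m N *m V *m b) 0 0)%:C.
    by rewrite mxE.
  by rewrite !map_mxM -map_trmx !mulmxA.
(* Expansion of [V b] on the eigenbasis; its coefficients are pairings with left eigenvectors, as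
   treated by [left_eigen_gramian]. *)
have e : VC *m beC = \sum_j (row j W *m VC *m beC) 0 0 *: monomials (lam j).
  rewrite -[LHS](mulKVmx M_unit) -/W; apply/colP => i.
  rewrite mxE summxE; apply: eq_bigr => j _.
  rewrite [RHS]mxE [M i j]mxE [monomials _ i 0]mxE mulrC; congr (_ * _).
  by rewrite -[in RHS]mulmxA -row_mul [RHS]mxE.
rewrite e !mulmx_sumr summxE mulr_sumr; apply: eq_bigr => j _.
rewrite -scalemxAr Nr scalerA -scalemxAr monomials_eigen scalerA -scalemxAr mxE beta_monomials//.
have lj0 : Re (lam j) < 0 by exact/stable/lam_eig.
have an0 : aC.[- lam j] != 0 by apply: alpha_neq0; rewrite Re_opp oppr_gt0.
have L := left_eigen_gramian lj0 (rowW_C j).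
have D := rowW_delta j.
have dn0 : aC^`().[lam j] != 0.
  by apply: contra_eq_neq D => ->; rewrite mul0r eq_sym oner_neq0.
have -> : (row j W *m VC *m beC) 0 0 =
    s%:C * bC.[- lam j] / (aC^`().[lam j] * aC.[- lam j]).
  apply: (mulfI an0); rewrite L.
  have -> : (row j W *m dC) 0 0 = (aC^`().[lam j])^-1.
    by apply: (mulfI dn0); rewrite D mulfV.
  by field; rewrite an0 dn0.
by field; rewrite an0 dn0.
Qed.

End spectral_form.

(** * The spectral formula and the complete statement *)

Lemma autocov_spectral d (T : measurableType d) (R : realType) (P : probability T R)
    (H : R) (B : R -> {RV P >-> R}) (p' q : nat) (alpha beta : nat -> R) (sigma : R)
    (Y : R -> {RV P >-> R}) (p := p'.+1) (lam : 'I_p -> R[i]) (t h : R) :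
  0 < H -> fractional_brownian_motion H B -> (q < p)%N ->
  stationary_carfima p q alpha beta sigma B Y ->
  injective lam -> (forall i, eigenvalue (companionC p alpha) (lam i)) -> 0 <= h ->
  (fine (autocov Y t h))%:C =
  (sigma ^+ 2 / 2 * Gamma (2 * H + 1))%:C *
  \sum_(i < p)
    (beta_polyC q beta).[lam i] * (beta_polyC q beta).[- lam i] /
      ((alpha_polyC p alpha)^`().[lam i] * (alpha_polyC p alpha).[- lam i])
    * ufun H (lam i) h.
Proof.
move=> H0 fB qp sY linj leig h0; have a0 : 0 < 2 * H by rewrite mulr_gt0.
have [c c0 Adec] := carfima_decay sY.
rewrite (autocovE H0 fB sY) [fine _]/=.
have lj0 j : complex.Re (lam j) < 0 by exact/sY.1/leig.
have N j := Theta_eigen (monomials_eigen leig j) a0 c0 Adec (lj0 j) h0.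
rewrite (@spectral_form _ p' q alpha beta _ _ qp (Vstar_sym sY) (Vstar_lyapunov sY) sY.1 lam linj leig _ _ N).
(* [Gamma(2H + 1) = 2 H Gamma(2H)]: the factor [H] belongs to [Theta], and [Gamma(2H)] turns the
   scalar integrals into [ufun]. *)
have -> : (sigma ^+ 2 / 2 * Gamma (2 * H + 1))%:C =
    (sigma ^+ 2)%:C * ((2 * H / 2)%:C * (Gamma (2 * H))%:C).
  by rewrite -!rmorphM GammaS//; congr (_%:C); field.
rewrite -[RHS]mulrA; congr (_ * _); rewrite mulr_sumr; apply: eq_bigr => j _.
rewrite [RHS]mulrCA; congr (_ * _).
by rewrite -[RHS]mulrA (ufunE H0 (lj0 j) h0) mulrCA.
Qed.

Theorem theorem2 (d : measure_display) (T : measurableType d) (R : realType)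
    (P : probability T R) (H : R) (B : R -> {RV P >-> R})
    (p q : nat) (alpha beta : nat -> R) (sigma : R) (Y : R -> {RV P >-> R}) :
  0 < H < 1 ->
  fractional_brownian_motion H B ->
  (1 <= p)%N -> (q < p)%N ->
  alpha 1%N != 0 -> ((1 <= q)%N -> beta q != 0) ->
  0 < sigma ->
  stationary_carfima p q alpha beta sigma B Y ->
  let A := companion p alpha in
  let bv := beta_vec p q beta in
  let V := Vstar p alpha sigma in
  let aC := alpha_polyC p alpha in
  let bC := beta_polyC q beta in
  forall t : R,
  [/\ (* (a) *)
      forall h : R, 0 <= h ->
        autocov Y t h =
        (H * (bv^T *m A *m expmx (h *: A)
                *m mxRintegral `[0, h]
                     (fun u => u `^ (2 * H - 1) *: expmx (- u *: A))
                *m V *m bv) 0 0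
         - H * (bv^T *m A *m expmx (- h *: A)
                *m mxRintegral `[h, +oo[
                     (fun u => u `^ (2 * H - 1) *: expmx (u *: A))
                *m V *m bv) 0 0
         - H * (bv^T *m A *m expmx (h *: A)
                *m mxRintegral `[0, +oo[
                     (fun u => u `^ (2 * H - 1) *: expmx (u *: A))
                *m V *m bv) 0 0)%:E,
      (* (b) *)
      forall lam : 'I_p -> R[i],
        injective lam -> (forall i, eigenvalue (companionC p alpha) (lam i)) ->
        forall h : R, 0 <= h ->
          (fine (autocov Y t h))%:C =
          (sigma ^+ 2 / 2 * Gamma (2 * H + 1))%:C *
          \sum_(i < p)
            bC.[lam i] * bC.[- lam i] / (aC^`().[lam i] * aC.[- lam i])
            * ufun H (lam i) h
    & (* (c) *)
      H != 2^-1 ->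
      fine (autocov Y t h) /
        (sigma ^+ 2 * H * (2 * H - 1)
         * ((beta_poly q beta).[0] ^+ 2 / (alpha_poly p alpha).[0] ^+ 2)
         * h `^ (2 * H - 2)) @[h --> +oo] --> (1 : R)].
Proof.
move=> /andP[H0 H1] fB; case: p => // p' _ qp alpha10 _ sigma0 sY A bv V aC bC t; split.
- by move=> h h0; exact: (autocov_integrals H0 fB sY t h0).
- by move=> lam linj leig h h0; exact: (autocov_spectral t H0 fB qp sY linj leig h0).
- by move=> H2; exact: (autocov_asymptotic H0 H1 sigma0 fB sY alpha10 t H2).
Qed.
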